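(* Let $q$ be a complex number with $0<|q|<1$. Then $$\sum_{i,j,k\geq 0} \frac{q^{3i^2+3j^2+3k^2-2ij-2ik-2jk}}{(q^4;q^4)_i(q^4;q^4)_j(q^4;q^4)_k}=\frac{J_6^5J_{28,60}}{J_3^2J_4^2J_{12}^2}+2q^3\frac{J_2^2J_3J_{12}J_{12,60}}{J_1J_4^3J_6}-q^4\frac{J_6^5J_{8,60}}{J_3^2J_4^2J_{12}^2}$$ and $$\sum_{i,j,k\geq 0} \frac{q^{3i^2+3j^2+3k^2-2ij-2ik-2jk-2i+2j-2k}}{(q^4;q^4)_i(q^4;q^4)_j(q^4;q^4)_k}=2\frac{J_2^2J_3J_{12}J_{24,60}}{J_1J_4^3J_6}+q\frac{J_6^5J_{16,60}}{J_3^2J_4^2J_{12}^2}+q^5\frac{J_6^5J_{4,60}}{J_3^2J_4^2J_{12}^2},$$ where the sums run over all nonnegative integers $i,j,k$.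
   Context: Notation: for $n\in\{0,1,2,\dots\}\cup\{\infty\}$, $(a;q)_n:=\prod_{k=0}^{n-1}(1-aq^k)$ and $(a_1,\dots,a_m;q)_n:=(a_1;q)_n\cdots(a_m;q)_n$. Further, $J_m:=(q^m;q^m)_\infty$ and $J_{a,m}:=(q^a,q^{m-a},q^m;q^m)_\infty$. *)

(* Defs.v *)
From HB Require Import structures.
From mathcomp Require Import all_boot all_order all_algebra.
From mathcomp Require Import finmap complex.
From mathcomp Require Import boolp classical_sets reals topology normedtype.
From mathcomp.analysis.showcase Require Import summability.

Set Implicit Arguments.
Unset Strict Implicit.
Unset Printing Implicit Defensive.

Import Order.TTheory GRing.Theory Num.Theory.
Import numFieldNormedType.Exports.

Local Open Scope classical_set_scope.
Local Open Scope ring_scope.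

(* These definitions are meant for R[i] with R : realType. They take any
   numFieldType because Mathcomp-Analysis puts the norm topology on a variable
   numFieldType, while R[i] itself has no declared topology. *)

Definition qpoch {C : numFieldType} (a q : C) (n : nat) : C :=
  \prod_(0 <= k < n) (1 - a * q ^+ k).

(* In R[i] this sequence converges whenever `|q| < 1, so that lim does not
   take its default value. *)
Definition qpoch_inf {C : numFieldType} (a q : C) : C :=
  lim (qpoch a q @ \oo).

Definition J {C : numFieldType} (q : C) (m : nat) : C :=
  qpoch_inf (q ^+ m) (q ^+ m).

(* J_{a,m} = (q^a, q^(m-a), q^m; q^m)_oo, with m - a taken in the integers. *)
Definition Jp {C : numFieldType} (q : C) (a m : nat) : C :=
  qpoch_inf (q ^+ a) (q ^+ m) * qpoch_inf (q ^ (m%:Z - a%:Z)) (q ^+ m)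
  * qpoch_inf (q ^+ m) (q ^+ m).

(* Unordered summation: the sums over finite sets of triples tend to s along
   the finite sets ordered by inclusion. In R[i] this is equivalent to absolute
   convergence with sum s. *)
Definition sums_to3 {C : numFieldType} (f : nat -> nat -> nat -> C) (s : C) :=
  partial_sum (fun t : nat * nat * nat => f t.1.1 t.1.2 t.2) @ totally --> s.

(* Main.v *)
(** With [p = q^4], the two sums are [T_0] and [q^-1 T_1], where [T_m] is the sum
    of [q^(2(i-k)^2 + 2j^2 + (i+k-j-m)^2) / ((p;p)_i (p;p)_j (p;p)_k)]. Grouping
    the terms by [i + k] shows that [T_m] satisfies a linear recurrence of order
    three, and that [e^m (T_m + e T_(m+1))] has an explicit limit for [e = 1] and
    [e = -1]. The generating functions of [T] at the powers of [tau = e q^2] solve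
    the recurrence: they express the limit as a combination of [T_0] and [T_1],
    whose coefficients are sums over a Bailey pair and hence theta functions.
    Write [th x y] for the sum of [x^(n^2) y^n] over the integers. With
    [eta^2 = - tau], this is the equation
      [th (eta^5) (-eta) T_0 + e th (eta^5) (-eta^3) T_1 = (p;p)_oo * limit].
    The right-hand sides of the theorem satisfy the same two equations. This
    follows from identities between products of two theta functions, each
    obtained by splitting a double series along the cosets of a sublattice of
    Z^2. The determinant of the system is, up to a constant, again a product
    [th y y * th z z], which does not vanish. *)

Require Import Defs.
From HB Require Import structures.
From mathcomp Require Import all_boot all_order all_algebra.
From mathcomp Require Import finmap complex.
From mathcomp Require Import boolp classical_sets reals topology normedtype sequences.
From mathcomp.analysis.showcase Require Import summability.
From mathcomp Require Import ring lra zify.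

Set Implicit Arguments.
Unset Strict Implicit.
Unset Printing Implicit Defensive.

Import Order.TTheory GRing.Theory Num.Theory.
Import numFieldNormedType.Exports.

Local Open Scope ring_scope.
Local Open Scope complex_scope.

(** * Unordered summation *)

(** The exponent is written in this way because [i] and [k] then meet [j] only through [z = i + k]:
    each sum is a convolution of a sum over pairs with a sum over [j], and both factors satisfy
    recurrences of their own. The generating function of [T] need not converge at 1; in the chain of
    equations between its values at powers of [p], the limit of [e^m (T_m + e T_(m+1))] takes the
    place of that first value. For [e = -1] one may take [eta = q], for [e = 1] a square root of -1
    times [q]. The modulus 60 has this origin. The Bailey sums have base [eta^5]: four powers come
    from [p = eta^4], one from the pair itself. The identity that links them to the right-hand sides
    lives at a cube root [x] of [eta], where the bases are [x^15 = eta^5] and [x^10]; dissecting the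
    latter modulo 3 gives [eta^30], whose triple products have base [eta^60]. All exponents that
    occur there are 2 modulo 4, so these functions take the same values for both choices of [eta].
    This is why one pair of right-hand sides can satisfy both equations. *)

(* The theory is developed over an abstract complete normed field, since over
   [R[i]] unification keeps unfolding the complex operations. The norm takes
   values in [R], where the order is total. *)
Structure valField (R : realType) := ValField {
  vf_sort :> numClosedFieldType;
  nrm : vf_sort -> R;
  nrm_ge0 : forall x, 0 <= nrm x;
  nrm_eq0 : forall x, (nrm x == 0) = (x == 0);
  nrmM : forall x y, nrm (x * y) = nrm x * nrm y;
  nrmD : forall x y, nrm (x + y) <= nrm x + nrm y
}.
Arguments nrm {R} {v} x : simpl never.

Section Norm.
Context {R : realType} {C : valField R}.
Implicit Types (x y : C).

Lemma nrm0 : nrm (0 : C) = 0.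
Proof. by apply/eqP; rewrite nrm_eq0. Qed.

Lemma nrm_gt0 x : (0 < nrm x) = (x != 0).
Proof. by rewrite lt_def nrm_ge0 andbT nrm_eq0. Qed.

Lemma nrm1 : nrm (1 : C) = 1.
Proof.
have n1 : nrm (1 : C) != 0 by rewrite nrm_eq0 oner_eq0.
by apply: (mulfI n1); rewrite -nrmM !mulr1.
Qed.

Lemma nrmN x : nrm (- x) = nrm x.
Proof.
suff n1 : nrm (-1 : C) = 1 by rewrite -mulN1r nrmM n1 mul1r.
have /eqP : nrm (-1 : C) ^+ 2 = 1 by rewrite expr2 -nrmM mulrNN mulr1 nrm1.
by rewrite sqrf_eq1 => /orP[/eqP //|/eqP n1]; have := nrm_ge0 (-1 : C); rewrite n1; lra.
Qed.

Lemma nrmV x : nrm x^-1 = (nrm x)^-1.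
Proof.
have [->|x0] := eqVneq x 0; first by rewrite invr0 nrm0 invr0.
have nx0 : nrm x != 0 by rewrite nrm_eq0.
by apply: (mulfI nx0); rewrite -nrmM !divff // nrm1.
Qed.

Lemma nrmB x y : nrm (x - y) <= nrm x + nrm y.
Proof. by rewrite -(nrmN y) nrmD. Qed.

Lemma nrm_distC x y : nrm (x - y) = nrm (y - x).
Proof. by rewrite -nrmN opprB. Qed.

Lemma nrmX x n : nrm (x ^+ n) = nrm x ^+ n.
Proof. by elim: n => [|n IH]; rewrite ?expr0 ?nrm1 // !exprS nrmM IH. Qed.

Lemma nrmXz x (n : int) : nrm (x ^ n) = nrm x ^ n.
Proof. by case: n => n; rewrite ?NegzE -?invr_expz ?nrmV ?nrmX. Qed.

Lemma nrm_sum (I : Type) (s : seq I) (F : I -> C) :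
  nrm (\sum_(i <- s) F i) <= \sum_(i <- s) nrm (F i).
Proof.
elim/big_rec2: _ => [|i y1 y2 _ IH]; first by rewrite nrm0.
by rewrite (le_trans (nrmD _ _)) // lerD2l.
Qed.

Lemma nrm_eps0 x : (forall e : R, 0 < e -> nrm x < e) -> x = 0.
Proof.
move=> H; apply/eqP; rewrite -nrm_eq0 eq_le nrm_ge0 andbT.
by apply/ler_addgt0Pl => e /H /ltW; rewrite addr0.
Qed.

End Norm.

Section HasSum.
Context {R : realType} {C : valField R}.

Definition has_sum (I : choiceType) (f : I -> C) (s : C) :=
  forall e : R, 0 < e -> exists A : {fset I},
    forall B : {fset I}, (A `<=` B)%fset -> nrm (\sum_(i <- B) f i - s) < e.

Definition rsummable (I : choiceType) (g : I -> R) :=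
  exists M : R, forall B : {fset I}, \sum_(i <- B) g i <= M.

Definition summable (I : choiceType) (f : I -> C) :=
  exists M : R, forall B : {fset I}, \sum_(i <- B) nrm (f i) <= M.

(** The value is 0 for a family without a sum; under completeness, [tsumP] makes it the sum of every
    summable family. *)
Definition tsum (I : choiceType) (f : I -> C) : C := xget 0 [set s | has_sum f s]%classic.

Section OneIndex.
Variable I : choiceType.
Implicit Types (f g : I -> C) (s t : C).

Lemma has_sum_uniq f s t : has_sum f s -> has_sum f t -> s = t.
Proof.
move=> fs ft; apply/eqP; rewrite -subr_eq0; apply/eqP/nrm_eps0 => e e0.
have e2 : 0 < e / 2 by rewrite divr_gt0.
have [A HA] := fs _ e2; have [B HB] := ft _ e2.
have {}HA := HA (A `|` B)%fset (fsubsetUl _ _).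
have {}HB := HB (A `|` B)%fset (fsubsetUr _ _).
set S := \sum_(i <- _) _ in HA HB.
rewrite (_ : s - t = (S - t) - (S - s)); last by ring.
by rewrite (le_lt_trans (nrmB _ _)) // (splitr e) ltrD.
Qed.

Lemma has_sum_eq f g s : f =1 g -> has_sum f s -> has_sum g s.
Proof. by move=> /funext ->. Qed.

Lemma has_sumD f g s t :
  has_sum f s -> has_sum g t -> has_sum (fun i => f i + g i) (s + t).
Proof.
move=> fs gt e e0; have e2 : 0 < e / 2 by rewrite divr_gt0.
have [A HA] := fs _ e2; have [B HB] := gt _ e2.
exists (A `|` B)%fset => D; rewrite fsubUset => /andP[/HA {}HA /HB {}HB].
by rewrite big_split /= opprD addrACA (le_lt_trans (nrmD _ _)) // (splitr e) ltrD.
Qed.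

Lemma has_sumZ (a : C) f s : has_sum f s -> has_sum (fun i => a * f i) (a * s).
Proof.
move=> fs e e0; have [->|a0] := eqVneq a 0.
  exists fset0 => B _; rewrite mul0r subr0 big1 ?nrm0 // => i _; exact: mul0r.
have na : 0 < nrm a by rewrite nrm_gt0.
have [A HA] := fs (e / nrm a) (divr_gt0 e0 na); exists A => B /HA h.
by rewrite -mulr_sumr -mulrBr nrmM mulrC -ltr_pdivlMr.
Qed.

Lemma has_sumN f s : has_sum f s -> has_sum (fun i => - f i) (- s).
Proof.
by move=> /(has_sumZ (-1)); rewrite mulN1r; apply: has_sum_eq => i; rewrite mulN1r.
Qed.

Lemma has_sumB f g s t :
  has_sum f s -> has_sum g t -> has_sum (fun i => f i - g i) (s - t).
Proof. by move=> fs /has_sumN; exact: has_sumD. Qed.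

Lemma has_sum0 : has_sum (fun _ : I => 0) 0.
Proof. by move=> e e0; exists fset0 => B _; rewrite big1 // subr0 nrm0. Qed.

Lemma has_sum_bound f s (M : R) :
  has_sum f s -> (forall B : {fset I}, \sum_(i <- B) nrm (f i) <= M) -> nrm s <= M.
Proof.
move=> fs HM; apply/ler_addgt0Pr => e e0; have [A HA] := fs e e0.
rewrite (_ : s = \sum_(i <- A) f i - (\sum_(i <- A) f i - s)); last by ring.
rewrite (le_trans (nrmB _ _)) // lerD ?(ltW (HA _ (fsubset_refl _))) //.
by rewrite (le_trans (nrm_sum _ _)).
Qed.

Lemma ler_sum_fset (g : I -> R) (A B : {fset I}) :
  (forall i, 0 <= g i) -> (A `<=` B)%fset -> \sum_(i <- A) g i <= \sum_(i <- B) g i.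
Proof.
move=> g0 AB.
have -> : \sum_(i <- A) g i = \sum_(i <- A) (if i \in A then g i else 0).
  by apply: eq_big_seq => i ->.
rewrite (big_fset_incl _ AB); last by move=> i _ /negPf ->.
by apply: ler_sum => i _; case: ifP.
Qed.

Lemma tsumE f s : has_sum f s -> tsum f = s.
Proof. move=> fs; rewrite /tsum; case: xgetP => [t _ ft|/(_ s)//].
exact: has_sum_uniq ft fs. Qed.

Lemma eq_tsum f g : f =1 g -> tsum f = tsum g.
Proof. by move=> /funext ->. Qed.

Lemma eq_summable f g : f =1 g -> summable f -> summable g.
Proof. by move=> /funext ->. Qed.

Lemma summable_le f g : summable g -> (forall i, nrm (f i) <= nrm (g i)) -> summable f.
Proof. by move=> [M HM] fg; exists M => B; rewrite (le_trans _ (HM B)) // ler_sum. Qed.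

Lemma summableZ (a : C) f : summable f -> summable (fun i => a * f i).
Proof.
move=> [M HM]; exists (nrm a * M) => B.
under eq_bigr do rewrite nrmM.
by rewrite -mulr_sumr ler_wpM2l ?nrm_ge0.
Qed.

Lemma summable_leZ (K : R) (g : I -> R) f : rsummable g ->
  0 <= K -> (forall i, nrm (f i) <= K * g i) -> summable f.
Proof.
move=> [M HM] K0 fg; exists (K * M) => B; apply: le_trans (ler_wpM2l K0 (HM B)).
by rewrite mulr_sumr ler_sum.
Qed.

Lemma rsummableZ (K : R) (g : I -> R) : 0 <= K -> rsummable g -> rsummable (fun i => K * g i).
Proof.
move=> K0 [M HM]; exists (K * M) => B; apply: le_trans (ler_wpM2l K0 (HM B)).
by rewrite mulr_sumr ler_sum.
Qed.

Lemma summableD f g : summable f -> summable g -> summable (fun i => f i + g i).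
Proof.
move=> [M HM] [N HN]; exists (M + N) => B; apply: le_trans (lerD (HM B) (HN B)).
by rewrite -big_split ler_sum //= => i _; exact: nrmD.
Qed.

Lemma summableN f : summable f -> summable (fun i => - f i).
Proof. by move=> fs; apply: summable_le fs _ => i; rewrite nrmN. Qed.

Lemma summableB f g : summable f -> summable g -> summable (fun i => f i - g i).
Proof. by move=> fs /summableN; exact: summableD. Qed.

End OneIndex.

Lemma sum_imfset (V : zmodType) (I J : choiceType) (h : I -> J) (G : J -> V) (B : {fset I}) :
  injective h -> \sum_(j <- (h @` B)%fset) G j = \sum_(i <- B) G (h i).
Proof. by move=> hI; rewrite big_imfset //= => x y _ _; exact: hI. Qed.

(** The map need not be onto, only its image must contain the support of [f]. This lets sums over
    [nat] be treated as sums over [int] whose terms vanish at negative indices. *)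
Lemma has_sum_reindex (I J : choiceType) (h : I -> J) (h' : J -> I) (f : J -> C) s :
  cancel h h' -> (forall j, f j != 0 -> h (h' j) = j) ->
  has_sum f s -> has_sum (fun i => f (h i)) s.
Proof.
move=> hK h'K fs e e0; have [A HA] := fs e e0.
exists (h' @` A)%fset => B AB.
rewrite -(sum_imfset f B (can_inj hK)).
rewrite (@big_fset_incl _ _ _ _ _ (A `|` h @` B)%fset) ?fsubsetUr //; last first.
  move=> j; rewrite in_fsetU => /orP[jA jB|-> //].
  apply/eqP; apply: contraNT jB => /h'K hj; rewrite -hj; apply: in_imfset.
  by apply: (fsubsetP AB); exact: in_imfset.
by apply: HA; exact: fsubsetUl.
Qed.

Lemma sum_inj_le (I J : choiceType) (h : I -> J) (f : J -> C) (M : R) :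
  injective h -> (forall B : {fset J}, \sum_(j <- B) nrm (f j) <= M) ->
  forall B : {fset I}, \sum_(i <- B) nrm (f (h i)) <= M.
Proof.
move=> hI HM B; rewrite -(sum_imfset (fun j => nrm (f j)) B hI); exact: HM.
Qed.

Lemma summable_inj (I J : choiceType) (h : I -> J) (f : J -> C) :
  injective h -> summable f -> summable (fun i => f (h i)).
Proof. by move=> hI [M HM]; exists M; exact: sum_inj_le. Qed.

Lemma has_sum_fin (I : finType) (f : I -> C) : has_sum f (\sum_i f i).
Proof.
move=> e e0; exists [fset x in I]%fset => B AB.
rewrite (_ : \sum_(i <- B) f i = \sum_i f i) ?subrr ?nrm0 //.
apply: perm_big; apply: uniq_perm; rewrite ?fset_uniq ?index_enum_uniq // => i.
by rewrite mem_index_enum; apply: (fsubsetP AB); rewrite inE.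
Qed.

End HasSum.

(** * The complex numbers as a complete valued field *)

Section ComplexNumbers.
Context (R : realType).
Local Notation normc := ComplexField.Normc.normc.

Lemma normc_ge0 (x : R[i]) : 0 <= normc x.
Proof. by case: x => a b /=; exact: sqrtr_ge0. Qed.

Lemma normc_eq0 (x : R[i]) : (normc x == 0) = (x == 0).
Proof.
apply/eqP/eqP => [/ComplexField.Normc.eq0_normc //|->].
exact: ComplexField.Normc.normc0.
Qed.

Definition complex_valField : valField R :=
  @ValField R R[i] (@ComplexField.Normc.normc R) normc_ge0 normc_eq0 (@ComplexField.Normc.normcM R) (@le_normcD R).

Local Notation C := complex_valField.

Lemma nrmE (x : R[i]) : `|x| = (nrm (x : C))%:C.
Proof. by rewrite normc_def; case: x. Qed.

Lemma nrm_real_complex (a : R) : nrm (a%:C : C) = `|a|.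
Proof. by rewrite /nrm /= expr0n addr0 sqrtr_sqr. Qed.

Lemma sum_real_complex (I : Type) (s : seq I) (g : I -> R) :
  \sum_(i <- s) (g i)%:C = (\sum_(i <- s) g i)%:C.
Proof. by rewrite (rmorph_sum (real_complex R)). Qed.

Lemma nrm_real_complexB (a b : R) : nrm (a%:C - b%:C : C) = `|a - b|.
Proof. by rewrite -(rmorphB (real_complex R)) nrm_real_complex. Qed.

Lemma nrm_Re (x : R[i]) : `|complex.Re x| <= nrm (x : C).
Proof.
case: x => a b; rewrite /nrm /= -sqrtr_sqr ler_sqrt ?lerDl ?sqr_ge0 //.
by rewrite addr_ge0 ?sqr_ge0.
Qed.

Lemma nrm_Im (x : R[i]) : `|complex.Im x| <= nrm (x : C).
Proof.
case: x => a b; rewrite /nrm /= -sqrtr_sqr ler_sqrt ?lerDr ?sqr_ge0 //.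
by rewrite addr_ge0 ?sqr_ge0.
Qed.

Lemma has_sum_pos (I : choiceType) (g : I -> R) (M : R) :
  (forall i, 0 <= g i) -> (forall B : {fset I}, \sum_(i <- B) g i <= M) ->
  exists s : R, has_sum (fun i => (g i)%:C : C) (s%:C : C).
Proof.
move=> g0 gM; set S := [set \sum_(i <- B) g i | B in [set: {fset I}]]%classic.
have hS : has_sup S.
  split; first by exists (\sum_(i <- fset0) g i); exists fset0.
  by exists M => _ [B _ <-].
have ub (B : {fset I}) : \sum_(i <- B) g i <= sup S by apply: ub_le_sup; [exact: hS.2 | exists B].
exists (sup S) => e e0; have [_ [A _ <-] HA] := sup_adherent e0 hS.
exists A => B AB; rewrite sum_real_complex nrm_real_complexB distrC ger0_norm ?subr_ge0 //.
rewrite ltrBlDr -ltrBlDl (lt_le_trans HA) //; exact: ler_sum_fset.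
Qed.

Lemma complex_complete (I : choiceType) (f : I -> C) :
  summable f -> exists s, has_sum f s.
Proof.
move=> [M HM].
have real_sum (a : I -> R) : (forall i, `|a i| <= nrm (f i)) ->
    exists s : R, has_sum (fun i => (a i)%:C : C) s%:C.
  move=> af.
  have abs_le (B : {fset I}) : \sum_(i <- B) `|a i| <= M.
    by rewrite (le_trans _ (HM B)) // ler_sum.
  have [s hs] := has_sum_pos (fun i => normr_ge0 (a i)) abs_le.
  (* A real family is the difference of the nonnegative families [a + |a|] and [|a|], to which
     [has_sum_pos] applies. *)
  have pos i : 0 <= a i + `|a i| by have := ler_norm (- a i); rewrite normrN; lra.
  have [t ht] : exists t : R, has_sum (fun i => (a i + `|a i|)%:C : C) t%:C.
    apply: (has_sum_pos (M := M + M)) => // B; rewrite big_split lerD //=.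
    by rewrite (le_trans _ (abs_le B)) // ler_sum // => i _; exact: ler_norm.
  exists (t - s); rewrite rmorphB /=; apply: has_sum_eq (has_sumB ht hs) => i.
  by rewrite rmorphD /= addrK.
have [s hs] := real_sum _ (fun i => nrm_Re (f i)).
have [t ht] := real_sum _ (fun i => nrm_Im (f i)).
exists (s%:C + 'i * t%:C); apply: has_sum_eq (has_sumD hs (has_sumZ 'i ht)) => i.
by rewrite -complexE.
Qed.

End ComplexNumbers.

(** Completeness is required only in the form in which it is used: absolute summability yields a sum
    over any index type. *)
Structure cvalField (R : realType) := CValField {
  cvf_valField :> valField R;
  cvf_complete : forall (I : choiceType) (f : I -> cvf_valField),
    summable f -> exists s, has_sum f s
}.

Definition complex_cvalField (R : realType) : cvalField R :=
  CValField (@complex_complete R).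

Lemma real_pos_sums (R : realType) (I : choiceType) (g : I -> R) (M : R) :
  (forall i, 0 <= g i) -> (forall B : {fset I}, \sum_(i <- B) g i <= M) ->
  forall e : R, 0 < e -> exists A : {fset I},
    forall B : {fset I}, [disjoint A & B]%fset -> \sum_(i <- B) g i < e.
Proof.
move=> g0 gM e e0; set S := [set \sum_(i <- B) g i | B in [set: {fset I}]]%classic.
have hS : has_sup S.
  split; first by exists (\sum_(i <- fset0) g i); exists fset0.
  by exists M => _ [B _ <-].
have ub (B : {fset I}) : \sum_(i <- B) g i <= sup S by apply: ub_le_sup; [exact: hS.2 | exists B].
have [_ [A _ <-] HA] := sup_adherent e0 hS; exists A => B dAB.
have := ub (A `|` B)%fset.
have -> : \sum_(i <- (A `|` B)%fset) g i = \sum_(i <- A) g i + \sum_(i <- B) g i.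
  rewrite -big_cat; apply: perm_big; apply: uniq_perm => [||i].
  - exact: fset_uniq.
  - rewrite cat_uniq !fset_uniq /= andbT; apply/hasPn => i iB; apply/negP => iA.
    by have := fdisjointP dAB _ iA; rewrite iB.
  - by rewrite mem_cat in_fsetU.
by move: HA; lra.
Qed.

Section TSum.
Context {R : realType} {C : cvalField R}.

Section OneIndex.
Variable I : choiceType.
Implicit Types (f g : I -> C).

Lemma tsumP f : summable f -> has_sum f (tsum f).
Proof. by move=> /cvf_complete[s fs]; rewrite (tsumE fs). Qed.

Lemma tsumD f g : summable f -> summable g ->
  tsum (fun i => f i + g i) = tsum f + tsum g.
Proof. by move=> /tsumP fs /tsumP gs; apply/tsumE/has_sumD. Qed.

Lemma tsumB f g : summable f -> summable g ->
  tsum (fun i => f i - g i) = tsum f - tsum g.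
Proof. by move=> /tsumP fs /tsumP gs; apply/tsumE/has_sumB. Qed.

Lemma tsumZ a f : summable f -> tsum (fun i => a * f i) = a * tsum f.
Proof. by move=> /tsumP fs; apply/tsumE/has_sumZ. Qed.

Lemma tsum_bound f (M : R) :
  (forall B : {fset I}, \sum_(i <- B) nrm (f i) <= M) -> nrm (tsum f) <= M.
Proof. by move=> HM; apply: (has_sum_bound (f := f)) => //; apply: tsumP; exists M. Qed.

End OneIndex.

Lemma tsum_reindex (I J : choiceType) (h : I -> J) (h' : J -> I) (f : J -> C) :
  summable f -> cancel h h' -> (forall j, f j != 0 -> h (h' j) = j) ->
  tsum (fun i => f (h i)) = tsum f.
Proof. by move=> /tsumP fs hK h'K; exact/tsumE/(has_sum_reindex hK h'K). Qed.

Lemma tsum_bij (I J : choiceType) (h : I -> J) (h' : J -> I) (f : J -> C) :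
  summable f -> cancel h h' -> cancel h' h -> tsum (fun i => f (h i)) = tsum f.
Proof. by move=> fs hK h'K; apply: tsum_reindex fs hK _ => j _; exact: h'K. Qed.

End TSum.

(** * Double series and limits *)

Section Fubini.
Context {R : realType} {C : cvalField R}.

Lemma sum_fsetM (V : zmodType) (I J : choiceType) (A : {fset I}) (B : {fset J})
    (F : I * J -> V) :
  \sum_(x <- (A `*` B)%fset) F x = \sum_(i <- A) \sum_(j <- B) F (i, j).
Proof.
rewrite -big_allpairs; apply: perm_big; apply: uniq_perm.
- exact: fset_uniq.
- by apply: allpairs_uniq; rewrite ?fset_uniq // => -[? ?] [? ?] _ _ [-> ->].
move=> [i j]; rewrite in_fsetM; apply/andP/allpairsP => [[iA jB]|[[i' j'] /= [? ? [-> ->]]]//].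
by exists (i, j).
Qed.

(* The rows are truncated at a finite set that is good for all rows in the
   finite set [B] at once. *)
Lemma rows_approx (I J : choiceType) (f : I * J -> C) (g : I -> C) (e : R)
    (B : {fset I}) (D : {fset J}) : 0 < e ->
  (forall i, has_sum (fun j => f (i, j)) (g i)) ->
  exists2 E : {fset J}, (D `<=` E)%fset &
    \sum_(i <- B) nrm (\sum_(j <- E) f (i, j) - g i) <= e.
Proof.
move=> e0 fg; pose d := e / (size B).+1%:R.
have d0 : 0 < d by rewrite divr_gt0.
have /choice[A HA] : forall i, exists A : {fset J},
    forall E : {fset J}, (A `<=` E)%fset -> nrm (\sum_(j <- E) f (i, j) - g i) < d.
  by move=> i; exact: fg.
exists (D `|` \bigcup_(i <- B) A i)%fset; first exact: fsubsetUl.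
apply: (@le_trans _ _ (\sum_(i <- B) d)).
  rewrite big_seq [leRHS]big_seq ler_sum // => i iB; rewrite ltW // HA //.
  by rewrite (fsubset_trans _ (fsubsetUr _ _)) // bigfcup_sup.
rewrite big_const_seq count_predT iter_addr_0 -[leLHS]mulr_natr /d.
rewrite -mulrA ler_piMr ?(ltW e0) // mulrC ler_pdivrMr ?ltr0n // mul1r.
by rewrite ler_nat.
Qed.

Lemma has_sum_fubini (I J : choiceType) (f : I * J -> C) (g : I -> C) s :
  has_sum f s -> (forall i, has_sum (fun j => f (i, j)) (g i)) -> has_sum g s.
Proof.
move=> fs fg e e0; have e2 : 0 < e / 2 by rewrite divr_gt0.
have [A HA] := fs _ e2; exists [fset x.1 | x in A]%fset => B AB.
have [E DE HE] := rows_approx B [fset x.2 | x in A]%fset e2 fg.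
have /HA : (A `<=` B `*` E)%fset.
  apply/fsubsetP => x xA; rewrite in_fsetM.
  by rewrite (fsubsetP AB) ?(fsubsetP DE) //; apply/imfsetP; exists x.
rewrite sum_fsetM => {}HA.
rewrite (_ : _ - s = (\sum_(i <- B) \sum_(j <- E) f (i, j) - s)
  - \sum_(i <- B) (\sum_(j <- E) f (i, j) - g i)); last by rewrite sumrB; ring.
rewrite (le_lt_trans (nrmB _ _)) // (splitr e) ltr_leD //.
by rewrite (le_trans (nrm_sum _ _)).
Qed.

Lemma summable_row (I J : choiceType) (f : I * J -> C) i :
  summable f -> summable (fun j => f (i, j)).
Proof. by apply: (@summable_inj _ _ _ _ (fun j => (i, j)) f) => j k []. Qed.

Lemma summable_rows (I J : choiceType) (f : I * J -> C) :
  summable f -> summable (fun i => tsum (fun j => f (i, j))).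
Proof.
move=> fs; have [M HM] := fs; exists M => B; apply/ler_addgt0Pr => e e0.
have [E _ HE] := rows_approx B fset0 e0 (fun i => tsumP (summable_row i fs)).
apply: le_trans (lerD (HM (B `*` E)%fset) HE).
rewrite sum_fsetM -big_split /= ler_sum // => i _.
rewrite -[in leLHS](subrK (\sum_(j <- E) f (i, j)) (tsum _)) addrC.
by rewrite (le_trans (nrmD _ _)) // lerD ?nrm_sum // nrm_distC.
Qed.

Lemma tsum_fubini (I J : choiceType) (f : I * J -> C) : summable f ->
  tsum f = tsum (fun i => tsum (fun j => f (i, j))).
Proof.
move=> fs; symmetry; apply/tsumE/(has_sum_fubini (tsumP fs)) => i.
exact/tsumP/summable_row.
Qed.

Lemma tsum_swap (I J : choiceType) (f : I * J -> C) : summable f ->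
  tsum (fun i => tsum (fun j => f (i, j))) = tsum (fun j => tsum (fun i => f (i, j))).
Proof.
move=> fs; have sK : cancel (fun x : J * I => (x.2, x.1)) (fun x : I * J => (x.2, x.1)).
  by case.
have sK' : cancel (fun x : I * J => (x.2, x.1)) (fun x : J * I => (x.2, x.1)) by case.
rewrite -tsum_fubini // -(tsum_bij fs sK sK').
by rewrite (tsum_fubini (summable_inj (can_inj sK) fs)).
Qed.

Lemma summable_prod (I J : choiceType) (f : I -> C) (g : J -> C) :
  summable f -> summable g -> summable (fun x : I * J => f x.1 * g x.2).
Proof.
move=> [M HM] [N HN]; exists (M * N) => B.
have HB : (B `<=` [fset x.1 | x in B] `*` [fset x.2 | x in B])%fset.
  by apply/fsubsetP => x xB; rewrite in_fsetM; apply/andP; split; apply/imfsetP; exists x.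
apply: le_trans (ler_sum_fset _ HB) _ => [x|]; first exact: nrm_ge0.
rewrite sum_fsetM.
under eq_bigr do under eq_bigr do rewrite nrmM /=.
under eq_bigr do rewrite -mulr_sumr.
rewrite -mulr_suml ler_pM ?sumr_ge0 // => i _; exact: nrm_ge0.
Qed.

Lemma tsum_prod (I J : choiceType) (f : I -> C) (g : J -> C) :
  summable f -> summable g ->
  tsum (fun x : I * J => f x.1 * g x.2) = tsum f * tsum g.
Proof.
move=> fs gs; rewrite (tsum_fubini (summable_prod fs gs)) /= mulrC -tsumZ //.
by apply: eq_tsum => i; rewrite tsumZ // mulrC.
Qed.

End Fubini.

Section Limits.
Context {R : realType} {C : cvalField R}.
Implicit Types (u v : nat -> C) (l m : C).

Definition lim_to u l :=
  forall e : R, 0 < e -> exists N, forall n, (N <= n)%N -> nrm (u n - l) < e.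

Lemma eq_lim_to u v l : u =1 v -> lim_to u l -> lim_to v l.
Proof. by move=> /funext ->. Qed.

Lemma lim_to_cst l : lim_to (fun=> l) l.
Proof. by move=> e e0; exists 0%N => n _; rewrite subrr nrm0. Qed.

Lemma lim_toD u v l m : lim_to u l -> lim_to v m -> lim_to (fun n => u n + v n) (l + m).
Proof.
move=> ul vm e e0; have e2 : 0 < e / 2 by rewrite divr_gt0.
have [N HN] := ul _ e2; have [P HP] := vm _ e2; exists (maxn N P) => n.
rewrite geq_max => /andP[/HN {}HN /HP {}HP].
by rewrite opprD addrACA (le_lt_trans (nrmD _ _)) // (splitr e) ltrD.
Qed.

Lemma lim_to_bounded u l : lim_to u l -> exists M : R, forall n, nrm (u n) <= M.
Proof.
move=> /(_ 1 ltr01)[N HN]; exists (nrm l + 1 + \sum_(i < N) nrm (u i)) => n.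
have [Nn|nN] := leqP N n.
  rewrite -[u n](subrK l) (le_trans (nrmD _ _)) // addrC -addrA lerD2l.
  rewrite (le_trans (ltW (HN _ Nn))) // lerDl sumr_ge0 // => i _; exact: nrm_ge0.
rewrite -[leLHS]add0r lerD ?addr_ge0 ?nrm_ge0 //.
rewrite (bigD1 (Ordinal nN)) //= lerDl sumr_ge0 // => i _; exact: nrm_ge0.
Qed.

Lemma lim_toM u v l m : lim_to u l -> lim_to v m -> lim_to (fun n => u n * v n) (l * m).
Proof.
move=> ul vm e e0; have [M HM] := lim_to_bounded ul.
have M0 : 0 <= M := le_trans (nrm_ge0 _) (HM 0%N).
have D0 : 0 < 2 * (M + nrm m + 1) by have := nrm_ge0 m; lra.
have e2 : 0 < e / (2 * (M + nrm m + 1)) by rewrite divr_gt0.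
have [N HN] := ul _ e2; have [P HP] := vm _ e2; exists (maxn N P) => n.
rewrite geq_max => /andP[/HN {}HN /HP {}HP].
rewrite (_ : _ - _ = u n * (v n - m) + (u n - l) * m); last by ring.
rewrite (le_lt_trans (nrmD _ _)) // !nrmM.
set d := e / _ in HN HP e2.
have -> : e = d * (2 * (M + nrm m + 1)) by rewrite /d divfK // gt_eqF.
have := HM n; have := nrm_ge0 (u n); have := nrm_ge0 m.
have := nrm_ge0 (u n - l); have := nrm_ge0 (v n - m).
move: HN HP e2; move: (nrm (u n)) (nrm (v n - m)) (nrm (u n - l)) (nrm m) d => a b c k d.
by nra.
Qed.

Lemma lim_toZ (a : C) u l : lim_to u l -> lim_to (fun n => a * u n) (a * l).
Proof. exact/lim_toM/lim_to_cst. Qed.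

Lemma lim_to_uniq u l m : lim_to u l -> lim_to u m -> l = m.
Proof.
move=> ul um; apply/eqP; rewrite -subr_eq0; apply/eqP/nrm_eps0 => e e0.
have e2 : 0 < e / 2 by rewrite divr_gt0.
have [N HN] := ul _ e2; have [P HP] := um _ e2.
have {}HN := HN _ (leq_maxl N P); have {}HP := HP _ (leq_maxr N P).
set n := maxn _ _ in HN HP.
rewrite (_ : l - m = (u n - m) - (u n - l)); last by ring.
by rewrite (le_lt_trans (nrmB _ _)) // (splitr e) ltrD.
Qed.

Lemma lim_to_shift u l N : lim_to u l -> lim_to (fun n => u (n + N)%N) l.
Proof.
move=> ul e /ul[P HP]; exists P => n Pn; apply: HP; exact: leq_trans (leq_addr _ _).
Qed.

Lemma lim_to_shiftI u l N : lim_to (fun n => u (n + N)%N) l -> lim_to u l.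
Proof.
move=> ul e /ul[P HP]; exists (P + N)%N => n Pn.
by rewrite -(subnK (leq_trans (leq_addl P N) Pn)); apply: HP; lia.
Qed.

Lemma lim_toV u l : l != 0 -> lim_to u l -> lim_to (fun n => (u n)^-1) l^-1.
Proof.
move=> l0 ul e e0; have nl : 0 < nrm l by rewrite nrm_gt0.
have nl2 : 0 < nrm l / 2 by rewrite divr_gt0.
have e2 : 0 < e * (nrm l * (nrm l / 2)) by rewrite mulr_gt0 // mulr_gt0.
have [N HN] := ul _ nl2; have [P HP] := ul _ e2; exists (maxn N P) => n.
rewrite geq_max => /andP[/HN {}HN /HP {}HP].
have nu : nrm l / 2 < nrm (u n).
  have := nrmB (u n) (u n - l); rewrite subKr; lra.
have u0 : u n != 0 by rewrite -nrm_gt0 (lt_trans nl2).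
rewrite (_ : _ - _ = (l - u n) / (l * u n)); last by field; rewrite l0 u0.
rewrite nrmM nrmV nrm_distC nrmM ltr_pdivrMr; last by rewrite mulr_gt0 // (lt_trans nl2).
by rewrite (lt_le_trans HP) // ler_wpM2l ?(ltW e0) // ler_wpM2l ?(ltW nl) // ltW.
Qed.

Lemma lim_to_le0 (b : nat -> R) u :
  (forall e : R, 0 < e -> exists N, forall n, (N <= n)%N -> b n < e) ->
  (forall n, nrm (u n) <= b n) -> lim_to u 0.
Proof.
move=> b0 ub e /b0[N HN]; exists N => n /HN; rewrite subr0; exact: le_lt_trans.
Qed.

Lemma lim_to_geo (r : R) u (K : R) : 0 <= r < 1 ->
  (forall n, nrm (u n) <= K * r ^+ n) -> lim_to u 0.
Proof.
move=> /andP[r0 r1] ur; apply: lim_to_le0 ur => e e0.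
have K0 : 0 < `|K| + 1 by rewrite ltr_wpDl.
have /cvg_expr/cvgrPdist_lt/(_ _ (divr_gt0 e0 K0))[N _ HN] : `|r| < 1 by rewrite ger0_norm.
exists N => n /HN; rewrite /= sub0r normrN ger0_norm ?exprn_ge0 // ltr_pdivlMr // => h.
rewrite (le_lt_trans _ h) // mulrC ler_wpM2l ?exprn_ge0 //.
by rewrite (le_trans (ler_norm K)) // lerDl.
Qed.

Lemma lim_to_sum (I : Type) (s : seq I) (f : nat -> I -> C) (l : I -> C) :
  (forall i, lim_to (f^~ i) (l i)) ->
  lim_to (fun n => \sum_(i <- s) f n i) (\sum_(i <- s) l i).
Proof.
move=> fl; elim: s => [|i s IH].
  by rewrite big_nil; apply: eq_lim_to (lim_to_cst 0) => n; rewrite big_nil.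
rewrite big_cons; apply: eq_lim_to (lim_toD (fl i) IH) => n; by rewrite big_cons.
Qed.

Lemma sum_tail_le (I : choiceType) (f : I -> C) (A : {fset I}) (e : R) :
  summable f ->
  (forall B : {fset I}, [disjoint A & B]%fset -> \sum_(i <- B) nrm (f i) <= e) ->
  nrm (tsum f - \sum_(i <- A) f i) <= e.
Proof.
move=> fs He; apply/ler_addgt0Pl => d d0; have [B HB] := tsumP fs d0.
have {}HB := HB _ (fsubsetUr A B).
set S := \sum_(i <- _) f i in HB.
have -> : tsum f - \sum_(i <- A) f i = (S - \sum_(i <- A) f i) - (S - tsum f).
  by ring.
rewrite (le_trans (nrmB _ _)) // addrC lerD ?(ltW HB) //.
have -> : S = \sum_(i <- A) f i + \sum_(i <- (B `\` A)%fset) f i.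
  rewrite /S -big_cat; apply: perm_big; apply: uniq_perm => [||i].
  - exact: fset_uniq.
  - rewrite cat_uniq !fset_uniq /= andbT; apply/hasPn => i.
    by rewrite in_fsetD => /andP[].
  - by rewrite mem_cat in_fsetD in_fsetU; case: (i \in A).
rewrite addrAC subrr add0r; rewrite (le_trans (nrm_sum _ _)) // He //.
by apply/fdisjointP => i iA; rewrite in_fsetD iA.
Qed.

(** Dominated convergence for series: a finite set carries all of the dominating sum but [e / 3],
    hence all but [e / 3] of every [f n] and of [l], and on that set the convergence is that of a
    finite sum. *)
Lemma tannery (I : choiceType) (f : nat -> I -> C) (l : I -> C) (g : I -> R) :
  rsummable g -> (forall n i, nrm (f n i) <= g i) ->
  (forall i, lim_to (f^~ i) (l i)) -> lim_to (fun n => tsum (f n)) (tsum l).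
Proof.
move=> gs fg fl e e0; have e3 : 0 < e / 3 by rewrite divr_gt0.
have g0 i : 0 <= g i := le_trans (nrm_ge0 _) (fg 0%N i).
have lg i : nrm (l i) <= g i.
  apply/ler_addgt0Pl => d d0; have [N HN] := fl i _ d0.
  rewrite -[l i](subKr (f N i)) (le_trans (nrmB _ _)) // addrC lerD //.
  exact/ltW/HN.
have [M HM] := gs; have [A HA] := real_pos_sums g0 HM e3.
have [N HN] := lim_to_sum A fl e3; exists N => n /HN {}HN.
have tail (h : I -> C) : (forall i, nrm (h i) <= g i) ->
    nrm (tsum h - \sum_(i <- A) h i) <= e / 3.
  move=> hg; apply: sum_tail_le; first by apply: (summable_leZ gs ler01) => i; rewrite mul1r.
  by move=> B /HA /ltW; apply: le_trans; exact: ler_sum.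
have H1 := tail _ (fg n); have H2 := tail _ lg.
set a := tsum _ in H1 *; set b := \sum_(i <- A) f n i in H1 HN.
set c := tsum _ in H2 *; set d := \sum_(i <- A) l i in H2 HN.
rewrite (_ : a - c = (a - b) + (b - d) - (c - d)); last by ring.
rewrite (le_lt_trans (nrmB _ _)) //.
have := nrmD (a - b) (b - d); lra.
Qed.

End Limits.

(** * Theta functions and q-Pochhammer symbols *)

Section IntegerSums.
Context {R : realType} {C : cvalField R}.

Lemma sum_geo_le (r : R) (N : nat) : 0 <= r < 1 -> \sum_(i < N) r ^+ i <= (1 - r)^-1.
Proof.
move=> /andP[r0 r1]; have d0 : 0 < 1 - r by rewrite subr_gt0.
rewrite -[leRHS]mul1r ler_pdivlMr // mulrC.
have -> : (1 - r) * \sum_(i < N) r ^+ i = 1 - r ^+ N.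
  by rewrite -(opprB r 1) mulNr -subrX1 opprB.
by rewrite gerBl exprn_ge0.
Qed.

Lemma sum_fset_nat_le (g : nat -> R) (B : {fset nat}) : (forall i, 0 <= g i) ->
  exists N : nat, \sum_(i <- B) g i <= \sum_(i < N) g i.
Proof.
move=> g0; exists (\max_(i <- B) i).+1; set N := _.+1.
have -> : \sum_(i <- B) g i = \sum_(i <- iota 0 N | i \in B) g i.
  rewrite -[RHS]big_filter; apply: perm_big; apply: uniq_perm; first exact: fset_uniq.
    by rewrite filter_uniq // iota_uniq.
  move=> i; rewrite mem_filter mem_iota /= add0n ltnS.
  by case: (boolP (i \in B)) => //= iB; rewrite leq_bigmax_seq.
rewrite -[X in _ <= X](big_mkord xpredT) /index_iota subn0 big_mkcond /=.
by apply: ler_sum => i _; case: ifP.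
Qed.

Lemma nat_geo_sums (r : R) : 0 <= r < 1 ->
  rsummable (fun n : nat => r ^+ n).
Proof.
move=> rr; exists (1 - r)^-1 => B; have /andP[r0 _] := rr.
have [N HN] := sum_fset_nat_le B (fun i => exprn_ge0 i r0).
exact: le_trans HN (sum_geo_le _ rr).
Qed.

Lemma int_geo_sums (r : R) : 0 <= r < 1 ->
  rsummable (fun n : int => r ^+ `|n|).
Proof.
move=> rr; have [M HM] := nat_geo_sums rr; have /andP[r0 _] := rr.
exists (M + M) => B.
(* The absolute value is injective on the nonnegative and on the negative integers, so each half is
   bounded by a geometric series over [nat]. *)
have half (P : pred int) : {in P &, injective absz} -> \sum_(n <- B | P n) r ^+ `|n| <= M.
  move=> P_inj; rewrite -big_filter -(big_map absz xpredT (fun k => r ^+ k)).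
  set t := map _ _; have ut : uniq t.
    rewrite map_inj_in_uniq ?filter_uniq ?fset_uniq // => m n.
    by rewrite !mem_filter => /andP[Pm _] /andP[Pn _]; exact: P_inj.
  apply: le_trans (HM [fset k in t]%fset).
  rewrite le_eqVlt; apply/orP; left; apply/eqP/perm_big/uniq_perm => //.
    exact: fset_uniq.
  by move=> n; rewrite !inE.
by rewrite (bigID (fun n : int => 0 <= n)) /= lerD // half // => -[m|m] [n|n]; rewrite !unfold_in //= => _ _; lia.
Qed.

(** The quotient of the two sides' main terms is [(2 r^m s)^m], and [r^m s] drops below 1/2 once [m]
    is large. This reduces every Gaussian sum to a geometric one. *)
Lemma gauss_bound (r s : R) : 0 <= r < 1 -> 0 <= s ->
  exists2 K : R, 0 <= K & forall m : nat, r ^+ (m * m) * s ^+ m <= K * 2^-1 ^+ m.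
Proof.
move=> /andP[r0 r1] s0; have s1 : 0 < s + 1 by rewrite ltr_wpDl.
have e0 : 0 < 2^-1 / (s + 1) by rewrite mulr_gt0 ?invr_gt0.
have /cvg_expr/cvgrPdist_lt/(_ _ e0)[N _ HN] : `|r| < 1 by rewrite ger0_norm.
have two_ge1 : 1 <= 2 :> R by lra.
(* For [m < N], [(s + 1)^N] bounds [s^m], and [2^N] offsets the factor [2^-m]. *)
exists ((s + 1) ^+ N * 2 ^+ N) => [|m]; first by rewrite mulr_ge0 ?exprn_ge0 // ltW.
rewrite exprM -exprMn.
have [Nm|mN] := leqP N m.
  apply: (@le_trans _ _ (2^-1 ^+ m)).
    apply: lerXn2r; rewrite ?nnegrE ?mulr_ge0 ?exprn_ge0 ?invr_ge0 //.
    have /= := HN _ Nm; rewrite sub0r normrN ger0_norm ?exprn_ge0 // ltr_pdivlMr // => /ltW.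
    by apply: le_trans; rewrite ler_wpM2l ?exprn_ge0 // lerDl.
  rewrite ler_peMl ?exprn_ge0 ?invr_ge0 // -exprMn.
  by rewrite exprn_ege1 //; lra.
apply: (@le_trans _ _ ((s + 1) ^+ N)).
  apply: (@le_trans _ _ ((s + 1) ^+ m)).
    apply: lerXn2r; rewrite ?nnegrE ?mulr_ge0 ?exprn_ge0 //; first exact: ltW.
    rewrite -[leRHS]mul1r ler_pM ?exprn_ge0 //; first by rewrite exprn_ile1 // ltW.
    by rewrite lerDl.
  by rewrite ler_weXn2l ?(ltnW mN) // lerDr.
rewrite -mulrA ler_peMr ?exprn_ge0 ?(ltW s1) // -(subnK (ltnW mN)) exprD -mulrA -exprMn.
by rewrite mulfV ?gt_eqF // expr1n mulr1 exprn_ege1.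
Qed.

Lemma mulzz_absz (n : int) : n * n = (`|n| * `|n|)%N%:Z.
Proof. by case: n => n; lia. Qed.

Lemma exprz_le_absz (s : R) (n : int) : 0 <= s -> s ^ n <= (s + s^-1) ^+ `|n|.
Proof.
move=> s0; have si : 0 <= s^-1 by rewrite invr_ge0.
case: n => n; first by apply: lerXn2r; rewrite ?nnegrE ?addr_ge0 // lerDl.
rewrite NegzE -exprz_inv abszN absz_nat -exprnP.
by apply: lerXn2r; rewrite ?nnegrE ?addr_ge0 // lerDr.
Qed.

Lemma half_lt1 : 0 <= (2^-1 : R) < 1.
Proof. by rewrite invr_ge0 ler0n /= invf_lt1 ?ltr0n // ltr1n. Qed.

Lemma summable_gauss (x : C) (s : R) (f : int -> C) : nrm x < 1 -> 0 <= s ->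
  (forall n, nrm (f n) <= nrm x ^+ (`|n| * `|n|) * s ^+ `|n|) -> summable f.
Proof.
move=> x1 s0 fx; have [|K K0 HK] := @gauss_bound (nrm x) s _ s0; first by rewrite nrm_ge0.
by apply: (summable_leZ (int_geo_sums half_lt1) K0) => n; apply: le_trans (HK _).
Qed.

Definition th (x y : C) : C := tsum (fun n : int => x ^ (n * n) * y ^ n).

Lemma summable_th (x y : C) : nrm x < 1 -> summable (fun n : int => x ^ (n * n) * y ^ n).
Proof.
move=> x1; apply: (@summable_gauss _ (nrm y + (nrm y)^-1) _ x1) => [|n].
  by rewrite addr_ge0 ?invr_ge0 ?nrm_ge0.
rewrite nrmM !nrmXz mulzz_absz -exprnP ler_wpM2l ?exprn_ge0 ?nrm_ge0 //.
exact/exprz_le_absz/nrm_ge0.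
Qed.

Lemma tsum_shift (f : int -> C) (a : int) : summable f ->
  tsum (fun n => f (n + a)) = tsum f.
Proof.
by move=> fs; apply: (tsum_bij (h' := fun n => n - a) fs) => n; [exact: addrK|exact: subrK].
Qed.

Lemma tsum_reflect (f : int -> C) (a : int) : summable f ->
  tsum (fun n => f (a - n)) = tsum f.
Proof. by move=> fs; apply: (tsum_bij (h' := fun n => a - n) fs) => n; exact: subKr. Qed.

Lemma summable_shift (f : int -> C) (a : int) : summable f -> summable (fun n => f (n + a)).
Proof. by apply: summable_inj; exact: addIr. Qed.

Lemma tsum_residues (f : int -> C) (m : nat) : (0 < m)%N -> summable f ->
  tsum f = \sum_(c < m) tsum (fun k : int => f (m%:Z * k + c%:Z)).
Proof.
case: m => // m _ fs.
pose h (x : 'I_m.+1 * int) : int := m.+1%:Z * x.2 + x.1%:Z.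
pose h' (n : int) : 'I_m.+1 * int := (inord `|(n %% m.+1%:Z)%Z|, (n %/ m.+1%:Z)%Z).
have rng n : (0 <= (n %% m.+1%:Z)%Z) && ((n %% m.+1%:Z)%Z < m.+1%:Z) by lia.
have h'K : cancel h' h.
  move=> n; rewrite /h /= inordK; first by have := rng n; lia.
  by have := rng n; lia.
have hK : cancel h h'.
  move=> [c k]; rewrite /h /h' /=; have c_lt := ltn_ord c.
  have e1 : ((m.+1%:Z * k + c%:Z) %/ m.+1%:Z)%Z = k.
    by rewrite mulrC divzMDl // divz_small ?addr0 //; lia.
  have e2 : ((m.+1%:Z * k + c%:Z) %% m.+1%:Z)%Z = c.
    by rewrite mulrC modzMDl modz_small //; lia.
  by rewrite e1 e2 absz_nat inord_val.
rewrite -(tsum_bij fs hK h'K) (tsum_fubini (summable_inj (can_inj hK) fs)).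
by rewrite (tsumE (has_sum_fin _)).
Qed.

Lemma th_sym (x y : C) : nrm x < 1 -> th x y^-1 = th x y.
Proof.
move=> x1; rewrite /th -(tsum_reflect 0 (summable_th y x1)).
by apply: eq_tsum => n; rewrite sub0r mulrNN exprz_inv.
Qed.

Lemma tsum_int_nat (f : int -> C) : summable f -> (forall n, f (Negz n) = 0) ->
  tsum (fun n : nat => f n%:Z) = tsum f.
Proof.
move=> fs f0; apply: (tsum_reindex (h' := absz) fs) => [n|[n|n]] //.
by rewrite f0 eqxx.
Qed.

Lemma tsum_natS (f : nat -> C) : summable f -> tsum f = f 0%N + tsum (fun n => f n.+1).
Proof.
move=> fs; pose h (x : unit + nat) : nat := if x is inr n then n.+1 else 0%N.
pose h' (n : nat) : unit + nat := if n is n'.+1 then inr n' else inl tt.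
have fS : has_sum (fun n => f n.+1) (tsum (fun n => f n.+1)).
  by apply/tsumP/(summable_inj _ fs) => m n [].
apply: tsumE => e e0; have [A HA] := fS _ e0.
exists (0%N |` [fset n.+1 | n in A])%fset => B AB.
have B0 : 0%N \in B by apply: (fsubsetP AB); rewrite !inE.
pose D := [fset n.-1 | n in (B `\ 0)%N]%fset.
have -> : \sum_(i <- B) f i = f 0%N + \sum_(i <- D) f i.+1.
  rewrite (big_fsetD1 0%N B0) /=; congr (_ + _).
  have -> : (B `\ 0%N)%fset = [fset n.+1 | n in D]%fset.
    apply/fsetP => -[|n]; rewrite !inE /=.
      by symmetry; apply/negP => /imfsetP[].
    apply/idP/imfsetP => [nB|[k /imfsetP[j /= jB ->] ->]].
      by exists n => //; apply/imfsetP; exists n.+1; rewrite //= !inE.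
    by move: jB; rewrite !inE => /andP[j0 jB]; rewrite prednK // lt0n.
  by rewrite (sum_imfset f D succn_inj).
rewrite opprD addrACA subrr add0r; apply: HA; apply/fsubsetP => n nA.
apply/imfsetP; exists n.+1 => //=; rewrite !inE /=.
by apply: (fsubsetP AB); rewrite !inE; apply/orP; right; apply/imfsetP; exists n.
Qed.

Lemma has_sum_sumr (I J : choiceType) (s : seq J) (f : J -> I -> C) (t : J -> C) :
  (forall j, has_sum (f j) (t j)) ->
  has_sum (fun i => \sum_(j <- s) f j i) (\sum_(j <- s) t j).
Proof.
move=> ft; elim: s => [|j s IH].
  by rewrite big_nil; apply: has_sum_eq (has_sum0 _) => i; rewrite big_nil.
by rewrite big_cons; apply: has_sum_eq (has_sumD (ft j) IH) => i; rewrite big_cons.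
Qed.

(* A sublattice of index [m] in Z^2 and its cosets, put in Hermite form. *)
Lemma tsum_lattice (F : int * int -> C) (m : nat) (a b : int) : (0 < m)%N ->
  summable F ->
  tsum F = \sum_(c < m) tsum (fun x : int * int =>
    F (x.1 - a * x.2, b * (x.1 - a * x.2) + m%:Z * x.2 + c%:Z)).
Proof.
move=> m0 Fs.
have sc (c : nat) : summable (fun x : int * int => F (x.1, b * x.1 + (m%:Z * x.2 + c%:Z))).
  apply: (@summable_inj _ _ _ _ (fun x : int * int => (x.1, b * x.1 + (m%:Z * x.2 + c%:Z))) F) => //.
  by move=> [w k] [w' k'] /= [-> /addrI/addIr e]; congr pair; nia.
(* Row [w] is shifted by [b w] and split modulo [m]. The shear by [a] that follows lets a caller
   remove the cross term of a quadratic form. *)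
transitivity (\sum_(c < m) tsum (fun x : int * int => F (x.1, b * x.1 + (m%:Z * x.2 + c%:Z)))).
  rewrite (tsum_fubini Fs); apply: tsumE.
  apply: (@has_sum_eq _ _ _ (fun w => \sum_(c < m)
      tsum (fun k : int => F (w, b * w + (m%:Z * k + c%:Z))))).
    move=> w; rewrite -(tsum_shift (b * w) (summable_row w Fs)).
    rewrite (tsum_residues m0); last exact: (summable_shift (b * w) (summable_row w Fs)).
    by apply: eq_bigr => c _; apply: eq_tsum => k; rewrite [b * w + _]addrC.
  apply: has_sum_sumr => c; rewrite (tsum_fubini (sc c)).
  exact: (tsumP (summable_rows (sc c))).
apply: eq_bigr => c _.
have hK : cancel (fun x : int * int => (x.1 - a * x.2, x.2)) (fun x => (x.1 + a * x.2, x.2)).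
  by move=> [n k] /=; rewrite subrK.
have h'K : cancel (fun x : int * int => (x.1 + a * x.2, x.2)) (fun x => (x.1 - a * x.2, x.2)).
  by move=> [n k] /=; rewrite addrK.
by rewrite -(tsum_bij (sc c) hK h'K); apply: eq_tsum => x /=; rewrite addrA.
Qed.

End IntegerSums.

(** * Infinite q-products and Euler's series *)

Section QPochhammer.
Context {R : realType} {C : cvalField R}.

Definition qinf (a q : C) : C := xget 0 [set l | lim_to (qpoch a q) l]%classic.

Lemma qinfE (a q l : C) : lim_to (qpoch a q) l -> qinf a q = l.
Proof.
move=> ul; rewrite /qinf; case: xgetP => [m _ um|/(_ l)//].
exact: lim_to_uniq um ul.
Qed.

Lemma qpochS (a q : C) n : qpoch a q n.+1 = qpoch a q n * (1 - a * q ^+ n).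
Proof. by rewrite /qpoch big_nat_recr. Qed.

Lemma qpoch0 (a q : C) : qpoch a q 0 = 1.
Proof. by rewrite /qpoch big_geq. Qed.

Lemma qpoch_neq0 (a q : C) n : (forall k, 1 - a * q ^+ k != 0) -> qpoch a q n != 0.
Proof.
by move=> H; elim: n => [|n IH]; rewrite ?qpoch0 ?oner_eq0 // qpochS mulf_neq0.
Qed.

Lemma one_sub_neq0 (a : C) : nrm a < 1 -> 1 - a != 0.
Proof. by rewrite subr_eq0; apply: contraTneq => <-; rewrite nrm1 ltxx. Qed.

Lemma nrm_expr_lt1 (q : C) n : nrm q < 1 -> nrm (q ^+ n.+1) < 1.
Proof. by move=> q1; rewrite nrmX exprn_ilt1 ?nrm_ge0. Qed.

Lemma one_sub_expr_neq0 (q : C) n : nrm q < 1 -> 1 - q ^+ n.+1 != 0.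
Proof. by move=> q1; exact/one_sub_neq0/nrm_expr_lt1. Qed.

Lemma one_sub_mul_neq0 (a q : C) : nrm q < 1 -> nrm a < 1 ->
  forall k, 1 - a * q ^+ k != 0.
Proof.
move=> q1 a1 k; apply: one_sub_neq0; rewrite nrmM nrmX.
by rewrite (le_lt_trans _ a1) // ler_piMr ?nrm_ge0 // exprn_ile1 ?nrm_ge0 // ltW.
Qed.

(** The convention [1 / (Q;Q)_z = 0] for negative [z] makes [ipB1] valid at every integer, including
    [z = 0] where both sides vanish. Sums can then run over all of Z and be shifted without boundary
    terms. *)
Definition ip (Q : C) (z : int) : C := if z is Posz n then (qpoch Q Q n)^-1 else 0.

Lemma ip0 (Q : C) : ip Q 0 = 1.
Proof. by rewrite -[ip Q 0]/((qpoch Q Q 0)^-1) qpoch0 invr1. Qed.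

Lemma ipB1 (Q : C) (z : int) : nrm Q < 1 -> (1 - Q ^ z) * ip Q z = ip Q (z - 1).
Proof.
move=> Q1; case: z => [[|n]|n]; first by rewrite expr0z subrr mul0r.
  rewrite (_ : n.+1%:Z - 1 = n); last by lia.
  rewrite /ip qpochS -exprnP -exprS invfM mulrC mulrVK //.
  by rewrite unitfE one_sub_expr_neq0.
by rewrite (_ : Negz n - 1 = Negz n.+1) ?mulr0 //; lia.
Qed.

(** A crude bound that does not presuppose convergence of the infinite product. It suffices against
    Gaussian decay, and convergence is then derived from Euler's series. *)
Lemma ip_geo (Q : C) (z : int) : nrm Q < 1 -> nrm (ip Q z) <= (1 - nrm Q)^-1 ^+ `|z|.
Proof.
move=> Q1; have d0 : 0 < 1 - nrm Q by rewrite subr_gt0.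
case: z => n /=; last by rewrite nrm0 exprn_ge0 // invr_ge0 ltW.
elim: n => [|n IH]; first by rewrite qpoch0 invr1 nrm1.
rewrite qpochS -exprS invfM nrmM [leRHS]exprSr ler_pM ?nrm_ge0 // nrmV lef_pV2 ?posrE //.
  have := nrmD (1 - Q ^+ n.+1) (Q ^+ n.+1); rewrite subrK nrm1.
  suff : nrm (Q ^+ n.+1) <= nrm Q by lra.
  by rewrite nrmX exprS ler_piMr ?nrm_ge0 // exprn_ile1 ?nrm_ge0 // ltW.
by rewrite nrm_gt0 one_sub_expr_neq0.
Qed.

(** Euler's series for [(-xy; x^2)_oo]. Working with a square root [x] of the base avoids the
    exponents [k(k-1)/2]. *)
Definition euler_sum (x y : C) : C :=
  tsum (fun k : int => x ^ (k * k) * y ^ k * ip (x ^+ 2) k).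

Lemma nrm_sqr_lt1 (x : C) : nrm x < 1 -> nrm (x ^+ 2) < 1.
Proof. exact: nrm_expr_lt1. Qed.

Lemma summable_euler (x y : C) : nrm x < 1 ->
  summable (fun k : int => x ^ (k * k) * y ^ k * ip (x ^+ 2) k).
Proof.
move=> x1; have x2 := nrm_sqr_lt1 x1.
have d0 : 0 <= (1 - nrm (x ^+ 2))^-1 by rewrite invr_ge0 subr_ge0 ltW.
have s0 : 0 <= nrm y + (nrm y)^-1 by rewrite addr_ge0 ?invr_ge0 ?nrm_ge0.
apply: (summable_gauss x1 (mulr_ge0 s0 d0)) => k.
rewrite (nrmM (_ * _)) (nrmM (x ^ _)) exprMn mulrA; apply: ler_pM; rewrite ?mulr_ge0 ?nrm_ge0 ?ip_geo //.
rewrite !nrmXz mulzz_absz -exprnP ler_wpM2l ?exprn_ge0 ?nrm_ge0 //.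
exact/exprz_le_absz/nrm_ge0.
Qed.

Lemma euler_sum_rec (x y : C) : x != 0 -> y != 0 -> nrm x < 1 ->
  euler_sum x y = (1 + x * y) * euler_sum x (x ^+ 2 * y).
Proof.
move=> x0 y0 x1; have x2 := nrm_sqr_lt1 x1.
pose f k := x ^ (k * k) * (x ^+ 2 * y) ^ k * ip (x ^+ 2) k.
have fs : summable f := summable_euler _ x1.
have gs := summableZ (x * y) (summable_shift (- 1) fs).
rewrite mulrDl mul1r -[X in _ + _ * X](tsum_shift (- 1) fs) -tsumZ; last exact: summable_shift.
rewrite -tsumD //; apply: eq_tsum => k; rewrite /f -ipB1 //.
rewrite !expfzMl.
have pred_expz (z : C) : z != 0 -> z ^ k = z ^ (k + -1) * z.
  by move=> z0; have := expfzDr (k + -1) 1 z0; rewrite expr1z subrK.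
have -> : x ^ (k * k) = x ^ ((k + -1) * (k + -1)) * x ^ (k + -1) * x ^ (k + -1) * x.
  rewrite -[X in _ = _ * X]expr1z -!expfzDr //; congr (_ ^ _); ring.
rewrite (pred_expz x x0) (pred_expz y y0); ring.
Qed.

Lemma euler_sum_qpoch (x y : C) n : x != 0 -> y != 0 -> nrm x < 1 ->
  euler_sum x y = qpoch (- (x * y)) (x ^+ 2) n * euler_sum x ((x ^+ 2) ^+ n * y).
Proof.
move=> x0 y0 x1; elim: n => [|n IH]; first by rewrite qpoch0 expr0 !mul1r.
rewrite [LHS]IH.
rewrite [X in _ * X]euler_sum_rec //; last by rewrite mulf_neq0 ?expf_neq0.
rewrite qpochS -mulrA; congr (_ * (_ * _)).
  ring.
by rewrite (exprS (x ^+ 2)) mulrA.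
Qed.

Lemma tsum_single (I : choiceType) (f : I -> C) (i : I) :
  (forall j, j != i -> f j = 0) -> tsum f = f i.
Proof.
move=> f0; apply: tsumE => e e0; exists [fset i]%fset => B; rewrite fsub1set => iB.
rewrite (big_fsetD1 i iB) /= big1_seq ?addr0 ?subrr ?nrm0 // => j /andP[_].
by rewrite !inE => /andP[/f0].
Qed.

Lemma lim_to_expr0 (q : C) : nrm q < 1 -> lim_to (fun n => q ^+ n) 0.
Proof.
move=> q1; apply: (@lim_to_geo _ _ (nrm q) _ 1) => [|n]; first by rewrite nrm_ge0.
by rewrite nrmX mul1r.
Qed.

Lemma lim_euler_sum (x y : C) : nrm x < 1 ->
  lim_to (fun n => euler_sum x ((x ^+ 2) ^+ n * y)) 1.
Proof.
move=> x1; have x2 := nrm_sqr_lt1 x1.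
pose l (k : int) : C := if k == 0 then 1 else 0.
have <- : tsum l = 1 by rewrite (@tsum_single _ _ 0) // => j /negPf; rewrite /l => ->.
apply: (tannery (summable_euler y x1)) => [n k|k].
  case: k => k; last by rewrite /= !mulr0 nrm0.
  rewrite -!exprnP exprMn !nrmM ler_wpM2r ?nrm_ge0 // ler_wpM2l ?nrm_ge0 //.
  by rewrite ler_piMl ?nrm_ge0 // !nrmX exprn_ile1 ?exprn_ge0 ?nrm_ge0 // exprn_ile1 ?exprn_ge0 ?nrm_ge0 // exprn_ile1 ?nrm_ge0 // ltW.
case: k => [[|k]|k].
- apply: eq_lim_to (lim_to_cst _) => n.
  by rewrite /l eqxx (ip0 (x ^+ 2)) mulr1 mul0r !expr0z mulr1.
- rewrite /l /=; pose K := x ^ (k.+1%:Z * k.+1%:Z) * y ^ k.+1 * ip (x ^+ 2) k.+1.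
  rewrite -[X in lim_to _ X](mulr0 K).
  apply: eq_lim_to (lim_toZ K (lim_to_expr0 (nrm_expr_lt1 k x2))) => n.
  rewrite /K -!exprnP [(_ * y) ^+ _]exprMn; set Q := x ^+ 2; rewrite -(exprM Q n) [(n * _)%N]mulnC (exprM Q) /ip; ring.
- by apply: eq_lim_to (lim_to_cst 0) => n; rewrite mulr0.
Qed.

(** Convergence of the product is a by-product of the series: the partial product is the quotient of
    the series at [y] by the series at [x^(2n) y], and the latter tends to 1. *)
Lemma lim_qpoch_euler (x y : C) : x != 0 -> y != 0 -> nrm x < 1 ->
  lim_to (qpoch (- (x * y)) (x ^+ 2)) (euler_sum x y).
Proof.
move=> x0 y0 x1; have L := lim_euler_sum y x1.
have Li := lim_toV (oner_neq0 _) L.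
rewrite (_ : euler_sum x y = euler_sum x y * 1^-1); last by rewrite invr1 mulr1.
have [N HN] : exists N, forall n, (N <= n)%N -> euler_sum x ((x ^+ 2) ^+ n * y) != 0.
  have [N HN] := L 1 ltr01; exists N => n /HN; apply: contraTneq => ->.
  by rewrite sub0r nrmN nrm1 ltxx.
apply: (@lim_to_shiftI _ _ _ _ N); apply: eq_lim_to (lim_to_shift N (lim_toZ (euler_sum x y) Li)) => n.
by rewrite (euler_sum_qpoch (n + N) x0 y0 x1) mulfK // HN // leq_addl.
Qed.

Lemma qinf_euler (x y : C) : x != 0 -> y != 0 -> nrm x < 1 ->
  qinf (- (x * y)) (x ^+ 2) = euler_sum x y.
Proof. by move=> x0 y0 x1; exact/qinfE/lim_qpoch_euler. Qed.

Lemma sqrt_exists (Q : C) : exists x : C, x ^+ 2 = Q.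
Proof. by exists (sqrtC Q); rewrite sqrtCK. Qed.

Lemma sqrt_lt1 (x : C) : nrm (x ^+ 2) < 1 -> nrm x < 1.
Proof. by rewrite nrmX; apply: contraTT; rewrite -!leNgt => x1; rewrite exprn_ege1. Qed.

Lemma lim_qpoch (a Q : C) : Q != 0 -> nrm Q < 1 -> lim_to (qpoch a Q) (qinf a Q).
Proof.
move=> Q0 Q1; have [->|a0] := eqVneq a 0.
  rewrite (qinfE (l := 1)); apply: eq_lim_to (lim_to_cst 1) => n;
  by rewrite /qpoch big1 // => k _; rewrite mul0r subr0.
(* With [x^2 = Q] and [y = - a / x] Euler's product starts at [- (x y) = a]. *)
have [x xQ] := sqrt_exists Q; have x1 : nrm x < 1 by apply: sqrt_lt1; rewrite xQ.
have x0 : x != 0 by apply: contra_neq Q0 => x0; rewrite -xQ x0 expr0n.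
have y0 : - a / x != 0 by rewrite mulf_neq0 ?invr_eq0 ?oppr_eq0.
have := lim_qpoch_euler x0 y0 x1.
by rewrite xQ mulrC divfK // opprK => L; rewrite (qinfE L).
Qed.

(** For large [N] the series at [x^(2N) y] lies within distance 1 of 1, hence is nonzero; the
    infinite product is this value times [N] nonzero factors. *)
Lemma qinf_neq0 (a Q : C) : Q != 0 -> nrm Q < 1 ->
  (forall k, 1 - a * Q ^+ k != 0) -> qinf a Q != 0.
Proof.
move=> Q0 Q1 aQ; have [a0|a0] := eqVneq a 0.
  rewrite (qinfE (l := 1)) ?oner_eq0 //; apply: eq_lim_to (lim_to_cst 1) => n.
  by rewrite a0 /qpoch big1 // => k _; rewrite mul0r subr0.
have [x xQ] := sqrt_exists Q; have x1 : nrm x < 1 by apply: sqrt_lt1; rewrite xQ.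
have x0 : x != 0 by apply: contra_neq Q0 => x0; rewrite -xQ x0 expr0n.
have y0 : - a / x != 0 by rewrite mulf_neq0 ?invr_eq0 ?oppr_eq0.
have := qinf_euler x0 y0 x1; rewrite {1}xQ mulrC divfK // opprK => ->.
have [N /(_ N (leqnn N))] := lim_euler_sum (- a / x) x1 ltr01.
rewrite (euler_sum_qpoch N x0 y0 x1) xQ (mulrC x) divfK // opprK => HN.
rewrite mulf_neq0 ?qpoch_neq0 //; apply: contraTneq HN => ->.
by rewrite sub0r nrmN nrm1 ltxx.
Qed.

Lemma qinf_neq0_lt1 (a Q : C) : Q != 0 -> nrm Q < 1 -> nrm a < 1 -> qinf a Q != 0.
Proof. by move=> Q0 Q1 a1; apply/qinf_neq0/one_sub_mul_neq0. Qed.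

Lemma lim_ip (Q : C) (a : int) : Q != 0 -> nrm Q < 1 ->
  lim_to (fun n : nat => ip Q (n%:Z + a)) (qinf Q Q)^-1.
Proof.
move=> Q0 Q1; apply: (@lim_to_shiftI _ _ _ _ `|a|%N).
have q0 : qinf Q Q != 0 by apply/qinf_neq0/one_sub_mul_neq0.
have L := lim_toV q0 (lim_qpoch Q Q0 Q1).
pose b := absz (`|a|%N%:Z + a); have b_eq : b%:Z = `|a|%N%:Z + a by rewrite /b; lia.
apply: eq_lim_to (lim_to_shift b L) => n.
by rewrite (_ : (n + `|a|)%N%:Z + a = (n + b)%N%:Z); last by lia.
Qed.

Lemma ip_bounded (Q : C) : Q != 0 -> nrm Q < 1 ->
  exists2 M : R, 0 <= M & forall z, nrm (ip Q z) <= M.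
Proof.
move=> Q0 Q1; have [M HM] := lim_to_bounded (lim_ip 0 Q0 Q1).
have M0 : 0 <= M := le_trans (nrm_ge0 _) (HM 0%N).
by exists M => // -[n|n]; [have := HM n; rewrite addr0|rewrite nrm0].
Qed.

End QPochhammer.

(** * Durfee rectangles and the Jacobi triple product *)

Section Durfee.
Context {R : realType} {C : cvalField R}.
Implicit Types (x y Q : C).

(** This series counts partitions by their largest rectangle of size [n] by [n + c], so its value
    should not depend on [c]. *)
Definition durfee Q (c : int) : C :=
  tsum (fun n : int => Q ^ (n * n + c * n) * ip Q n * ip Q (n + c)).

Lemma summable_bounded_mul (I : choiceType) (f g : I -> C) (M : R) : 0 <= M ->
  (forall i, nrm (g i) <= M) -> summable f -> summable (fun i => f i * g i).
Proof.
move=> M0 gM fs; apply: (summable_leZ (g := fun i => nrm (f i)) fs M0) => i.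
by rewrite nrmM mulrC ler_wpM2r ?nrm_ge0.
Qed.

Lemma summable_durfee Q c : Q != 0 -> nrm Q < 1 ->
  summable (fun n : int => Q ^ (n * n + c * n) * ip Q n * ip Q (n + c)).
Proof.
move=> Q0 Q1; have [M M0 HM] := ip_bounded Q0 Q1.
apply: (summable_bounded_mul M0) => [n|]; first exact: HM.
apply: (summable_bounded_mul M0 HM); apply: eq_summable (summable_th (Q ^ c) Q1) => n.
by rewrite expfzDr // exprz_exp.
Qed.

Lemma durfee_rec Q c : Q != 0 -> nrm Q < 1 ->
  durfee Q c - durfee Q (c + 1) = - Q ^ (c + 1) * (durfee Q (c + 1) - durfee Q (c + 2)).
Proof.
move=> Q0 Q1; have S d := summable_durfee d Q0 Q1.
pose F d (n : int) := Q ^ (n * n + d * n) * ip Q n * ip Q (n + d).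
have Sm : summable (fun n => Q ^ (c + 1) * F (c + 2) (n + - 1)).
  exact/summableZ/(summable_shift (- 1) (S (c + 2))).
have S1 : summable (fun n => Q ^ (c + 1) * F (c + 1) n) by exact/summableZ/S.
rewrite -tsumB // (@eq_tsum _ _ _ _
  (fun n => Q ^ (c + 1) * F (c + 2) (n + - 1) - Q ^ (c + 1) * F (c + 1) n)); last first.
  move=> n; rewrite /F.
  rewrite (_ : n + c = n + (c + 1) - 1); last by ring.
  rewrite (_ : n + - 1 + (c + 2) = n + (c + 1)); last by ring.
  rewrite -!ipB1 //.
  have -> : Q ^ (n * n + (c + 1) * n) = Q ^ (n * n + c * n) * Q ^ n.
    by rewrite -expfzDr //; congr (_ ^ _); ring.
  have -> : Q ^ (n * n + c * n) = Q ^ (c + 1) * Q ^ ((n + - 1) * (n + - 1) + (c + 2) * (n + - 1)).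
    by rewrite -expfzDr //; congr (_ ^ _); ring.
  rewrite (expfzDr n (c + 1) Q0); ring.
rewrite tsumB // !tsumZ; [|exact: S|exact: (summable_shift (- 1) (S (c + 2)))].
rewrite (tsum_shift (- 1) (S (c + 2))) -/(durfee Q (c + 1)) -/(durfee Q (c + 2)); ring.
Qed.

Lemma lim_durfee Q : Q != 0 -> nrm Q < 1 ->
  lim_to (fun c : nat => durfee Q c) (qinf Q Q)^-1.
Proof.
move=> Q0 Q1; have [M M0 HM] := ip_bounded Q0 Q1.
pose l (n : int) : C := if n == 0 then (qinf Q Q)^-1 else 0.
have <- : tsum l = (qinf Q Q)^-1.
  by rewrite (@tsum_single _ _ _ _ 0) // => j /negPf; rewrite /l => ->.
apply: (tannery (g := fun n : int => M * M * nrm (Q ^ (n * n)))) => [|c n|n].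
- apply: rsummableZ; first exact: mulr_ge0.
  by apply: eq_summable (summable_th 1 Q1) => n; rewrite exp1rz mulr1.
- case: n => n; last by rewrite mulr0 mul0r nrm0 mulr_ge0 ?nrm_ge0 // mulr_ge0.
  rewrite expfzDr // -mulrA nrmM mulrC (nrmM (Q ^ _)) mulrCA [leRHS]mulrC ler_wpM2l ?nrm_ge0 //.
  rewrite nrmM -[leRHS]mulr1; apply: ler_pM; rewrite ?mulr_ge0 ?nrm_ge0 //.
    by apply: ler_pM; rewrite ?nrm_ge0.
  by rewrite -PoszM -exprnP nrmX exprn_ile1 ?nrm_ge0 // ltW.
case: n => [[|n]|n].
- apply: eq_lim_to (lim_ip 0 Q0 Q1) => c.
  by rewrite !mulr0 addr0 expr0z mul1r ip0 mul1r add0r.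
- have [r0 r1] := (nrm_ge0 Q, Q1).
  apply: (@lim_to_geo _ _ (nrm Q) _ (M * M)) => [|c]; first by rewrite r0.
  rewrite -PoszM -!PoszD -exprnP -mulrA nrmM mulrC; apply: ler_pM; rewrite ?nrm_ge0 //.
    by rewrite nrmM; apply: ler_pM; rewrite ?nrm_ge0.
  by rewrite nrmX; apply: ler_wiXn2l; [| exact: ltW | lia].
- by apply: eq_lim_to (lim_to_cst 0) => c; rewrite mulr0 mul0r.
Qed.

(** By [durfee_rec] the differences of consecutive values, for [c] in [nat], do not decrease in norm
    as [c] grows, but by [lim_durfee] they tend to 0; hence they all vanish and each value equals
    the limit. For negative [c] a shift by [- c] exchanges the two factors [ip]. *)
Lemma durfeeE Q c : Q != 0 -> nrm Q < 1 -> durfee Q c = (qinf Q Q)^-1.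
Proof.
move=> Q0 Q1; have L := lim_durfee Q0 Q1.
have step (d : nat) : durfee Q d = durfee Q d.+1.
  pose D (n : nat) := durfee Q n - durfee Q n.+1.
  have Drec n : nrm (D n) <= nrm (D n.+1).
    have := durfee_rec n%:Z Q0 Q1.
    rewrite (_ : n%:Z + 1 = n.+1%:Z); last by lia.
    rewrite (_ : n%:Z + 2 = n.+2%:Z); last by lia.
    rewrite /D => ->; rewrite nrmM nrmN ler_piMl ?nrm_ge0 // -exprnP nrmX.
    by rewrite exprn_ile1 ?nrm_ge0 // ltW.
  have DD n : nrm (D d) <= nrm (D (n + d)%N).
    by elim: n => // n IH; rewrite addSn (le_trans IH).
  apply/eqP; rewrite -subr_eq0; apply/eqP/nrm_eps0 => e e0.
  have L1 := lim_to_shift 1 L.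
  have LD := lim_toD L (lim_toZ (-1) L1); rewrite mulN1r subrr in LD.
  have [N HN] := LD _ e0; apply: le_lt_trans (DD N) _.
  have := HN (N + d)%N (leq_addr _ _).
  by rewrite subr0 mulN1r addn1.
have nat_case (d : nat) : durfee Q d = (qinf Q Q)^-1.
  have cst n : durfee Q d = durfee Q (n + d)%N.
    by elim: n => // n IH; rewrite addSn -step.
  apply: (lim_to_uniq (lim_to_cst (durfee Q d))).
  by apply: eq_lim_to (lim_to_shift d L) => n; rewrite -cst.
case: c => c; first exact: nat_case.
rewrite -(nat_case c.+1) /durfee -(tsum_shift c.+1 (summable_durfee (Negz c) Q0 Q1)).
apply: eq_tsum => n; rewrite NegzE addrK mulrAC; congr (_ ^ _ * _ * _); ring.
Qed.

(** The Euler series in [y] and in [y^-1] are multiplied and the terms grouped by the difference [r]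
    of the indices. The coefficient of [y^r] is [x^(r^2)] times a Durfee sum with offset [r], which
    is the same constant for every [r]. *)
Lemma jacobi_triple x y : x != 0 -> y != 0 -> nrm x < 1 ->
  th x y = qinf (- (x * y)) (x ^+ 2) * qinf (- (x / y)) (x ^+ 2) * qinf (x ^+ 2) (x ^+ 2).
Proof.
move=> x0 y0 x1; have x2 := nrm_sqr_lt1 x1; have x20 : x ^+ 2 != 0 by rewrite expf_neq0.
have y'0 : y^-1 != 0 by rewrite invr_eq0.
have q0 : qinf (x ^+ 2) (x ^+ 2) != 0 by apply/qinf_neq0/one_sub_mul_neq0.
rewrite !qinf_euler // /euler_sum -(tsum_prod (summable_euler y x1) (summable_euler y^-1 x1)).
have S := summable_prod (summable_euler y x1) (summable_euler y^-1 x1).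
pose h (z : int * int) := (z.2 + z.1, z.2); pose h' (z : int * int) := (z.1 - z.2, z.2).
have hK : cancel h h' by move=> [r k]; rewrite /h /h' /=; congr pair; ring.
have h'K : cancel h' h by move=> [l k]; rewrite /h /h' /=; congr pair; ring.
rewrite -(tsum_bij S hK h'K) (tsum_fubini (summable_inj (can_inj hK) S)) /=.
rewrite mulrC -tsumZ; last exact: (summable_rows (summable_inj (can_inj hK) S)).
apply: eq_tsum => r; pose Q := x ^+ 2.
have -> : x ^ (r * r) * y ^ r = qinf Q Q * (x ^ (r * r) * y ^ r * durfee Q r).
  by rewrite durfeeE // mulrCA mulfV ?mulr1.
congr (_ * _); rewrite -tsumZ; last exact: summable_durfee.
apply: eq_tsum => k; rewrite exprz_inv -/Q (expfzDr k r y0).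
have -> : Q ^ (k * k + r * k) = x ^ (2 * (k * k + r * k)) by rewrite /Q exprnP exprz_exp.
transitivity (x ^ (r * r) * x ^ (2 * (k * k + r * k)) * y ^ r * ip Q k * ip Q (k + r)).
  ring.
transitivity ((x ^ ((k + r) * (k + r)) * x ^ (k * k)) * (y ^ k * y ^ (- k)) * y ^ r *
  ip Q k * ip Q (k + r)); last by ring.
rewrite -!expfzDr // addrN expr0z mulr1; congr (_ ^ _ * _ * _ * _); ring.
Qed.

End Durfee.

(** * The recurrence and the limit of the triple sums *)

Section Pairs.
Context {R : realType} {C : cvalField R}.
Variables (t : C) (t0 : t != 0) (t1 : nrm t < 1).
Implicit Types (a z : int).

Let Q := t ^+ 2.
Let Q0 : Q != 0. Proof. exact: expf_neq0. Qed.
Let Q1 : nrm Q < 1. Proof. exact: nrm_sqr_lt1. Qed.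

Lemma ip_Negz q n : ip q (Negz n) = 0 :> C. Proof. by []. Qed.

(** For [i + k = z] the number [2 * i - z] is [i - k]. Only [a = 0] occurs in the triple sums; the
    other values are needed because the first-order relation [pair_sum_rec] changes [a]. *)
Definition pair_sum a z : C := tsum (fun i : int =>
  t ^ ((2 * i - z) * (2 * i - z) + a * (2 * i - z)) * ip Q i * ip Q (z - i)).

Lemma summable_pair a z : summable (fun i : int =>
  t ^ ((2 * i - z) * (2 * i - z) + a * (2 * i - z)) * ip Q i * ip Q (z - i)).
Proof.
have [M M0 HM] := ip_bounded Q0 Q1.
apply: (summable_bounded_mul M0) => [i|]; first exact: HM.
apply: (summable_bounded_mul M0 HM).
have inj : injective (fun i : int => 2 * i - z) by move=> i j; lia.
apply: eq_summable (summable_inj inj (summable_th (t ^ a) t1)) => i.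
by rewrite /= exprz_exp -expfzDr.
Qed.

Lemma pair_sum_sym a z : pair_sum (- a) z = pair_sum a z.
Proof.
rewrite /pair_sum -(tsum_reflect z (summable_pair (- a) z)); apply: eq_tsum => i.
by rewrite subKr mulrAC; congr (_ ^ _ * _ * _); ring.
Qed.

Lemma pair_sum_rec a z :
  pair_sum a z = t ^ z * pair_sum (a - 1) z + t ^ (1 - a) * pair_sum (a - 2) (z - 1).
Proof.
have S b y := summable_pair b y.
rewrite -!tsumZ // -tsumD; [|exact: summableZ|exact: summableZ].
apply: eq_tsum => i; set x := 2 * i - z.
have -> : 2 * i - (z - 1) = x + 1 by rewrite /x; ring.
have -> : z - 1 - i = z - i - 1 by ring.
rewrite -(ipB1 (z - i) Q1).
have -> : Q ^ (z - i) = t ^ z * t ^ (- x).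
  by rewrite -expfzDr // /Q exprnP exprz_exp; congr (_ ^ _); rewrite /x; ring.
have -> : t ^ (x * x + (a - 1) * x) = t ^ (x * x + a * x) * t ^ (- x).
  by rewrite -expfzDr //; congr (_ ^ _); ring.
have e : t ^ (1 - a) * t ^ ((x + 1) * (x + 1) + (a - 2) * (x + 1)) = t ^ (x * x + a * x).
  by rewrite -expfzDr //; congr (_ ^ _); ring.
rewrite -[in LHS]e; ring: e.
Qed.

Lemma pair_sum_lt0 a n : pair_sum a (Negz n) = 0.
Proof.
rewrite /pair_sum (@tsum_single _ _ _ _ 0) => [|j _]; first by rewrite subr0 mulr0.
case: j => j; last by rewrite ip_Negz mulr0 mul0r.
by rewrite (_ : Negz n - Posz j = Negz (n + j)%N) ?mulr0 //; lia.
Qed.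

(** The symmetry [a -> - a] closes [pair_sum_rec] on the sums with [a = 0] and [a = 1]: [X] and [E]
    below give the differences of each in terms of the other. Eliminating [a = 1] leaves this
    relation. *)
Lemma pair_sum_recurrence z :
  pair_sum 0 z - t * pair_sum 0 (z - 1) - pair_sum 0 (z - 2) + t * pair_sum 0 (z - 3) =
  Q ^ z * pair_sum 0 z + t * Q ^ (z - 1) * pair_sum 0 (z - 1).
Proof.
have X y : pair_sum 1 y = t ^ y * pair_sum 0 y + pair_sum 1 (y - 1).
  by rewrite pair_sum_rec subrr expr0z mul1r (_ : 1 - 2 = - 1) // pair_sum_sym.
have tS y : t ^ y = t * t ^ (y - 1).
  by rewrite -{2}(expr1z t) -expfzDr //; congr (_ ^ _); ring.
have E y : pair_sum 0 y = t ^ y * (pair_sum 1 y + pair_sum 1 (y - 1)) + pair_sum 0 (y - 2).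
  rewrite pair_sum_rec !sub0r subr0 !pair_sum_sym expr1z (pair_sum_rec 2).
  rewrite (_ : 2 - 1 = 1 :> int) // subrr (_ : 1 - 2 = -1 :> int) //.
  rewrite (_ : y - 1 - 1 = y - 2); last by ring.
  have tV : t * t ^ (-1) = 1 by rewrite exprN1 mulfV.
  by rewrite mulrDr [t * (t ^ (-1) * _)]mulrA tV (tS y); ring.
have := E z; have := E (z - 1); have := X z; have := X (z - 1); rewrite (tS z).
rewrite (_ : z - 1 - 1 = z - 2); last by ring.
rewrite (_ : z - 1 - 2 = z - 3); last by ring.
have Qz y : Q ^ y = t ^ y * t ^ y.
  by rewrite -expfzDr // /Q exprnP exprz_exp; congr (_ ^ _); ring.
rewrite !Qz (tS z).
move: (pair_sum 1 z) (pair_sum 1 (z - 1)) (pair_sum 1 (z - 2)) (t ^ (z - 1)) => X0 X1 X2 u.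
move: (pair_sum 0 z) (pair_sum 0 (z - 1)) (pair_sum 0 (z - 2)) (pair_sum 0 (z - 3)).
move=> E0 E1 E2 E3 eX1 eX0 eE1 eE0.
have {eE0} -> : E2 = E0 - t * u * (X0 + X1) by rewrite [in RHS]eE0; ring.
have {eE1} -> : E3 = E1 - u * (X1 + X2) by rewrite [in RHS]eE1; ring.
rewrite eX0 {1 2 3}eX1; ring.
Qed.

Lemma pair_sum_bounded : exists2 K : R, 0 <= K & forall z, nrm (pair_sum 0 z) <= K.
Proof.
have [M M0 HM] := ip_bounded Q0 Q1; have [N HN] := summable_th 1 t1.
have N0 : 0 <= N by have := HN fset0; rewrite big_seq_fset0.
exists (N * (M * M)) => [|z]; first by rewrite !mulr_ge0.
apply: tsum_bound => B; rewrite (@le_trans _ _ (\sum_(i <- B)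
  nrm (t ^ ((2 * i - z) * (2 * i - z)) * 1 ^ (2 * i - z)) * (M * M))) //.
  apply: ler_sum => i _; rewrite mul0r addr0 -mulrA nrmM exp1rz mulr1.
  by rewrite ler_wpM2l ?nrm_ge0 // nrmM ler_pM ?nrm_ge0.
have inj : injective (fun i : int => 2 * i - z) by move=> i j; lia.
by rewrite -mulr_suml ler_wpM2r ?mulr_ge0 //; apply: sum_inj_le inj HN B.
Qed.

(** Once [i] is centred at half of [z], both factors [ip] tend to [1 / (Q;Q)_oo]. The remaining
    theta sum depends on the parity of [z], hence the restriction to a progression of step 2. *)
Lemma lim_pair_sum (c : int) :
  lim_to (fun m : nat => pair_sum 0 (2 * m%:Z + c))
    (tsum (fun i : int => t ^ ((2 * i + c) * (2 * i + c))) * ((qinf Q Q)^-1 * (qinf Q Q)^-1)).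
Proof.
have [M M0 HM] := ip_bounded Q0 Q1.
have inj : injective (fun i : int => 2 * i + c) by move=> i j; lia.
have S : summable (fun i : int => t ^ ((2 * i + c) * (2 * i + c))).
  by apply: eq_summable (summable_inj inj (summable_th 1 t1)) => i; rewrite exp1rz mulr1.
rewrite mulrC -tsumZ //.
apply: (@eq_lim_to _ _ (fun m : nat => tsum (fun i : int =>
  t ^ ((2 * i + c) * (2 * i + c)) * (ip Q (m%:Z + (i + c)) * ip Q (m%:Z + (- i)))))).
  move=> m; rewrite /pair_sum -(tsum_shift (m%:Z + c) (summable_pair 0 _)).
  apply: eq_tsum => i; rewrite mul0r addr0 mulrA.
  by congr (_ ^ (_ * _) * ip Q _ * ip Q _); ring.
apply: (tannery (rsummableZ (mulr_ge0 M0 M0) S)) => [m i|i].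
  by rewrite nrmM mulrC ler_wpM2r ?nrm_ge0 // nrmM ler_pM ?nrm_ge0.
rewrite [X in lim_to _ X]mulrC.
exact: (lim_toZ _ (lim_toM (lim_ip (i + c) Q0 Q1) (lim_ip (- i) Q0 Q1))).
Qed.

Lemma lim_even_odd (u : nat -> C) l :
  lim_to (fun n => u n.*2) l -> lim_to (fun n => u n.*2.+1) l -> lim_to u l.
Proof.
move=> u0 u1 e e0; have [M HM] := u0 _ e0; have [N HN] := u1 _ e0.
exists (maxn M N).*2.+1 => n Hn; rewrite -(odd_double_half n).
by case: (odd n) => /=; rewrite ?add0n ?add1n; [apply: HN | apply: HM]; lia.
Qed.

Variables (eps : C) (eps2 : eps ^+ 2 = 1).

Lemma eps_neq0 : eps != 0.
Proof. by apply: contra_eq_neq eps2 => ->; rewrite expr0n eq_sym oner_neq0. Qed.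

Lemma nrm_eps : nrm eps = 1.
Proof.
have /eqP : nrm eps ^+ 2 = 1 by rewrite -nrmX eps2 nrm1.
by rewrite sqrf_eq1 => /orP[/eqP //|/eqP e]; have := nrm_ge0 eps; rewrite e; lra.
Qed.

Lemma eps_even (k : int) : eps ^ (2 * k) = 1.
Proof. by rewrite -exprz_exp -exprnP eps2 exp1rz. Qed.

Lemma th_even_odd : th t eps = tsum (fun i : int => t ^ ((2 * i) * (2 * i))) +
  eps * tsum (fun i : int => t ^ ((2 * i + 1) * (2 * i + 1))).
Proof.
have S := summable_th eps t1.
rewrite /th (@tsum_residues _ _ _ 2) // big_ord_recr big_ord1 /=; congr (_ + _).
  by apply: eq_tsum => k; rewrite addr0 eps_even mulr1.
rewrite -tsumZ; last first.
  have inj : injective (fun i : int => 2 * i + 1) by move=> i j; lia.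
  by apply: eq_summable (summable_inj inj (summable_th 1 t1)) => i; rewrite exp1rz mulr1.
apply: eq_tsum => k; rewrite (expfzDr (2 * k) 1 eps_neq0) eps_even mul1r expr1z.
by rewrite mulrC.
Qed.

(** Although [pair_sum 0] has different limits along even and odd arguments, this combination has
    one limit: passing from even to odd interchanges the two parts and [eps^2 = 1] restores the
    signs. *)
Lemma lim_pair_sum_eps (s : int) :
  lim_to (fun n : nat => eps ^ (n%:Z + s) *
      (pair_sum 0 (n%:Z + s) + eps * pair_sum 0 (n%:Z + s + 1)))
    (th t eps * ((qinf Q Q)^-1 * (qinf Q Q)^-1)).
Proof.
pose V (z : int) := eps ^ z * (pair_sum 0 z + eps * pair_sum 0 (z + 1)).
have V0 : lim_to (fun n : nat => V n%:Z) (th t eps * ((qinf Q Q)^-1 * (qinf Q Q)^-1)).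
  have L c := lim_pair_sum c.
  have tsE c : tsum (fun i : int => t ^ ((2 * i + (c + 2)) * (2 * i + (c + 2)))) =
      tsum (fun i : int => t ^ ((2 * i + c) * (2 * i + c))).
    have inj : injective (fun i : int => 2 * i + c) by move=> i j; lia.
    have S : summable (fun i : int => t ^ ((2 * i + c) * (2 * i + c))).
      by apply: eq_summable (summable_inj inj (summable_th 1 t1)) => i; rewrite exp1rz mulr1.
    rewrite -(tsum_shift 1 S); apply: eq_tsum => i; congr (_ ^ (_ * _)); ring.
  have L2 := L (0 + 2); rewrite tsE in L2.
  have e0 : tsum (fun i : int => t ^ ((2 * i + 0) * (2 * i + 0))) =
     tsum (fun i : int => t ^ ((2 * i) * (2 * i))) by apply: eq_tsum => i; rewrite addr0.
  rewrite e0 in L2; have L0 := L 0; rewrite e0 in L0.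
  rewrite th_even_odd mulrDl -mulrA; apply: lim_even_odd.
    apply: eq_lim_to (lim_toD L0 (lim_toZ eps (L 1))) => n.
    rewrite /V (_ : n.*2%:Z = 2 * n%:Z); last by lia.
    by rewrite eps_even mul1r addr0.
  apply: eq_lim_to (lim_toD L2 (lim_toZ eps (L 1))) => n.
  rewrite /V (_ : n.*2.+1%:Z = 2 * n%:Z + 1); last by lia.
  rewrite (expfzDr (2 * n%:Z) 1 eps_neq0) eps_even mul1r expr1z mulrDr mulrA -expr2 eps2 mul1r addrC.
  by rewrite -addrA.
apply: (@lim_to_shiftI _ _ _ _ `|s|%N).
pose b := absz (`|s|%N%:Z + s); have b_eq : b%:Z = `|s|%N%:Z + s by rewrite /b; lia.
apply: eq_lim_to (lim_to_shift b V0) => n; rewrite /V.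
by rewrite (_ : (n + b)%N%:Z = (n + `|s|)%N%:Z + s) //; lia.
Qed.

End Pairs.

Section Triples.
Context {R : realType} {C : cvalField R}.
Variables (q : C) (q0 : q != 0) (q1 : nrm q < 1).

Let t := q ^+ 2.
Let p := t ^+ 2.
Let t0 : t != 0. Proof. exact: expf_neq0. Qed.
Let t1 : nrm t < 1. Proof. exact: nrm_sqr_lt1. Qed.
Let p0 : p != 0. Proof. exact: expf_neq0. Qed.
Let p1 : nrm p < 1. Proof. exact: nrm_sqr_lt1. Qed.

Let tE (n : int) : t ^ n = q ^ (2 * n). Proof. by rewrite /t exprnP exprz_exp. Qed.
Let pE (n : int) : p ^ n = q ^ (4 * n).
Proof. by rewrite /p /t -exprM exprnP exprz_exp. Qed.

(** Here [k] stands for the middle index [j] of the triple and [s] for [i + k - m] formed with the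
    outer indices. *)
Definition mid_term (s k : int) : C := q ^ ((s - k) * (s - k)) * (t ^ (k * k) * ip p k).

Definition mid_sum (s : int) : C := tsum (mid_term s).

Lemma summable_mid2 : summable (fun x : int * int => mid_term x.1 x.2).
Proof.
have inj : injective (fun x : int * int => (x.1 - x.2, x.2)).
  by move=> [s k] [s' k'] /= [e ek]; congr pair => //; lia.
have S := summable_prod (summable_th 1 q1) (summable_euler 1 t1).
apply: eq_summable (summable_inj inj S) => -[s k] /=.
by rewrite !exp1rz !mulr1.
Qed.

Lemma summable_mid s : summable (mid_term s).
Proof. exact: (summable_row s summable_mid2). Qed.

Lemma summable_mid_sum : summable mid_sum.
Proof. exact: (summable_rows summable_mid2). Qed.

(** Write [1 = p^k + (1 - p^k)]. Completing squares, the first part is absorbed by [s -> s - 2]; in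
    the second, [1 - p^k] lowers [k] by one and [s] goes to [s - 3]. *)
Lemma mid_sum_rec s :
  mid_sum s = q ^ (4 * s - 4) * mid_sum (s - 2) + q ^ (4 * s - 6) * mid_sum (s - 3).
Proof.
rewrite /mid_sum -(tsum_shift (-1) (summable_mid (s - 3))) -!tsumZ; last first.
- exact: summable_mid.
- exact: (summable_shift (-1) (summable_mid (s - 3))).
rewrite -tsumD; last first.
- exact/summableZ/(summable_shift (-1) (summable_mid (s - 3))).
- exact/summableZ/summable_mid.
apply: eq_tsum => k; rewrite /mid_term -(ipB1 k p1).
have e1 : q ^ (4 * s - 4) * (q ^ ((s - 2 - k) * (s - 2 - k)) * t ^ (k * k)) =
    q ^ ((s - k) * (s - k)) * t ^ (k * k) * p ^ k.
  by rewrite !tE pE -!expfzDr //; congr (_ ^ _); ring.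
have e2 : q ^ (4 * s - 6) * (q ^ ((s - 3 - (k - 1)) * (s - 3 - (k - 1))) * t ^ ((k - 1) * (k - 1))) =
    q ^ ((s - k) * (s - k)) * t ^ (k * k).
  by rewrite !tE -!expfzDr //; congr (_ ^ _); ring.
transitivity (q ^ (4 * s - 4) * (q ^ ((s - 2 - k) * (s - 2 - k)) * t ^ (k * k)) * ip p k +
  q ^ (4 * s - 6) * (q ^ ((s - 3 - (k - 1)) * (s - 3 - (k - 1))) * t ^ ((k - 1) * (k - 1))) *
    ((1 - p ^ k) * ip p k)); last by rewrite !mulrA.
rewrite e1 e2; ring.
Qed.

(* With [i + k = z] this is the sum over [i, j, k] of [triple_term] below. *)
Definition triple_sum (m : int) : C := tsum (fun z : int => pair_sum t 0 z * mid_sum (z - m)).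

Lemma summable_triple_sum m : summable (fun z : int => pair_sum t 0 z * mid_sum (z - m)).
Proof.
have [K K0 HK] := pair_sum_bounded t0 t1.
have S := summable_bounded_mul K0 HK (summable_shift (- m) summable_mid_sum).
by apply: eq_summable S => z; rewrite mulrC.
Qed.

Lemma triple_sum_shift m (a : int) :
  triple_sum (m - a) = tsum (fun z : int => pair_sum t 0 (z - a) * mid_sum (z - m)).
Proof.
rewrite /triple_sum -(tsum_shift (- a) (summable_triple_sum _)); apply: eq_tsum => z.
by congr (_ * mid_sum _); ring.
Qed.

Lemma summable_triple_sum_shift m (a : int) :
  summable (fun z : int => pair_sum t 0 (z - a) * mid_sum (z - m)).
Proof.
apply: eq_summable (summable_shift (- a) (summable_triple_sum (m - a))) => z.
by congr (_ * mid_sum _); ring.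
Qed.

(** Shifting [z] in the convolution turns a shift of the argument of [pair_sum] into a shift of [m].
    The left side of [pair_sum_recurrence] becomes the constant-coefficient part, and its right side
    becomes, through [mid_sum_rec], a multiple of a single triple sum. *)
Lemma triple_sum_recurrence m :
  triple_sum m = t * triple_sum (m - 1) + triple_sum (m - 2)
    - t * (1 - p ^ (m - 2)) * triple_sum (m - 3).
Proof.
have S a := summable_triple_sum_shift m a.
pose F (a z : int) := pair_sum t 0 (z - a) * mid_sum (z - m).
have [K K0 HK] := pair_sum_bounded t0 t1.
(* The factor [p^z] is unbounded only for negative [z], where [pair_sum] vanishes. *)
have pS : summable (fun z => p ^ z * (pair_sum t 0 z * mid_sum (z - m))).
  apply: summable_le (summable_triple_sum m) _ => -[n|n].
    rewrite (nrmM (p ^ _)) ler_piMl ?nrm_ge0 // -exprnP nrmX exprn_ile1 ?nrm_ge0 //; exact: ltW.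
  by rewrite (pair_sum_lt0 t0 t1) mul0r mulr0.
have pS1 : summable (fun z => t * p ^ z * (pair_sum t 0 z * mid_sum (z + 1 - m))).
  apply: summable_le (summableZ t (summable_triple_sum (m - 1))) _ => -[n|n].
    rewrite -mulrA (nrmM t) (nrmM t) ler_wpM2l ?nrm_ge0 // (_ : n%:Z + 1 - m = n%:Z - (m - 1)); last by ring.
    rewrite (nrmM (p ^ _)) ler_piMl ?nrm_ge0 // -exprnP nrmX exprn_ile1 ?nrm_ge0 //; exact: ltW.
  by rewrite (pair_sum_lt0 t0 t1) !mul0r !mulr0.
have lhs : triple_sum m - t * triple_sum (m - 1) - triple_sum (m - 2) + t * triple_sum (m - 3) =
    tsum (fun z => p ^ z * (pair_sum t 0 z * mid_sum (z - m)) +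
      t * p ^ (z + -1) * (pair_sum t 0 (z + -1) * mid_sum (z + -1 + 1 - m))).
  rewrite -{1}(subr0 m) !triple_sum_shift.
  rewrite -!tsumZ // -!tsumB //; first last.
  - exact/summableZ.
  - exact/summableB/summableZ.
  rewrite -tsumD; first last.
  - exact/summableZ.
  - by apply: summableB => //; apply: summableB => //; exact: summableZ.
  apply: eq_tsum => z; rewrite subr0 (_ : z + -1 + 1 - m = z - m); last by ring.
  have := pair_sum_recurrence t0 t1 z; rewrite -/p.
  move: (pair_sum t 0 _) (pair_sum t 0 _) (pair_sum t 0 _) (pair_sum t 0 _) => a b c d.
  move: (mid_sum _) (p ^ _) (p ^ _) => k u v H.
  by rewrite !mulrA -!mulrDl -!mulrBl -!mulrDl -H; ring.
(* After the shift the coefficient of [pair_sum t 0 z] is, up to [t p^(m-2)], exactly [mid_sum_rec]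
   at [s = z - m + 3]. *)
have rhs : tsum (fun z => p ^ z * (pair_sum t 0 z * mid_sum (z - m)) +
      t * p ^ (z + -1) * (pair_sum t 0 (z + -1) * mid_sum (z + -1 + 1 - m))) =
    t * p ^ (m - 2) * triple_sum (m - 3).
  rewrite tsumD //; last exact: (summable_shift (-1) pS1).
  rewrite (tsum_shift (-1) pS1) -tsumD // -tsumZ; last exact: summable_triple_sum.
  apply: eq_tsum => z; rewrite (_ : z - (m - 3) = z - m + 3); last by ring.
  rewrite (mid_sum_rec (z - m + 3)) (_ : z - m + 3 - 2 = z + 1 - m); last by ring.
  rewrite (_ : z - m + 3 - 3 = z - m); last by ring.
  have e1 : t * p ^ (m - 2) * q ^ (4 * (z - m + 3) - 4) = t * p ^ z.
    by rewrite -mulrA !pE -expfzDr //; congr (_ * _ ^ _); ring.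
  have e2 : t * p ^ (m - 2) * q ^ (4 * (z - m + 3) - 6) = p ^ z.
    rewrite (_ : t = q ^ 2%:Z) // !pE -!expfzDr //; congr (_ ^ _); ring.
  rewrite -[in LHS]e1 -e2; ring.
rewrite rhs in lhs; apply/eqP; rewrite -subr_eq0; apply/eqP.
transitivity (triple_sum m - t * triple_sum (m - 1) - triple_sum (m - 2) + t * triple_sum (m - 3)
  - t * p ^ (m - 2) * triple_sum (m - 3)); first by ring.
by rewrite lhs subrr.
Qed.

Lemma triple_sum_bounded : exists K : R, forall m, nrm (triple_sum m) <= K.
Proof.
have [K K0 HK] := pair_sum_bounded t0 t1; have [N HN] := summable_mid_sum.
exists (K * N) => m; apply: tsum_bound => B.
rewrite (@le_trans _ _ (\sum_(z <- B) K * nrm (mid_sum (z - m)))) //.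
  by rewrite ler_sum // => z _; rewrite nrmM ler_wpM2r ?nrm_ge0.
rewrite -mulr_sumr ler_wpM2l //.
by apply: (@sum_inj_le _ _ _ _ (fun z => z - m)) => // x y /addIr.
Qed.

Section Sign.
Variables (eps : C) (eps2 : eps ^+ 2 = 1).

(** Since [eps^s = eps^(s-k) eps^k], the double sum separates in the variables [s - k] and [k]. *)
Lemma mid_sum_eps : tsum (fun s : int => eps ^ s * mid_sum s) = th q eps * euler_sum t eps.
Proof.
have e0 := eps_neq0 eps2; have ne := nrm_eps eps2.
have S := summable_prod (summable_th eps q1) (summable_euler eps t1).
rewrite -(tsum_prod (summable_th eps q1) (summable_euler eps t1)).
pose h (x : int * int) := (x.1 - x.2, x.2); pose h' (x : int * int) := (x.1 + x.2, x.2).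
have hK : cancel h h' by move=> [s k]; rewrite /h /h' /= subrK.
have h'K : cancel h' h by move=> [s k]; rewrite /h /h' /= addrK.
rewrite -(tsum_bij S hK h'K) (tsum_fubini (summable_inj (can_inj hK) S)) /=.
apply: eq_tsum => s; rewrite -tsumZ; last exact: summable_mid.
apply: eq_tsum => k; rewrite /mid_term -[in LHS](subrK k s) (expfzDr _ _ e0) subrK; ring.
Qed.

(** Replacing [z] by [z + m] leaves [m] in the pair sums only. There [lim_pair_sum_eps] gives the
    termwise limit, and the summable family [mid_sum] dominates. *)
Lemma lim_triple_sum :
  lim_to (fun m : nat => eps ^+ m * triple_sum m + eps ^+ m.+1 * triple_sum m.+1)
    (th q eps * euler_sum t eps * (th t eps * ((qinf p p)^-1 * (qinf p p)^-1))).
Proof.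
have e0 := eps_neq0 eps2; have ne := nrm_eps eps2.
have [K K0 HK] := pair_sum_bounded t0 t1.
pose V (z : int) := eps ^ z * (pair_sum t 0 z + eps * pair_sum t 0 (z + 1)).
have nz (z : int) : nrm (eps ^ z) = 1 by rewrite nrmXz ne exp1rz.
have VK z : nrm (V z) <= K + K.
  by rewrite nrmM nz mul1r (le_trans (nrmD _ _)) // nrmM ne mul1r lerD.
have eS : summable (fun s => eps ^ s * mid_sum s).
  by apply: summable_le summable_mid_sum _ => s; rewrite nrmM nz mul1r.
rewrite -mid_sum_eps mulrC -tsumZ //.
apply: (@eq_lim_to _ _ (fun m : nat => tsum (fun s => V (m%:Z + s) * (eps ^ s * mid_sum s)))).
  move=> m; rewrite /triple_sum -(tsum_shift m (summable_triple_sum m)).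
  rewrite -(tsum_shift m.+1 (summable_triple_sum m.+1)) -!tsumZ; last first.
  - exact: (summable_shift m (summable_triple_sum m)).
  - exact: (summable_shift m.+1 (summable_triple_sum m.+1)).
  rewrite -tsumD; last first.
  - exact/summableZ/(summable_shift m.+1 (summable_triple_sum m.+1)).
  - exact/summableZ/(summable_shift m (summable_triple_sum m)).
  apply: eq_tsum => s; rewrite !addrK /V (expfzDr _ _ e0) -exprnP exprS.
  have -> : s + m.+1 = m%:Z + s + 1 by lia.
  have es : eps ^ s * eps ^ s = 1.
    by rewrite -expfzDr // (_ : s + s = 2 * s) ?eps_even //; ring.
  rewrite (addrC s); transitivity (eps ^+ m * (pair_sum t 0 (m%:Z + s) + eps * pair_sum t 0 (m%:Z + s + 1)) * mid_sum s * (eps ^ s * eps ^ s)).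
    ring.
  by rewrite es; ring.
apply: (tannery (rsummableZ (addr_ge0 K0 K0) eS)) => [m s|s].
  by rewrite nrmM ler_wpM2r ?nrm_ge0.
exact: (lim_toM (lim_pair_sum_eps t0 t1 eps2 s) (lim_to_cst _)).
Qed.

End Sign.
End Triples.

(** * The linear equations for the triple sums *)

Section Elimination.
Context {R : realType} {C : cvalField R}.

Lemma lim_partial_sums (f : nat -> C) : summable f ->
  lim_to (fun n => \sum_(i < n) f i) (tsum f).
Proof.
move=> /tsumP fs e /fs[A HA]; exists (\max_(i <- A) i).+1 => n Hn.
have -> : \sum_(i < n) f i = \sum_(i <- [fset k in iota 0 n]%fset) f i.
  rewrite -(big_mkord xpredT) /index_iota subn0; apply/perm_big/uniq_perm.
  - exact: iota_uniq.
  - exact: fset_uniq.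
  - by move=> i; rewrite !inE.
apply/HA/fsubsetP => i iA; rewrite !inE mem_iota /= add0n (leq_trans _ Hn) // ltnS.
exact: leq_bigmax_seq.
Qed.

Variables (tau : C) (tau1 : nrm tau < 1) (U A Y : nat -> C) (l : C).
Hypothesis U_bounded : exists K : R, forall n, nrm (U n) <= K.
Hypothesis U2 : U 2 = tau * U 1%N + U 0%N.
Hypothesis U_rec : forall k, U k.+3 = tau * U k.+2 + U k.+1 - tau * (1 - tau ^+ (2 * k.+1)) * U k.
Hypothesis U_lim : lim_to (fun n => U n + U n.+1) l.
Hypothesis A_bounded : exists K : R, forall n, nrm (A n) <= K.
Hypothesis A0 : A 0 = 1.
(** Together with [A0], the relations [AY] and [AS] determine both sequences. They are the
    multipliers for which the iterated relation between [gam n] and [gam n.+1] telescopes. *)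
Hypothesis AY : forall n, A n = Y n * (1 - tau ^+ (2 * n).+1).
Hypothesis AS : forall n, A n.+1 * (1 - tau ^+ (4 * n.+1)) = tau ^+ (2 * n).+1 * Y n.

Let gam n := tsum (fun k : nat => U k * tau ^+ (2 * n * k)).

Let gam_summable n : (0 < n)%N -> summable (fun k : nat => U k * tau ^+ (2 * n * k)).
Proof.
move=> n0; have [K HK] := U_bounded.
have K0 : 0 <= K := le_trans (nrm_ge0 _) (HK 0%N).
have r : 0 <= nrm tau < 1 by rewrite nrm_ge0.
apply: (summable_leZ (nat_geo_sums r) K0) => k.
rewrite nrmM ler_pM ?nrm_ge0 // nrmX; apply: ler_wiXn2l; [exact: nrm_ge0|exact: ltW|].
by rewrite leq_pmull // muln_gt0.
Qed.

(** [U_rec] is multiplied by [z^(k+3)], [z = tau^(2n)], and summed. The variable coefficient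
    [tau^(2k)] replaces [z] by [tau^2 z], which is where [gam n.+1] comes from. *)
Let gam_rec n : (0 < n)%N -> (1 - tau ^+ (2 * n).+1) * (1 - tau ^+ (4 * n)) * gam n =
  U 0%N * (1 - tau ^+ (2 * n).+1) + U 1%N * tau ^+ (2 * n) + tau ^+ (6 * n + 3) * gam n.+1.
Proof.
move=> n0; pose z := tau ^+ (2 * n); pose f k := U k * tau ^+ (2 * n * k).
have fz k : f k = U k * z ^+ k by rewrite /f exprM.
have fS : summable f := gam_summable n0.
have fS1 : summable (fun k => f k.+1) by apply: summable_inj fS => i j [].
have fS2 : summable (fun k => f k.+2) by apply: summable_inj fS => i j [].
have gS := gam_summable (ltn0Sn n).
have e1 : gam n = f 0%N + tsum (fun k => f k.+1) by exact: tsum_natS.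
have e2 : tsum (fun k => f k.+1) = f 1%N + tsum (fun k => f k.+2) by exact: tsum_natS.
have e3 : tsum (fun k => f k.+2) = f 2 + tsum (fun k => f k.+3) by exact: tsum_natS.
have e4 : tsum (fun k => f k.+3) = tau * z * tsum (fun k => f k.+2) +
    z ^+ 2 * tsum (fun k => f k.+1) - tau * z ^+ 3 * tsum f + tau ^+ 3 * z ^+ 3 * gam n.+1.
  rewrite -!tsumZ // -tsumD -?tsumB -?tsumD; try by [exact: summableZ |
    apply: summableD; exact: summableZ | apply: summableB; [apply: summableD|]; exact: summableZ].
  apply: eq_tsum => k; rewrite !fz U_rec.
  have -> : tau ^+ (2 * n.+1 * k) = z ^+ k * tau ^+ (2 * k).
    by rewrite /z -exprM -exprD; congr (_ ^+ _); lia.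
  have -> : tau ^+ (2 * k.+1) = tau ^+ 2 * tau ^+ (2 * k) by rewrite -exprD; congr (_ ^+ _); lia.
  rewrite !exprS; ring.
have f0 : f 0%N = U 0%N by rewrite fz mulr1.
have f1 : f 1%N = U 1%N * z by rewrite fz.
have f2 : f 2 = (tau * U 1%N + U 0%N) * z ^+ 2 by rewrite fz U2.
have -> : tau ^+ (2 * n).+1 = tau * z by rewrite exprS.
have -> : tau ^+ (4 * n) = z ^+ 2 by rewrite /z -exprM; congr (_ ^+ _); lia.
have -> : tau ^+ (6 * n + 3) = tau ^+ 3 * z ^+ 3.
  by rewrite /z -exprM -exprD; congr (_ ^+ _); lia.
rewrite -/z; move: e4; rewrite -/(gam n).
have -> : tsum (fun k => f k.+3) = gam n - f 0%N - f 1%N - f 2 by rewrite e1 e2 e3; ring.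
have -> : tsum (fun k => f k.+2) = gam n - f 0%N - f 1%N by rewrite e1 e2; ring.
have -> : tsum (fun k => f k.+1) = gam n - f 0%N by rewrite e1; ring.
rewrite f0 f1 f2; move: (gam n) (gam n.+1) => g g' H.
have {}H : g = (U 0%N + U 1%N * z + (tau * U 1%N + U 0%N) * z ^+ 2) +
  (tau * z * (g - U 0%N - U 1%N * z) + z ^+ 2 * (g - U 0%N) - tau * z ^+ 3 * g + tau ^+ 3 * z ^+ 3 * g').
  by rewrite -H; ring.
apply/eqP; rewrite -subr_eq0; apply/eqP; rewrite -[RHS](subrr g) [X in _ = _ - X]H; ring.
Qed.

(** This replaces [gam_rec] at [n = 0], where the series need not converge: the product of the
    vanishing factor and [gam 0] gives way to [l]. *)
Let gam_base : (1 - tau) * l = U 0%N * (1 - tau) + U 1%N + tau ^+ 3 * gam 1.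
Proof.
(* By [U_rec] the increment of [a] is [tau^3 tau^(2k) U k], a term of [gam 1], while [a] itself
   tends to [(1 - tau) l]. *)
pose a k := U k.+2 + U k.+1 - tau * (U k.+1 + U k).
have aE k : a k = U 0%N * (1 - tau) + U 1%N + tau ^+ 3 * \sum_(j < k) U j * tau ^+ (2 * 1 * j).
  elim: k => [|k IH]; first by rewrite /a big_ord0 U2; ring.
  rewrite big_ord_recr /= (mulrDr (tau ^+ 3)) addrA -IH /a U_rec.
  have -> : tau ^+ (2 * k.+1) = tau ^+ 2 * tau ^+ (2 * 1 * k) by rewrite -exprD; congr (_ ^+ _); lia.
  ring.
have L1 : lim_to a ((1 - tau) * l).
  have := lim_toD (lim_to_shift 1 U_lim) (lim_toZ (- tau) U_lim).
  rewrite (_ : l + - tau * l = (1 - tau) * l); last by ring.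
  by apply: eq_lim_to => n; rewrite /a !addn1; ring.
apply: lim_to_uniq L1 _; apply: eq_lim_to (lim_toD (lim_to_cst _)
  (lim_toZ (tau ^+ 3) (lim_partial_sums (gam_summable (ltn0Sn 0))))) => n.
by rewrite aE.
Qed.

(* [gam] is the generating function of [U] at [tau ^ (2 n)]; the recurrence for
   [U] links [gam n] to [gam n.+1], and iterating it expresses [l] by [U 0] and
   [U 1] alone, with a remainder that tends to 0. *)
Lemma elimination :
  lim_to (fun n => \sum_(j < n) (tau ^+ (2 * j ^ 2) * A j * U 0%N +
    tau ^+ (2 * j ^ 2 + 2 * j) * Y j * U 1%N)) l.
Proof.
pose c j := tau ^+ (2 * j ^ 2) * A j * U 0%N + tau ^+ (2 * j ^ 2 + 2 * j) * Y j * U 1%N.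
pose b n := tau ^+ (2 * n ^ 2) * A n * (1 - tau ^+ (4 * n)).
have step m X : X = U 0%N * (1 - tau ^+ (2 * m).+1) + U 1%N * tau ^+ (2 * m) +
    tau ^+ (6 * m + 3) * gam m.+1 -> tau ^+ (2 * m ^ 2) * Y m * X = c m + b m.+1 * gam m.+1.
  move=> ->; rewrite /c /b -[_ * A m.+1 * _]mulrA AS AY.
  have -> : tau ^+ (2 * m ^ 2 + 2 * m) = tau ^+ (2 * m ^ 2) * tau ^+ (2 * m) by rewrite exprD.
  have -> : tau ^+ (2 * m.+1 ^ 2) * (tau ^+ (2 * m).+1 * Y m) =
      tau ^+ (2 * m ^ 2) * tau ^+ (6 * m + 3) * Y m.
    by rewrite mulrA -!exprD; congr (_ ^+ _ * _); lia.
  ring.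
have rem n : l = \sum_(j < n.+1) c j + b n.+1 * gam n.+1.
  elim: n => [|n IH].
    rewrite big_ord1 -(step 0%N ((1 - tau) * l)).
      by rewrite expr0 mul1r mulrA -[Y 0%N * _]/(Y 0%N * (1 - tau ^+ (2 * 0).+1)) -AY A0 mul1r.
    by rewrite gam_base muln0 expr1 expr0 mulr1.
  rewrite big_ord_recr /= IH -addrA; congr (_ + _).
  rewrite -(step _ ((1 - tau ^+ (2 * n.+1).+1) * (1 - tau ^+ (4 * n.+1)) * gam n.+1)).
    rewrite /b AY; ring.
  exact: gam_rec.
have [K HK] := U_bounded; have [L HL] := A_bounded.
have r01 : 0 <= nrm tau < 1 by rewrite nrm_ge0.
have [M HM] := nat_geo_sums r01.
have K0 : 0 <= K := le_trans (nrm_ge0 _) (HK 0%N).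
have L0 : 0 <= L := le_trans (nrm_ge0 _) (HL 0%N).
have pow_le m n : (n <= m)%N -> nrm (tau ^+ m) <= nrm tau ^+ n.
  by move=> nm; rewrite nrmX; apply: ler_wiXn2l; rewrite ?nrm_ge0 ?ltW.
have gam_le n : nrm (gam n.+1) <= K * M.
  apply: tsum_bound => B; apply: le_trans (ler_wpM2l K0 (HM B)).
  rewrite mulr_sumr ler_sum // => k _; rewrite nrmM ler_pM ?nrm_ge0 // pow_le //.
  by rewrite leq_pmull // muln_gt0.
have rem0 : lim_to (fun n => b n.+1 * gam n.+1) 0.
  apply: (@lim_to_geo _ _ (nrm tau) _ (L * 2 * (K * M))) => // n.
  rewrite nrmM mulrAC; apply: ler_pM; rewrite ?nrm_ge0 // /b nrmM mulrAC.
  apply: ler_pM; rewrite ?nrm_ge0 //.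
    rewrite nrmM mulrC ler_pM ?nrm_ge0 // pow_le //; lia.
  rewrite (le_trans (nrmB _ _)) // nrm1 (_ : 2 = 1 + 1 :> R) // lerD2l.
  by rewrite (le_trans (pow_le _ 0%N _)) // expr0.
apply: (@lim_to_shiftI _ _ _ _ 1).
have := lim_toD (lim_to_cst l) (lim_toZ (-1) rem0); rewrite mulr0 addr0.
by apply: eq_lim_to => n; rewrite {1}(rem n) addn1; ring.
Qed.

End Elimination.

(** * The Bailey pair and its theta evaluations *)

Section BaileyPair.
Context {R : realType} {C : cvalField R}.
Variables (eta : C) (eta0 : eta != 0) (eta1 : nrm eta < 1).
Implicit Types (b n r : int).

Let Q := eta ^+ 4.
Let Q0 : Q != 0. Proof. exact: expf_neq0. Qed.
Let Q1 : nrm Q < 1. Proof. exact: nrm_expr_lt1. Qed.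
Let QE n : Q ^ n = eta ^ (4 * n). Proof. by rewrite /Q exprnP exprz_exp. Qed.

Let sg r : C := (-1) ^ r.
Let sgS r : sg (r + 1) = - sg r.
Proof. by rewrite /sg expfzDr ?oppr_eq0 ?oner_eq0 // expr1z mulrN1. Qed.
Let sgN r : sg (- r) = sg r.
Proof. by rewrite /sg -exprz_inv invrN invr1. Qed.

(* For [b = 1] and [b = -1] respectively, these are the sides [A] and [Y] of the
   system in [elimination] for [tau = - eta ^ 2]: a Bailey pair whose
   coefficients are the signed powers of [eta]. *)
Definition bailey_w n b : C := tsum (fun r : int =>
  sg r * eta ^ (r * r + b * r) * (ip Q (n + r) * ip Q (n - r))).
Definition bailey_y n b : C := tsum (fun r : int =>
  sg r * eta ^ (r * r + b * r) * (ip Q (n + 1 + r) * ip Q (n - r))).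

Lemma ip_pair_bounded : exists2 M : R, 0 <= M &
  forall m n, nrm (ip Q m * ip Q n) <= M.
Proof.
have [M M0 HM] := ip_bounded Q0 Q1; exists (M * M) => [|m n]; first exact: mulr_ge0.
by rewrite nrmM ler_pM ?nrm_ge0.
Qed.

Lemma summable_bailey_theta b : summable (fun r : int => sg r * eta ^ (r * r + b * r)).
Proof.
apply: eq_summable (summable_th (- eta ^ b) eta1) => r.
by rewrite (expfzDr (r * r) (b * r) eta0) -(exprz_exp eta b r) -[- eta ^ b]mulN1r expfzMl /sg; ring.
Qed.

Lemma summable_w n b : summable (fun r : int =>
  sg r * eta ^ (r * r + b * r) * (ip Q (n + r) * ip Q (n - r))).
Proof.
have [M M0 HM] := ip_pair_bounded.
by apply: (summable_bounded_mul M0) (summable_bailey_theta b) => r.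
Qed.

Lemma summable_y n b : summable (fun r : int =>
  sg r * eta ^ (r * r + b * r) * (ip Q (n + 1 + r) * ip Q (n - r))).
Proof.
have [M M0 HM] := ip_pair_bounded.
by apply: (summable_bounded_mul M0) (summable_bailey_theta b) => r.
Qed.

Lemma bailey_w_sym n b : bailey_w n (- b) = bailey_w n b.
Proof.
rewrite /bailey_w -(tsum_reflect 0 (summable_w n b)); apply: eq_tsum => r.
rewrite sub0r opprK sgN (mulrC (ip Q (n - r))); congr (_ * _ ^ _ * _); ring.
Qed.

Lemma bailey_y_sym n b : bailey_y n b = - eta ^ (1 - b) * bailey_y n (2 - b).
Proof.
rewrite /bailey_y -(tsum_reflect (-1) (summable_y n b)) -tsumZ; last exact: summable_y.
apply: eq_tsum => r.
rewrite (_ : n + 1 + (-1 - r) = n - r); last by ring.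
rewrite (_ : n - (-1 - r) = n + 1 + r); last by ring.
rewrite (_ : -1 - r = - (r + 1)); last by ring.
rewrite sgN sgS.
have -> : eta ^ (- (r + 1) * - (r + 1) + b * - (r + 1)) =
    eta ^ (1 - b) * eta ^ (r * r + (2 - b) * r).
  by rewrite -expfzDr //; congr (_ ^ _); ring.
ring.
Qed.

(** The factor on the left is split as [(1 - Q^(n+1+r)) + Q^(n+1+r) (1 - Q^(n-r))], so that each
    part lowers one of the two arguments of [ip]. The same device, with [n + 1 - r], proves
    [bailey_w_rec]. *)
Lemma bailey_y_rec n b : (1 - Q ^ (2 * n + 1)) * bailey_y n b =
  bailey_w n b - Q ^ n * eta ^ (1 - b) * bailey_w n (b + 2).
Proof.
rewrite /bailey_y /bailey_w -mulNr -(tsum_shift 1 (summable_w n (b + 2))) -!tsumZ; first last.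
- exact: summable_y.
- exact: (summable_shift 1 (summable_w n (b + 2))).
rewrite -tsumD; first last.
- exact/summableZ/(summable_shift 1 (summable_w n (b + 2))).
- exact: summable_w.
apply: eq_tsum => r; rewrite sgS.
rewrite (_ : n + (r + 1) = n + 1 + r); last by ring.
rewrite (_ : n - (r + 1) = n - r - 1); last by ring.
rewrite (_ : n + r = n + 1 + r - 1); last by ring.
rewrite -(ipB1 (n - r) Q1) -(ipB1 (n + 1 + r) Q1).
have -> : Q ^ (2 * n + 1) = Q ^ (n + 1 + r) * Q ^ (n - r).
  by rewrite -expfzDr //; congr (_ ^ _); ring.
have e : Q ^ n * eta ^ (1 - b) * eta ^ ((r + 1) * (r + 1) + (b + 2) * (r + 1)) =
    Q ^ (n + 1 + r) * eta ^ (r * r + b * r).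
  by rewrite !QE -!expfzDr //; congr (_ ^ _); ring.
transitivity (sg r * eta ^ (r * r + b * r) * ((1 - Q ^ (n + 1 + r)) * ip Q (n + 1 + r) * ip Q (n - r)) +
   sg r * (Q ^ (n + 1 + r) * eta ^ (r * r + b * r)) * (ip Q (n + 1 + r) * ((1 - Q ^ (n - r)) * ip Q (n - r)))).
  ring.
rewrite -e; ring.
Qed.

Lemma bailey_w_rec n b : (1 - Q ^ (2 * n + 2)) * bailey_w (n + 1) b =
  bailey_y n b - Q ^ n * eta ^ (1 + b) * bailey_y n (b - 2).
Proof.
rewrite /bailey_y /bailey_w -mulNr -(tsum_shift (-1) (summable_y n (b - 2))) -!tsumZ; first last.
- exact: summable_w.
- exact: (summable_shift (-1) (summable_y n (b - 2))).
rewrite -tsumD; first last.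
- exact/summableZ/(summable_shift (-1) (summable_y n (b - 2))).
- exact: summable_y.
apply: eq_tsum => r.
have -> : sg r = - sg (r - 1) by rewrite -sgS subrK.
rewrite (_ : n + 1 + (r - 1) = n + 1 + r - 1); last by ring.
rewrite (_ : n - (r - 1) = n + 1 - r); last by ring.
rewrite (_ : n - r = n + 1 - r - 1); last by ring.
rewrite -(ipB1 (n + 1 - r) Q1) -(ipB1 (n + 1 + r) Q1).
have -> : Q ^ (2 * n + 2) = Q ^ (n + 1 + r) * Q ^ (n + 1 - r).
  by rewrite -expfzDr //; congr (_ ^ _); ring.
have e : Q ^ n * eta ^ (1 + b) * eta ^ ((r - 1) * (r - 1) + (b - 2) * (r - 1)) =
    Q ^ (n + 1 - r) * eta ^ (r * r + b * r).
  by rewrite !QE -!expfzDr //; congr (_ ^ _); ring.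
transitivity (- sg (r - 1) * eta ^ (r * r + b * r) * (ip Q (n + 1 + r) * ((1 - Q ^ (n + 1 - r)) * ip Q (n + 1 - r))) +
   - sg (r - 1) * (Q ^ (n + 1 - r) * eta ^ (r * r + b * r)) *
   ((1 - Q ^ (n + 1 + r)) * ip Q (n + 1 + r) * ip Q (n + 1 - r))).
  ring.
rewrite -e; ring.
Qed.

Let tau := - eta ^+ 2.

(** The reflection in [bailey_y_sym] sends [b = 1] to itself with sign -1, so [bailey_y n 1 = 0] and
    [bailey_w_rec] keeps one term. In [bailey_y_rec] at [b = -1] the two values of [bailey_w]
    coincide, and the common factor [1 + tau^(2n+1)] cancels. *)
Lemma bailey_wy (n : nat) :
  bailey_w n 1 = bailey_y n (-1) * (1 - tau ^+ (2 * n).+1) /\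
  bailey_w n.+1 1 * (1 - tau ^+ (4 * n.+1)) = tau ^+ (2 * n).+1 * bailey_y n (-1).
Proof.
have tau2 : tau ^+ 2 = Q by rewrite /tau sqrrN -exprM.
have y1 : bailey_y n 1 = 0.
  have := bailey_y_sym n 1; rewrite subrr expr0z (_ : 2 - 1 = 1 :> int) // mulN1r => /eqP.
  by rewrite -addr_eq0 -mulr2n mulrn_eq0 => /eqP.
have tn : Q ^ n * eta ^ 2 = - tau ^+ (2 * n).+1.
  by rewrite exprS exprM tau2 -exprnP /tau -exprnP; ring.
have Qn1 : Q ^ (2 * n%:Z + 1) = tau ^+ (2 * n).+1 * tau ^+ (2 * n).+1.
  rewrite -exprD -tau2 exprnP exprz_exp exprnP; congr (_ ^ _); lia.
have Qn2 : Q ^ (2 * n%:Z + 2) = tau ^+ (4 * n.+1).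
  rewrite -tau2 exprnP exprz_exp exprnP; congr (_ ^ _); lia.
have W : (1 - Q ^ (2 * n%:Z + 2)) * bailey_w (n%:Z + 1) 1 =
    bailey_y n 1 - Q ^ n * eta ^ 2 * bailey_y n (-1).
  by have := bailey_w_rec n 1; congr (_ = _ - _ * eta ^ _ * bailey_y _ _).
have Y : (1 - Q ^ (2 * n%:Z + 1)) * bailey_y n (-1) =
    bailey_w n (-1) - Q ^ n * eta ^ 2 * bailey_w n 1.
  by have := bailey_y_rec n (-1); congr (_ = _ - _ * eta ^ _ * bailey_w _ _).
rewrite y1 sub0r Qn2 tn in W; rewrite bailey_w_sym Qn1 tn in Y; split.
  have s0 : 1 + tau ^+ (2 * n).+1 != 0.
    have t1 : nrm (- tau ^+ (2 * n).+1) < 1.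
      by rewrite nrmN nrm_expr_lt1 // /tau nrmN nrm_sqr_lt1.
    by have := one_sub_neq0 t1; rewrite opprK.
  apply: (mulfI s0); move: Y; move: (tau ^+ _) (bailey_y _ _) (bailey_w _ _) => u y w e.
  transitivity (w - - u * w); first by ring.
  by rewrite -e; ring.
rewrite (_ : n.+1%:Z = n%:Z + 1); last by lia.
by rewrite mulrC W; ring.
Qed.

Lemma bailey_w0 : bailey_w 0 1 = 1.
Proof.
rewrite /bailey_w (@tsum_single _ _ _ _ 0) => [|[[|r]|r] // _].
- by rewrite !mulr0 addr0 /sg !expr0z ?addr0 ?add0r ?subr0 !ip0 !mulr1.
- by rewrite sub0r (_ : - r.+1%:Z = Negz r) // ip_Negz !mulr0.
- by rewrite add0r ip_Negz mul0r mulr0.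
Qed.

Lemma bailey_w_bounded : exists K : R, forall n, nrm (bailey_w n 1) <= K.
Proof.
have [M M0 HM] := ip_pair_bounded; have [N HN] := summable_bailey_theta 1.
exists (N * M) => n; apply: tsum_bound => B.
apply: le_trans (ler_wpM2r M0 (HN B)); rewrite mulr_suml ler_sum // => r _.
by rewrite nrmM ler_wpM2l ?nrm_ge0.
Qed.

(** A limiting case of Bailey's lemma: for fixed [r], the shift [n -> n + r] turns the sum over [n]
    into a Durfee sum of offset [2 r], a constant. The left-over [Q^(r^2)] raises the base [eta] of
    the pair to [eta^5]. For [bailey_y] the offset is [2 r + 1]. *)
Lemma sum_bailey_w : summable (fun n : nat => Q ^+ (n * n) * bailey_w n 1) /\
  tsum (fun n : nat => Q ^+ (n * n) * bailey_w n 1) = th (eta ^+ 5) (- eta) / qinf Q Q.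
Proof.
have [M M0 HM] := ip_pair_bounded.
pose F (x : int * int) : C := Q ^ (x.1 * x.1) * (sg x.2 * eta ^ (x.2 * x.2 + 1 * x.2)) *
  (ip Q (x.1 + x.2) * ip Q (x.1 - x.2)).
have FS : summable F.
  apply: (summable_bounded_mul M0) => [x|]; first exact: HM.
  apply: eq_summable (summable_prod (summable_th 1 Q1) (summable_bailey_theta 1)) => x.
  by rewrite exp1rz mulr1.
have row n : tsum (fun r => F (n, r)) = Q ^ (n * n) * bailey_w n 1.
  by rewrite -tsumZ; [apply: eq_tsum => r; rewrite /F /=; ring | exact: summable_w].
have S : summable (fun n : int => Q ^ (n * n) * bailey_w n 1).
  by apply: eq_summable (summable_rows FS) => n; rewrite row.
split; first by apply: (summable_inj (h := Posz)) S => m n [].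
(* For negative [n] the numbers [n + r] and [n - r] cannot both be nonnegative, so the row
   vanishes. *)
rewrite (tsum_int_nat S) => [|n]; last first.
  rewrite -row (@tsum_single _ _ _ _ 0) => [|[r|r] _].
  - by rewrite /F /= !mulr0.
  - by rewrite /F /= (_ : Negz n - Posz r = Negz (n + r)%N) ?ip_Negz ?mulr0 //; lia.
  - by rewrite /F /= mul0r mulr0.
rewrite -(eq_tsum row) (tsum_swap FS) mulrC /th -tsumZ; last first.
  by apply: summable_th; exact: nrm_expr_lt1.
apply: eq_tsum => r; rewrite -(tsum_shift r (summable_inj (h := fun n => (n, r)) _ FS)) //; last by move=> m n [].
rewrite -(durfeeE (2 * r) Q0 Q1) mulrC -tsumZ; last exact: summable_durfee.
apply: eq_tsum => n; rewrite /F /= (_ : n + r - r = n); last by ring.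
rewrite (_ : n + r + r = n + 2 * r); last by ring.
rewrite -[- eta]mulN1r [(-1 * eta) ^ r]expfzMl -/(sg r).
have -> : (eta ^+ 5) ^ (r * r) = eta ^ (5 * (r * r)) by rewrite exprnP exprz_exp.
have e : Q ^ ((n + r) * (n + r)) * eta ^ (r * r + 1 * r) =
    eta ^ (5 * (r * r)) * eta ^ r * Q ^ (n * n + 2 * r * n).
  by rewrite !QE -!expfzDr //; congr (_ ^ _); ring.
transitivity (sg r * (Q ^ ((n + r) * (n + r)) * eta ^ (r * r + 1 * r)) * (ip Q (n + 2 * r) * ip Q n)).
  ring.
rewrite e; ring.
Qed.

Lemma sum_bailey_y : summable (fun n : nat => Q ^+ (n * n + n) * bailey_y n (-1)) /\
  tsum (fun n : nat => Q ^+ (n * n + n) * bailey_y n (-1)) = th (eta ^+ 5) (- eta ^+ 3) / qinf Q Q.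
Proof.
have [M M0 HM] := ip_pair_bounded.
pose F (x : int * int) : C := Q ^ (x.1 * x.1) * Q ^ x.1 * (sg x.2 * eta ^ (x.2 * x.2 + -1 * x.2)) *
  (ip Q (x.1 + 1 + x.2) * ip Q (x.1 - x.2)).
have FS : summable F.
  apply: (summable_bounded_mul M0) => [x|]; first exact: HM.
  exact: (summable_prod (summable_th Q Q1) (summable_bailey_theta (-1))).
have row n : tsum (fun r => F (n, r)) = Q ^ (n * n + n) * bailey_y n (-1).
  rewrite -tsumZ; last exact: summable_y.
  by apply: eq_tsum => r; rewrite /F /= (expfzDr (n * n) n Q0); ring.
have S : summable (fun n : int => Q ^ (n * n + n) * bailey_y n (-1)).
  by apply: eq_summable (summable_rows FS) => n; rewrite row.
split; first by apply: (summable_inj (h := Posz)) S => m n [].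
rewrite (tsum_int_nat S) => [|n]; last first.
  rewrite -row (@tsum_single _ _ _ _ 0) => [|[r|r] _].
  - by rewrite /F /= !mulr0.
  - by rewrite /F /= (_ : Negz n - Posz r = Negz (n + r)%N) ?ip_Negz ?mulr0 //; lia.
  - by rewrite /F /= (_ : Negz n + 1 + Negz r = Negz (n + r)%N) ?ip_Negz ?mul0r ?mulr0 //; lia.
rewrite -(eq_tsum row) (tsum_swap FS) mulrC /th -tsumZ; last first.
  by apply: summable_th; exact: nrm_expr_lt1.
apply: eq_tsum => r; rewrite -(tsum_shift r (summable_inj (h := fun n => (n, r)) _ FS)) //; last by move=> m n [].
rewrite -(durfeeE (2 * r + 1) Q0 Q1) mulrC -tsumZ; last exact: summable_durfee.
apply: eq_tsum => n; rewrite /F /= (_ : n + r - r = n); last by ring.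
rewrite (_ : n + r + 1 + r = n + (2 * r + 1)); last by ring.
rewrite -[- eta ^+ 3]mulN1r [(-1 * eta ^+ 3) ^ r]expfzMl -/(sg r).
have -> : (eta ^+ 5) ^ (r * r) = eta ^ (5 * (r * r)) by rewrite exprnP exprz_exp.
have -> : (eta ^+ 3) ^ r = eta ^ (3 * r) by rewrite exprnP exprz_exp.
have e : Q ^ ((n + r) * (n + r)) * Q ^ (n + r) * eta ^ (r * r + -1 * r) =
    eta ^ (5 * (r * r)) * eta ^ (3 * r) * Q ^ (n * n + (2 * r + 1) * n).
  by rewrite !QE -!expfzDr //; congr (_ ^ _); ring.
transitivity (sg r * (Q ^ ((n + r) * (n + r)) * Q ^ (n + r) * eta ^ (r * r + -1 * r)) *
   (ip Q (n + (2 * r + 1)) * ip Q n)).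
  ring.
rewrite e; ring.
Qed.

End BaileyPair.

Section TripleEquation.
Context {R : realType} {C : cvalField R}.
Variables (q : C) (q0 : q != 0) (q1 : nrm q < 1).

Let t := q ^+ 2.
Let p := t ^+ 2.
Let t0 : t != 0. Proof. exact: expf_neq0. Qed.
Let t1 : nrm t < 1. Proof. exact: nrm_sqr_lt1. Qed.
Let p0 : p != 0. Proof. exact: expf_neq0. Qed.
Let p1 : nrm p < 1. Proof. exact: nrm_sqr_lt1. Qed.

(** [elimination] is applied to [eps^n T_n], for which the coefficient [t] of the recurrence becomes
    [tau = eps t]. The condition on [eta] makes the base [eta^4] of the Bailey pair equal to
    [tau^2 = p]. *)
Lemma triple_sum_eqn (eps eta : C) : eps ^+ 2 = 1 -> eta ^+ 2 = - (eps * t) ->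
  th (eta ^+ 5) (- eta) * triple_sum q 0 + eps * th (eta ^+ 5) (- eta ^+ 3) * triple_sum q 1 =
  th q eps * euler_sum t eps * th t eps / qinf p p.
Proof.
move=> eps2 etaE; pose tau := - eta ^+ 2.
have e0 := eps_neq0 eps2; have ne := nrm_eps eps2.
have tauE : tau = eps * t by rewrite /tau etaE opprK.
have tau2 : tau ^+ 2 = p by rewrite tauE exprMn eps2 mul1r.
have eta0 : eta != 0.
  by apply: contra_eq_neq etaE => ->; rewrite expr0n /= eq_sym oppr_eq0 mulf_neq0.
have eta1 : nrm eta < 1 by apply: sqrt_lt1; rewrite etaE nrmN nrmM ne mul1r.
have QE : eta ^+ 4 = p by rewrite -tau2 /tau sqrrN -exprM.
have tau1 : nrm tau < 1 by rewrite tauE nrmM ne mul1r.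
(* At [m = 2] the factor [1 - p^(m-2)] is 0, which removes the term with index -1. *)
have T2 : triple_sum q 2 = t * triple_sum q 1 + triple_sum q 0.
  by rewrite (triple_sum_recurrence q0 q1) subrr expr0z subrr mulr0 mul0r subr0.
have T3 (k : nat) : triple_sum q k.+3 = t * triple_sum q k.+2 + triple_sum q k.+1
    - t * (1 - p ^+ k.+1) * triple_sum q k.
  rewrite (triple_sum_recurrence q0 q1) (_ : k.+3%:Z - 1 = k.+2); last by lia.
  rewrite (_ : k.+3%:Z - 2 = k.+1); last by lia.
  by rewrite (_ : k.+3%:Z - 3 = k) //; lia.
have L : lim_to (fun n => \sum_(j < n) (tau ^+ (2 * j ^ 2) * bailey_w eta j 1 * (eps ^+ 0 * triple_sum q 0%N) +
    tau ^+ (2 * j ^ 2 + 2 * j) * bailey_y eta j (-1) * (eps ^+ 1 * triple_sum q 1%N)))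
    (th q eps * euler_sum t eps * (th t eps * ((qinf p p)^-1 * (qinf p p)^-1))).
  apply: (@elimination _ _ tau tau1 (fun n => eps ^+ n * triple_sum q n)
    (fun n => bailey_w eta n 1) (fun n => bailey_y eta n (-1))).
  - have [K HK] := triple_sum_bounded q0 q1; exists K => n.
    by rewrite nrmM nrmX ne expr1n mul1r.
  - rewrite T2 tauE eps2 mul1r expr1 mulrACA -expr2 eps2 mul1r expr0 mul1r //.
  - move=> k; rewrite T3 exprM tau2 tauE.
    have -> : eps ^+ k.+3 = eps ^+ k.+1 by rewrite -[RHS]mul1r -eps2 -exprD.
    have -> : eps ^+ k.+2 = eps ^+ k by rewrite -[RHS]mul1r -eps2 -exprD.
    rewrite exprS; ring: eps2.
  - exact: lim_triple_sum.
  - have [K HK] := bailey_w_bounded eta0 eta1; by exists K.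
  - exact: bailey_w0.
  - by move=> n; have [] := bailey_wy eta0 eta1 n.
  - by move=> n; have [] := bailey_wy eta0 eta1 n.
have [wS wE] := sum_bailey_w eta0 eta1; have [yS yE] := sum_bailey_y eta0 eta1.
have S := summableD (summableZ (triple_sum q 0) wS) (summableZ (eps * triple_sum q 1) yS).
have := lim_partial_sums S; rewrite tsumD; [|exact: summableZ|exact: summableZ].
rewrite !tsumZ // wE yE QE => L'.
have := lim_to_uniq L (eq_lim_to _ L') => H.
have pinf0 : qinf p p != 0 by apply/qinf_neq0/one_sub_mul_neq0.
apply: (mulIf (invr_neq0 pinf0)); rewrite -[RHS]mulrA.
transitivity (th q eps * euler_sum t eps * (th t eps * ((qinf p p)^-1 * (qinf p p)^-1))); last by ring.
rewrite H; last first.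
  move=> n; apply: eq_bigr => j _; rewrite expr0 expr1 !mul1r.
  have -> : tau ^+ (2 * j ^ 2) = p ^+ (j * j) by rewrite -tau2 -exprM mulnn.
  have -> : tau ^+ (2 * j ^ 2 + 2 * j) = p ^+ (j * j + j).
    by rewrite -tau2 -exprM mulnDr mulnn.
  ring.
ring.
Qed.

Definition triple_term (m : int) (i j k : nat) : C :=
  q ^ (2 * ((i%:Z - k%:Z) * (i%:Z - k%:Z)) + 2 * (j%:Z * j%:Z) +
    (i%:Z + k%:Z - j%:Z - m) * (i%:Z + k%:Z - j%:Z - m)) /
  (qpoch p p i * qpoch p p j * qpoch p p k).

(** The triple [(i, j, k)] is coded as [((i + k, j), i)]. The vanishing of [ip] confines the support
    over the integers to the image of the natural triples. *)
Lemma has_sum_triple (m : int) :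
  has_sum (fun x : nat * nat * nat => triple_term m x.1.1 x.1.2 x.2) (triple_sum q m).
Proof.
have [M M0 HM] := ip_bounded p0 p1.
pose P (z i : int) := t ^ ((2 * i - z) * (2 * i - z) + 0 * (2 * i - z)) * ip p i * ip p (z - i).
pose G (x : int * int * int) := P x.1.1 x.2 * mid_term q (x.1.1 - m) x.1.2.
have GS : summable G.
  (* In the coordinates [2 i - z], [z - m - j] and [j] the Gaussian weight is a product of three
     weights in one variable. *)
  have inj : injective (fun x : int * int * int =>
      (2 * x.2 - x.1.1, (x.1.1 - m - x.1.2, x.1.2))).
    by move=> [[z j] i] [[z' j'] i'] /= [e1 e2 e3]; congr ((_, _), _); lia.
  have S := summable_inj inj (summable_prod (summable_th 1 t1)
    (summable_prod (summable_th 1 q1) (summable_euler 1 t1))).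
  have [K HK] : exists K : R, 0 <= K /\ forall x : int * int * int,
      nrm (ip p x.2 * ip p (x.1.1 - x.2)) <= K.
    exists (M * M); split=> [|x]; first exact: mulr_ge0.
    by rewrite nrmM ler_pM ?nrm_ge0.
  have := summable_bounded_mul HK.1 HK.2 S; apply: eq_summable => -[[z j] i] /=.
  by rewrite /G /P /mid_term /= !exp1rz !mulr1 mul0r addr0; ring.
have sumG : tsum G = triple_sum q m.
  rewrite (tsum_fubini GS) /=.
  have row : forall y : int * int, tsum (fun i : int => G (y, i)) =
      pair_sum t 0 y.1 * mid_term q (y.1 - m) y.2.
    move=> [z j] /=; rewrite mulrC -tsumZ; last exact: (summable_pair t0 t1).
    by apply: eq_tsum => i; rewrite /G /P /= mulrC.
  have rS := summable_rows GS.
  rewrite (eq_tsum row) tsum_fubini; last by apply: eq_summable rS => y; rewrite row.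
  by apply: eq_tsum => z; rewrite /= tsumZ //; exact: (summable_mid q0 q1).
rewrite -sumG.
pose h (x : nat * nat * nat) : int * int * int := ((x.1.1%:Z + x.2%:Z, x.1.2%:Z), x.1.1%:Z).
pose h' (y : int * int * int) : nat * nat * nat := ((`|y.2|, `|y.1.2|), `|y.1.1 - y.2|)%N.
have hK : cancel h h' by move=> [[i j] k]; rewrite /h /h' /=; congr ((_, _), _); lia.
have h'K y : G y != 0 -> h (h' y) = y.
  case: y => [[z j] i]; rewrite /G /P /mid_term /h /h' /= => /eqP ne.
  have i0 : 0 <= i by case: i ne => // i; rewrite ip_Negz mulr0 !mul0r.
  have j0 : 0 <= j by case: j ne => // j; rewrite ip_Negz !mulr0.
  have k0 : 0 <= z - i.
    by move: ne; move: (z - i) => [|] // k; rewrite ip_Negz mulr0 !mul0r.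
  by congr ((_, _), _); lia.
apply: has_sum_eq (has_sum_reindex hK h'K (tsumP GS)) => -[[i j] k].
rewrite /G /P /mid_term /triple_term /h /= mul0r addr0.
rewrite (_ : i%:Z + k%:Z - i%:Z = k); last by ring.
have tE n : t ^ n = q ^ (2 * n) by rewrite /t exprnP exprz_exp.
have e : t ^ ((2 * i%:Z - (i%:Z + k%:Z)) * (2 * i%:Z - (i%:Z + k%:Z))) *
    q ^ ((i%:Z + k%:Z - m - j%:Z) * (i%:Z + k%:Z - m - j%:Z)) * t ^ (j%:Z * j%:Z) =
  q ^ (2 * ((i%:Z - k%:Z) * (i%:Z - k%:Z)) + 2 * (j%:Z * j%:Z) +
    (i%:Z + k%:Z - j%:Z - m) * (i%:Z + k%:Z - j%:Z - m)).
  by rewrite !tE -!expfzDr //; congr (_ ^ _); ring.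
rewrite -e !invfM /ip; ring.
Qed.

End TripleEquation.

(** * Identities between theta functions *)

Section ThetaIdentities.
Context {R : realType} {C : cvalField R}.
Implicit Types (x y z q d : C).

Lemma sqrN1 : (-1 : C) ^+ 2 = 1.
Proof. by rewrite sqrrN expr1n. Qed.

Lemma expz_sq d (n : int) : d ^+ 2 = 1 -> d ^ (n * n) = d ^ n.
Proof.
move=> d2; have d0 := eps_neq0 d2.
have [c [k [nE c01]]] : exists c k : int, n = 2 * k + c /\ (c = 0 \/ c = 1).
  by exists (n %% 2)%Z, (n %/ 2)%Z; lia.
have -> : n * n = 2 * (2 * k * k + 2 * k * c) + c * c by rewrite nE; ring.
rewrite nE !expfzDr // !eps_even // mul1r mul1r.
by case: c01 => ->; rewrite ?mulr0 ?mulr1.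
Qed.

(** [n^2 + n] is even, so a common sign on [x] and [y] has no effect. *)
Lemma th_twist x y d : d ^+ 2 = 1 -> th (d * x) (d * y) = th x y.
Proof.
move=> d2; apply: eq_tsum => n; rewrite !expfzMl (expz_sq n d2).
have dd : d ^ n * d ^ n = 1 by rewrite -expfzDr ?eps_neq0 // (_ : n + n = 2 * n) ?eps_even //; ring.
rewrite -[RHS]mul1r -dd; ring.
Qed.

Lemma th_flip x y : x != 0 -> y != 0 -> nrm x < 1 -> th x (x ^+ 2 / y) = x^-1 * y * th x y.
Proof.
move=> x0 y0 x1; rewrite -(th_sym y x1) [in RHS]/th -(tsum_shift 1 (summable_th y^-1 x1)).
rewrite -tsumZ; last exact: (summable_shift 1 (summable_th y^-1 x1)).
apply: eq_tsum => n; have y'0 : y^-1 != 0 by rewrite invr_eq0.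
rewrite (expfzDr n 1 y'0) expr1z expfzMl exprnP exprz_exp.
have -> : x ^ ((n + 1) * (n + 1)) = x ^ (n * n) * x ^ (2 * n) * x.
  by rewrite -[X in _ = _ * X]expr1z -!expfzDr //; congr (_ ^ _); ring.
by field; rewrite x0 y0.
Qed.

Lemma th_flip_opp x (a b c : nat) : x != 0 -> nrm x < 1 -> (b + c = 2 * a.+1)%N ->
  th (x ^+ a.+1) (- x ^+ c) = - ((x ^+ a.+1)^-1 * x ^+ b) * th (x ^+ a.+1) (- x ^+ b).
Proof.
move=> x0 x1 bc; have b0 : - x ^+ b != 0 by rewrite oppr_eq0 expf_neq0.
rewrite -mulrN -th_flip ?expf_neq0 ?nrm_expr_lt1 //; congr (th _ _).
by rewrite -exprM mulnC -bc exprD; field; rewrite expf_neq0.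
Qed.

Lemma th_period_opp x (a c : nat) : x != 0 -> nrm x < 1 ->
  th (x ^+ a.+1) (- x ^+ (c + 2 * a.+1)) = - (x ^+ a.+1 * x ^+ c)^-1 * th (x ^+ a.+1) (- x ^+ c).
Proof.
move=> x0 x1; have c0 : (- x ^+ c)^-1 != 0 by rewrite invr_eq0 oppr_eq0 expf_neq0.
rewrite -(th_sym (- x ^+ c)) ?nrm_expr_lt1 // invfM -mulrN -invrN -th_flip ?expf_neq0 ?nrm_expr_lt1 //.
by congr (th _ _); rewrite invrK -exprM mulrN exprD [(2 * _)%N]mulnC mulrC.
Qed.

(** [th_flip] fixes [y = - x] and multiplies the series by -1. *)
Lemma th_opp_eq0 x : x != 0 -> nrm x < 1 -> th x (- x) = 0.
Proof.
move=> x0 x1; have nx0 : - x != 0 by rewrite oppr_eq0.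
have := th_flip x0 nx0 x1; rewrite (_ : x ^+ 2 / - x = - x); last by field.
rewrite mulrN mulVf // mulN1r => /eqP.
by rewrite -addr_eq0 -mulr2n mulrn_eq0 => /eqP.
Qed.

Lemma th_opp_powE x (a b : nat) : x != 0 ->
  th (x ^+ a) (- x ^+ b) = tsum (fun n : int => (-1) ^ n * x ^ (a%:Z * (n * n) + b%:Z * n)).
Proof.
move=> x0; apply: eq_tsum => n; rewrite -[- x ^+ b]mulN1r [(-1 * _) ^ n]expfzMl [in X in _ = X]expfzDr // !exprnP !exprz_exp.
by rewrite mulrCA.
Qed.

Lemma summable_th_opp_pow x (a b : nat) : x != 0 -> nrm x < 1 -> (0 < a)%N ->
  summable (fun n : int => (-1) ^ n * x ^ (a%:Z * (n * n) + b%:Z * n)).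
Proof.
case: a => // a x0 x1 _; apply: eq_summable (summable_th (- x ^+ b) (nrm_expr_lt1 a x1)) => n.
by rewrite -[- x ^+ b]mulN1r [(-1 * _) ^ n]expfzMl [in X in _ = X]expfzDr // !exprnP !exprz_exp mulrCA.
Qed.

(* Of the five cosets of the sublattice, [c = 2] contributes 0, and [c = 3, 4]
   repeat [c = 1, 0]. *)
Lemma th_lattice_6 x : x != 0 -> nrm x < 1 ->
  2 * (th (x ^+ 15) (- x ^+ 3) * th (x ^+ 10) (- x ^+ 2) +
    x ^+ 2 * (th (x ^+ 15) (- x ^+ 9) * th (x ^+ 10) (- x ^+ 6))) =
  th (- x ^+ 6) 1 * th x x.
Proof.
move=> x0 x1.
have x15 : x ^+ 15 != 0 by rewrite expf_neq0.
have x10 : x ^+ 10 != 0 by rewrite expf_neq0.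
have n15 : nrm (x ^+ 15) < 1 by exact: nrm_expr_lt1.
have n10 : nrm (x ^+ 10) < 1 by exact: nrm_expr_lt1.
have S1 : summable (fun w : int => (- x ^+ 6) ^ (w * w) * 1 ^ w).
  by apply: summable_th; rewrite nrmN; exact: nrm_expr_lt1.
have S2 := summable_th x x1.
(* The cross term cancels: [6 (n - k)^2 + (3 n + 2 k)^2 = 15 n^2 + 10 k^2]. *)
rewrite [in RHS]/th -(tsum_prod S1 S2) (@tsum_lattice _ _ _ 5 1 3 isT (summable_prod S1 S2)) /=.
have piece (c : nat) : tsum (fun z : int * int =>
    (- x ^+ 6) ^ ((z.1 - 1 * z.2) * (z.1 - 1 * z.2)) * 1 ^ (z.1 - 1 * z.2) *
    (x ^ ((3 * (z.1 - 1 * z.2) + 5%:Z * z.2 + c%:Z) * (3 * (z.1 - 1 * z.2) + 5%:Z * z.2 + c%:Z)) *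
     x ^ (3 * (z.1 - 1 * z.2) + 5%:Z * z.2 + c%:Z))) =
    x ^+ (c * c + c) * (th (x ^+ 15) (- x ^+ (6 * c + 3)) * th (x ^+ 10) (- x ^+ (4 * c + 2))).
  have T1 := summable_th_opp_pow (6 * c + 3) x0 x1 (isT : (0 < 15)%N).
  have T2 := summable_th_opp_pow (4 * c + 2) x0 x1 (isT : (0 < 10)%N).
  rewrite !th_opp_powE // -(tsum_prod T1 T2) -tsumZ; last exact: (summable_prod T1 T2).
  apply: eq_tsum => -[n k] /=; rewrite exp1rz mulr1 mul1r.
  rewrite -[- x ^+ 6]mulN1r [(-1 * _) ^ _]expfzMl (expz_sq (n - k) sqrN1) (expfzDr n (- k)) ?oppr_eq0 ?oner_eq0 //.
  have -> : (-1) ^ (- k) = (-1) ^ k :> C by rewrite -exprz_inv invrN1.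
  have e : (x ^+ 6) ^ ((n - k) * (n - k)) *
    (x ^ ((3 * (n - k) + 5%:Z * k + c%:Z) * (3 * (n - k) + 5%:Z * k + c%:Z)) *
     x ^ (3 * (n - k) + 5%:Z * k + c%:Z)) = x ^+ (c * c + c) *
   (x ^ (15%:Z * (n * n) + (6 * c + 3)%:Z * n) * x ^ (10%:Z * (k * k) + (4 * c + 2)%:Z * k)).
    rewrite !exprnP exprz_exp -!expfzDr //; congr (_ ^ _).
    rewrite !PoszD !PoszM; ring.
  rewrite -[LHS]mulrA e; ring.
have flip15 b c (bc : (b + c = 30)%N) := @th_flip_opp x 14 b c x0 x1 bc.
have flip10 b c (bc : (b + c = 20)%N) := @th_flip_opp x 9 b c x0 x1 bc.
rewrite !big_ord_recr big_ord0 /= !piece.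
rewrite (_ : 6 * 2 + 3 = 15)%N // th_opp_eq0 //.
rewrite (flip15 9 (6 * 3 + 3)%N) // (flip15 3 (6 * 4 + 3)%N) //.
rewrite (flip10 6 (4 * 3 + 2)%N) // (flip10 2 (4 * 4 + 2)%N) //.
by field; rewrite x0.
Qed.

(** The lattice comes from multiplication by [1 + 2i] on the Gaussian integers: [(n - 2 k)^2 + (2 n
    + k)^2 = 5 n^2 + 5 k^2]. The coset [c = 1] contributes 0, [c = 0, 2] give the first product and
    [c = 3, 4] the second. At [y = q] the left side is the determinant of the system for the triple
    sums. *)
Lemma th_lattice_5 (io y z : C) : io ^+ 2 = -1 -> z = io * y -> y != 0 -> nrm y < 1 ->
  2 * (th (y ^+ 5) (- y) * th (z ^+ 5) (- z ^+ 3) + th (z ^+ 5) (- z) * th (y ^+ 5) (- y ^+ 3)) =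
  th y y * th z z.
Proof.
move=> io2 zE y0 y1.
have io0 : io != 0 by apply: contra_eq_neq io2 => ->; rewrite expr0n eq_sym oppr_eq0 oner_neq0.
have nio : nrm io = 1.
  have /eqP : nrm io ^+ 2 = 1 by rewrite -nrmX io2 nrmN nrm1.
  by rewrite sqrf_eq1 => /orP[/eqP //|/eqP e]; have := nrm_ge0 io; rewrite e; lra.
have z0 : z != 0 by rewrite zE mulf_neq0.
have z1 : nrm z < 1 by rewrite zE nrmM nio mul1r.
have S1 := summable_th y^-1 y1; have S2 := summable_th z z1.
rewrite -(th_sym y y1) [in RHS]/th -(tsum_prod S1 S2).
rewrite (@tsum_lattice _ _ _ 5 2 2 isT (summable_prod S1 S2)) /=.
have piece (c : nat) : tsum (fun x : int * int =>
    y ^ ((x.1 - 2 * x.2) * (x.1 - 2 * x.2)) * y^-1 ^ (x.1 - 2 * x.2) *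
    (z ^ ((2 * (x.1 - 2 * x.2) + 5%:Z * x.2 + c%:Z) * (2 * (x.1 - 2 * x.2) + 5%:Z * x.2 + c%:Z)) *
     z ^ (2 * (x.1 - 2 * x.2) + 5%:Z * x.2 + c%:Z))) =
    z ^+ (c * c + c) * (th (y ^+ 5) (- y ^+ (4 * c + 1)) * th (z ^+ 5) (- z ^+ (2 * c + 3))).
  have T1 := summable_th_opp_pow (4 * c + 1) y0 y1 (isT : (0 < 5)%N).
  have T2 := summable_th_opp_pow (2 * c + 3) z0 z1 (isT : (0 < 5)%N).
  rewrite !th_opp_powE // -(tsum_prod T1 T2) -tsumZ; last exact: (summable_prod T1 T2).
  apply: eq_tsum => -[n k] /=; set u := n - 2 * k; set j := 2 * u + 5%:Z * k + c%:Z.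
  have zX m : z ^ m = io ^ m * y ^ m by rewrite zE expfzMl.
  have sg m : (-1) ^ m = io ^ (2 * m) by rewrite -exprz_exp -exprnP io2.
  have io4 m : io ^ (4 * m) = 1.
    by rewrite -exprz_exp -exprnP (exprM io 2 2) io2 sqrN1 exp1rz.
  rewrite exprz_inv [z ^+ _]exprnP !zX !sg.
  have ey : y ^ (u * u) * y ^ (- u) * (y ^ (j * j) * y ^ j) = y ^ (c * c + c)%N *
     (y ^ (5%:Z * (n * n) + (4 * c + 1)%:Z * n) * y ^ (5%:Z * (k * k) + (2 * c + 3)%:Z * k)).
    rewrite -!expfzDr //; congr (_ ^ _); rewrite /j /u !PoszD !PoszM; ring.
  have ei : io ^ (j * j) * io ^ j = io ^ (c * c + c)%N * (io ^ (2 * n) *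
     (io ^ (2 * k) * io ^ (5%:Z * (k * k) + (2 * c + 3)%:Z * k))).
    (* The exponents of [io] on the two sides agree only modulo 4; the inserted power makes up the
       difference. *)
    rewrite -[RHS]mul1r -(io4 (n * n + n * k + c%:Z * n - k * k - k)) -!expfzDr //.
    congr (_ ^ _); rewrite /j /u !PoszD !PoszM; ring.
  transitivity ((io ^ (j * j) * io ^ j) * (y ^ (u * u) * y ^ (- u) * (y ^ (j * j) * y ^ j))).
    ring.
  rewrite ei ey; ring.
rewrite !big_ord_recr big_ord0 /= !piece.
rewrite (th_opp_eq0 (x := y ^+ 5)) ?expf_neq0 ?nrm_expr_lt1 //.
have E9 := @th_flip_opp y 4 1 9 y0 y1 erefl; have E13 := @th_period_opp y 4 3 y0 y1.
have E7 := @th_flip_opp y 4 3 7 y0 y1 erefl; have E17 := @th_period_opp y 4 7 y0 y1.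
have F7 := @th_flip_opp z 4 3 7 z0 z1 erefl; have F9 := @th_flip_opp z 4 1 9 z0 z1 erefl.
have F11 := @th_period_opp z 4 1 z0 z1.
rewrite ![(_ * _ + _)%N]/= E9 E13 E17 E7 F7 F9 F11 !expr1.
have z2 : z ^+ 2 = - y ^+ 2 by rewrite zE exprMn io2 mulN1r.
have -> : z ^+ (1 * 1 + 1) = - y ^+ 2 by [].
have -> : z ^+ (2 * 2 + 2) = - y ^+ 6 by rewrite (exprM z 2 3) z2; ring.
have -> : z ^+ (3 * 3 + 3) = y ^+ 12 by rewrite (exprM z 2 6) z2; ring.
have -> : z ^+ (4 * 4 + 4) = y ^+ 20 by rewrite (exprM z 2 10) z2; ring.
have -> : (z ^+ 5)^-1 * z ^+ 3 = - (y ^+ 2)^-1 by rewrite -invrN -z2; field.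
have -> : (z ^+ 5)^-1 * z = (y ^+ 4)^-1.
  by rewrite (_ : y ^+ 4 = z ^+ 4); [field | rewrite (exprM z 2 2) z2; ring].
have -> : (z ^+ 5 * z)^-1 = - (y ^+ 6)^-1.
  rewrite -exprSr (exprM z 2 3) z2 -invrN; congr _^-1; ring.
move: (th (y ^+ 5) _) (th (y ^+ 5) _) (th (z ^+ 5) _) (th (z ^+ 5) _) (th (z ^+ 5) _).
by move=> a b c d e; field.
Qed.

(** Here [2 (n + k)^2 + (2 k - n)^2 = 3 n^2 + 6 k^2] on a lattice of index 3, and the cosets [c = 1]
    and [c = 2] contribute equally. *)
Lemma th_dissect_3 q eps : eps ^+ 2 = 1 -> q != 0 -> nrm q < 1 ->
  th q eps * th (q ^+ 2) eps =
  th (q ^+ 3) 1 * th (q ^+ 6) eps +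
  2 * eps * q * th (q ^+ 3) (q ^+ 2) * th (q ^+ 6) (eps * q ^+ 4).
Proof.
move=> e2 q0 q1; have e0 := eps_neq0 e2; have q21 : nrm (q ^+ 2) < 1 by exact: nrm_expr_lt1.
have q31 : nrm (q ^+ 3) < 1 by exact: nrm_expr_lt1.
have q61 : nrm (q ^+ 6) < 1 by exact: nrm_expr_lt1.
have S1 := summable_th eps q21; have S2 := summable_th eps q1.
rewrite mulrC [in LHS]/th -(tsum_prod S1 S2).
rewrite (@tsum_lattice _ _ _ 3 (-1) (-1) isT (summable_prod S1 S2)) /=.
have piece (c : nat) : tsum (fun x : int * int =>
    (q ^+ 2) ^ ((x.1 - -1 * x.2) * (x.1 - -1 * x.2)) * eps ^ (x.1 - -1 * x.2) *
    (q ^ ((-1 * (x.1 - -1 * x.2) + 3%:Z * x.2 + c%:Z) * (-1 * (x.1 - -1 * x.2) + 3%:Z * x.2 + c%:Z)) *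
     eps ^ (-1 * (x.1 - -1 * x.2) + 3%:Z * x.2 + c%:Z))) =
    eps ^+ c * q ^+ (c * c) * (th (q ^+ 3) (q ^+ (2 * c)) * th (q ^+ 6) (eps * q ^+ (4 * c))).
  rewrite -(th_sym (q ^+ (2 * c)) q31).
  have T1 := summable_th (q ^+ (2 * c))^-1 q31; have T2 := summable_th (eps * q ^+ (4 * c)) q61.
  rewrite [in RHS]/th -(tsum_prod T1 T2) -tsumZ; last exact: (summable_prod T1 T2).
  apply: eq_tsum => -[n k] /=; set u := n - -1 * k; set j := -1 * u + 3%:Z * k + c%:Z.
  have ee : eps ^ u * eps ^ j = eps ^+ c * eps ^ k.
    rewrite -[RHS]mulr1 -(eps_even e2 k) exprnP -!expfzDr //; congr (_ ^ _).
    rewrite /j /u; ring.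
  have eq' : (q ^+ 2) ^ (u * u) * q ^ (j * j) = q ^+ (c * c) *
     ((q ^+ 3) ^ (n * n) * (q ^+ (2 * c))^-1 ^ n * ((q ^+ 6) ^ (k * k) * (q ^+ (4 * c)) ^ k)).
    rewrite exprz_inv !exprnP !exprz_exp -!expfzDr //; congr (_ ^ _).
    rewrite /j /u !PoszM; ring.
  rewrite [(eps * _) ^ k]expfzMl.
  transitivity ((eps ^ u * eps ^ j) * ((q ^+ 2) ^ (u * u) * q ^ (j * j))); first by ring.
  rewrite ee eq'; ring.
rewrite !big_ord_recr big_ord0 /= !piece.
have E4 : th (q ^+ 3) (q ^+ (2 * 2)) = q^-1 * th (q ^+ 3) (q ^+ 2).
  transitivity ((q ^+ 3)^-1 * q ^+ 2 * th (q ^+ 3) (q ^+ 2)); last by field.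
  rewrite -th_flip ?expf_neq0 //; congr (th _ _); by field.
have E8 : th (q ^+ 6) (eps * q ^+ (4 * 2)) = eps * (q ^+ 2)^-1 * th (q ^+ 6) (eps * q ^+ 4).
  transitivity ((q ^+ 6)^-1 * (eps * q ^+ 4) * th (q ^+ 6) (eps * q ^+ 4)); last by field.
  rewrite -th_flip ?mulf_neq0 ?expf_neq0 //; congr (th _ _).
  have ei : eps^-1 = eps by apply: (mulfI e0); rewrite mulfV // -expr2 e2.
  by rewrite invfM ei; field.
rewrite E4 E8 mulr1 expr1 e2 ?expr0 ?mul1r ?mulr1 ?add0r.
by field.
Qed.

Lemma th_split3 x y : x != 0 -> y != 0 -> nrm x < 1 ->
  th x y = th (x ^+ 9) (y ^+ 3) + x * y * th (x ^+ 9) (y ^+ 3 * x ^+ 6) +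
    x ^+ 4 * y ^+ 2 * th (x ^+ 9) (y ^+ 3 * x ^+ 12).
Proof.
move=> x0 y0 x1; have x9 : nrm (x ^+ 9) < 1 by exact: nrm_expr_lt1.
rewrite [LHS](@tsum_residues _ _ _ 3 isT (summable_th y x1)) !big_ord_recr big_ord0 /= add0r.
have piece (c : nat) : tsum (fun k : int => x ^ ((3%:Z * k + c%:Z) * (3%:Z * k + c%:Z)) * y ^ (3%:Z * k + c%:Z)) =
    x ^+ (c * c) * y ^+ c * th (x ^+ 9) (y ^+ 3 * x ^+ (6 * c)).
  rewrite -tsumZ; last exact: summable_th.
  apply: eq_tsum => k; rewrite [(y ^+ 3 * _) ^ _]expfzMl.
  have ex : x ^ ((3%:Z * k + c%:Z) * (3%:Z * k + c%:Z)) =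
      x ^+ (c * c) * ((x ^+ 9) ^ (k * k) * (x ^+ (6 * c)) ^ k).
    rewrite !exprnP !exprz_exp -!expfzDr //; congr (_ ^ _); rewrite !PoszM; ring.
  have ey : y ^ (3%:Z * k + c%:Z) = y ^+ c * (y ^+ 3) ^ k.
    rewrite !exprnP !exprz_exp -!expfzDr //; congr (_ ^ _); ring.
  rewrite ex ey; ring.
by rewrite !piece !expr0 !mul1r !mulr1 expr1.
Qed.

End ThetaIdentities.

(** * Dissection at a cube root of [eta] *)

Section Level15.
Context {R : realType} {C : cvalField R}.
Implicit Types (x y z q d eta : C).

(** The second condition concerns [w^2] because replacing [x] by [w x] multiplies [x^2] by [w^2]. *)
Lemma omega_exists : exists2 w : C, w ^+ 3 = 1 & w ^+ 2 != 1.
Proof.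
pose s := sqrtC (-3 : C); have s2 : s ^+ 2 = -3 by rewrite sqrtCK.
pose w := (s - 1) / 2; exists w.
  have -> : w ^+ 3 = (s ^+ 2 * s - 3 * s ^+ 2 + 3 * s - 1) / 8 by rewrite /w; field.
  by rewrite s2; field.
have w2 : w ^+ 2 = - w - 1.
  have -> : w ^+ 2 = (s ^+ 2 - 2 * s + 1) / 4 by rewrite /w; field.
  by rewrite s2 /w; field.
apply/negP => /eqP h; have wE : w = - w ^+ 2 - 1 by rewrite w2; ring.
rewrite h in wE; move: h; rewrite wE => /eqP; rewrite -subr_eq0 (_ : _ - 1 = 3%:R) ?pnatr_eq0 //; ring.
Qed.

(* At [eta = q], the modulus 60 products of the theorem enter through these:
   [J_(a,60) = th (q ^ 30) (- q ^ `|30 - a|)]. *)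
Definition theta_A0 eta : C := th (eta ^+ 30) (- eta ^+ 2) - eta ^+ 4 * th (eta ^+ 30) (- eta ^+ 22).
Definition theta_A1 eta : C := th (eta ^+ 30) (- eta ^+ 18).
Definition theta_B0 eta : C := th (eta ^+ 30) (- eta ^+ 14) + eta ^+ 4 * th (eta ^+ 30) (- eta ^+ 26).
Definition theta_B1 eta : C := th (eta ^+ 30) (- eta ^+ 6).

Section CubeRoot.
Variables (x : C) (x0 : x != 0) (x1 : nrm x < 1).
Let eta := x ^+ 3.
Let e0 : eta != 0. Proof. exact: expf_neq0. Qed.
Let e1 : nrm eta < 1. Proof. exact: nrm_expr_lt1. Qed.

Let etaX n : x ^+ (3 * n) = eta ^+ n. Proof. by rewrite exprM. Qed.

(** In [th_lattice_6] only the functions of base [x^10] and [th x x] depend on more than [x^3].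
    Splitting these by residues modulo 3 sorts the identity by powers of [x] modulo 3; the residue 1
    does not occur. *)
Lemma th_split_A : th (x ^+ 10) (- x ^+ 2) = theta_A0 eta - x ^+ 8 * theta_A1 eta.
Proof.
rewrite th_split3 ?oppr_eq0 ?expf_neq0 ?nrm_expr_lt1 //.
rewrite -(exprM x 10 9) -(exprM x 10 6) -(exprM x 10 12).
have -> : (- x ^+ 2) ^+ 3 = - x ^+ 6 by ring.
have -> : - x ^+ 6 * x ^+ (10 * 6) = - x ^+ 66 by rewrite mulNr -exprD.
have -> : - x ^+ 6 * x ^+ (10 * 12) = - x ^+ 126 by rewrite mulNr -exprD.
rewrite (etaX 30) (etaX 2) (etaX 22) (etaX 42) (@th_flip_opp _ _ _ 29 18 42) // /theta_A0 /theta_A1.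
have -> : eta ^+ 4 = x ^+ 12 by rewrite -etaX.
move: (th _ _) (th _ _) (th _ _) => a b c; rewrite /eta; by field.
Qed.

Lemma th_split_B : th (x ^+ 10) (- x ^+ 6) = theta_B1 eta - x ^+ 4 * theta_B0 eta.
Proof.
rewrite th_split3 ?oppr_eq0 ?expf_neq0 ?nrm_expr_lt1 //.
rewrite -(exprM x 10 9) -(exprM x 10 6) -(exprM x 10 12).
have -> : (- x ^+ 6) ^+ 3 = - x ^+ 18 by ring.
have -> : - x ^+ 18 * x ^+ (10 * 6) = - x ^+ 78 by rewrite mulNr -exprD.
have -> : - x ^+ 18 * x ^+ (10 * 12) = - x ^+ 138 by rewrite mulNr -exprD.
rewrite (etaX 30) (etaX 6) (etaX 26) (etaX 46) (@th_flip_opp _ _ _ 29 14 46) // /theta_B0 /theta_B1.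
have -> : eta ^+ 4 = x ^+ 12 by rewrite -etaX.
move: (th _ _) (th _ _) (th _ _) => a b c; rewrite /eta; by field.
Qed.

Lemma th_split_xx : th x x = 2 * th (eta ^+ 3) eta + x ^+ 2 * th (eta ^+ 3) (eta ^+ 3).
Proof.
rewrite th_split3 // -(exprD x 3 6) -(exprD x 3 12) (etaX 3) (etaX 5) -/eta.
have -> : th (eta ^+ 3) (eta ^+ 5) = (eta ^+ 3)^-1 * eta * th (eta ^+ 3) eta.
  by rewrite -th_flip ?expf_neq0 ?nrm_expr_lt1 //; congr (th _ _); field.
move: (th _ _) (th _ _) => a b; rewrite /eta; by field.
Qed.

Lemma level15_eqn :
  2 * (th (eta ^+ 5) (- eta) * theta_A0 eta - eta ^+ 2 * (th (eta ^+ 5) (- eta ^+ 3) * theta_B0 eta)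
    - th (- eta ^+ 2) 1 * th (eta ^+ 3) eta) +
  x ^+ 2 * (2 * (th (eta ^+ 5) (- eta ^+ 3) * theta_B1 eta - eta ^+ 2 * (th (eta ^+ 5) (- eta) * theta_A1 eta))
    - th (- eta ^+ 2) 1 * th (eta ^+ 3) (eta ^+ 3)) = 0.
Proof.
have := th_lattice_6 x0 x1; rewrite th_split_A th_split_B th_split_xx.
rewrite (etaX 5) (etaX 3) (etaX 2) -/eta.
move: (th _ _) (theta_A0 _) (theta_A1 _) (theta_B0 _) (theta_B1 _) (th _ _) (th _ _) (th _ _) (th _ _).
move=> a b c d e f g h i /eqP; rewrite -subr_eq0 => /eqP H.
rewrite -[RHS]H /eta; ring.
Qed.

End CubeRoot.

(* [level15_eqn] has the form [P + x ^ 2 S = 0] with [P] and [S] depending on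
   [x ^ 3] only; replacing [x] by [w x] with [w ^ 3 = 1] gives [P = S = 0]. *)
Lemma level15 eta : eta != 0 -> nrm eta < 1 ->
  th (eta ^+ 5) (- eta) * theta_A0 eta - eta ^+ 2 * (th (eta ^+ 5) (- eta ^+ 3) * theta_B0 eta) =
    th (- eta ^+ 2) 1 * th (eta ^+ 3) eta /\
  2 * (th (eta ^+ 5) (- eta ^+ 3) * theta_B1 eta - eta ^+ 2 * (th (eta ^+ 5) (- eta) * theta_A1 eta)) =
    th (- eta ^+ 2) 1 * th (eta ^+ 3) (eta ^+ 3).
Proof.
move=> eta0 eta1; pose x := 3.-root eta; have xE : x ^+ 3 = eta by rewrite rootCK.
have x0 : x != 0 by apply: contra_neq eta0 => x0; rewrite -xE x0 expr0n.
have x1 : nrm x < 1.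
  by move: eta1; rewrite -xE nrmX; apply: contraTT; rewrite -!leNgt => h; rewrite exprn_ege1.
have [w w3 w2] := omega_exists; have w0 : w != 0.
  by apply: contra_eq_neq w3 => ->; rewrite expr0n eq_sym oner_neq0.
have nw : nrm w = 1.
  have /eqP : nrm w ^+ 3 = 1 by rewrite -nrmX w3 nrm1.
  by rewrite pexpr_eq1 ?nrm_ge0 // => /eqP.
have wx0 : w * x != 0 by rewrite mulf_neq0.
have wx1 : nrm (w * x) < 1 by rewrite nrmM nw mul1r.
have := level15_eqn x0 x1; have := level15_eqn wx0 wx1.
rewrite [(w * x) ^+ 3]exprMn w3 mul1r xE exprMn.
set P := 2 * _; set S := _ - _ * th _ (eta ^+ 3).
move=> e1 e2; have S0 : S = 0.
  have /eqP : (w ^+ 2 - 1) * x ^+ 2 * S = 0.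
    by rewrite -[RHS](subrr 0) -{1}e1 -e2; ring.
  by rewrite !mulf_eq0 subr_eq0 (negPf w2) (negPf x0) /= => /eqP.
have P0 : P = 0 by move: e2; rewrite S0 mulr0 addr0.
split; apply/eqP; rewrite -subr_eq0; last by apply/eqP.
by move/eqP: P0; rewrite /P mulf_eq0 pnatr_eq0.
Qed.

End Level15.

(** * Infinite products for the theta functions *)

Section Products.
Context {R : realType} {C : cvalField R}.
Implicit Types (a x q Q : C).

Section Base.
Variables (Q : C) (Q0 : Q != 0) (Q1 : nrm Q < 1).

Lemma qinf_sqr a : qinf (a ^+ 2) (Q ^+ 2) = qinf a Q * qinf (- a) Q.
Proof.
have Q20 : Q ^+ 2 != 0 by rewrite expf_neq0.
apply: qinfE; apply: eq_lim_to (lim_toM (lim_qpoch a Q0 Q1) (lim_qpoch (- a) Q0 Q1)) => n.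
elim: n => [|n IH]; first by rewrite !qpoch0 mulr1.
by rewrite !qpochS -IH -exprM mulnC exprM; ring.
Qed.

Lemma qinf_dissect a (m : nat) : (0 < m)%N ->
  qinf a Q = \prod_(j < m) qinf (a * Q ^+ j) (Q ^+ m).
Proof.
move=> m0; have Qm0 : Q ^+ m != 0 by rewrite expf_neq0.
have Qm1 : nrm (Q ^+ m) < 1 by case: m m0 {Qm0} => // m _; exact: nrm_expr_lt1.
have fin n : qpoch a Q (n * m) = \prod_(j < m) qpoch (a * Q ^+ j) (Q ^+ m) n.
  elim: n => [|n IH]; first by rewrite mul0n qpoch0 big1 // => j _; rewrite qpoch0.
  have -> : qpoch a Q (n.+1 * m) = qpoch a Q (n * m) * \prod_(j < m) (1 - a * Q ^+ (n * m + j)).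
    rewrite /qpoch !big_mkord mulSn addnC big_split_ord /=; congr (_ * _).
  rewrite IH -big_split /=; apply: eq_bigr => j _; rewrite qpochS; congr (_ * (1 - _)).
  by rewrite -exprM exprD mulnC; ring.
have L1 : lim_to (fun n => qpoch a Q (n * m)) (qinf a Q).
  move=> e /(lim_qpoch a Q0 Q1)[N HN]; exists N => n Nn; apply: HN.
  by rewrite (leq_trans Nn) // leq_pmulr.
apply: lim_to_uniq L1 _; apply: (@eq_lim_to _ _ (fun n => \prod_(j < m) qpoch (a * Q ^+ j) (Q ^+ m) n)).
  by move=> n; rewrite fin.
elim: (index_enum _) => [|j s IH].
  by rewrite big_nil; apply: eq_lim_to (lim_to_cst 1) => n; rewrite big_nil.
rewrite big_cons; apply: eq_lim_to (lim_toM (lim_qpoch _ Qm0 Qm1) IH) => n.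
by rewrite big_cons.
Qed.

End Base.
End Products.

Section ProductIdentities.
Context {R : realType} {C : cvalField R}.
Implicit Types (a x y q Q : C).

Lemma qinf_split2 Q a : Q != 0 -> nrm Q < 1 ->
  qinf a Q = qinf a (Q ^+ 2) * qinf (a * Q) (Q ^+ 2).
Proof.
move=> Q0 Q1; rewrite (qinf_dissect Q0 Q1 a (isT : 0 < 2)%N) !big_ord_recr big_ord0 /=.
by rewrite mul1r mulr1 expr1.
Qed.

Lemma qinf_split3 Q a : Q != 0 -> nrm Q < 1 ->
  qinf a Q = qinf a (Q ^+ 3) * qinf (a * Q) (Q ^+ 3) * qinf (a * Q ^+ 2) (Q ^+ 3).
Proof.
move=> Q0 Q1; rewrite (qinf_dissect Q0 Q1 a (isT : 0 < 3)%N) !big_ord_recr big_ord0 /=.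
by rewrite mul1r mulr1 expr1.
Qed.

Lemma qinf_shift Q a : Q != 0 -> nrm Q < 1 -> qinf a Q = (1 - a) * qinf (a * Q) Q.
Proof.
move=> Q0 Q1; apply: qinfE; apply: (@lim_to_shiftI _ _ _ _ 1).
apply: eq_lim_to (lim_toZ (1 - a) (lim_qpoch (a * Q) Q0 Q1)) => n.
rewrite addn1 /qpoch big_nat_recl // mulr1; congr (_ * _).
by apply: eq_bigr => i _; rewrite exprS mulrA.
Qed.

Lemma qinf_opp1_neq0 Q : Q != 0 -> nrm Q < 1 -> qinf (-1) Q != 0.
Proof.
move=> Q0 Q1; rewrite qinf_shift // opprK mulN1r mulf_neq0 //.
  by rewrite (_ : 1 + 1 = 2%:R) ?pnatr_eq0.
by apply: qinf_neq0_lt1; rewrite ?nrmN.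
Qed.

(** This is read off the triple product, whose critical factor [(-1; y^2)_oo] begins with 2. *)
Lemma th_diag_neq0 y : y != 0 -> nrm y < 1 -> th y y != 0.
Proof.
move=> y0 y1; have y20 : y ^+ 2 != 0 by rewrite expf_neq0.
have y21 : nrm (y ^+ 2) < 1 by exact: nrm_sqr_lt1.
have ny21 : nrm (- y ^+ 2) < 1 by rewrite nrmN.
rewrite jacobi_triple // divff // -expr2.
by rewrite !mulf_neq0 ?(qinf_neq0_lt1 y20 y21 ny21) ?(qinf_neq0_lt1 y20 y21 y21) ?qinf_opp1_neq0.
Qed.

Section Tau.
Variables (tau eta : C) (tau0 : tau != 0) (tau1 : nrm tau < 1) (etaE : eta ^+ 2 = - tau).

Let eta0 : eta != 0.
Proof. by apply: contra_eq_neq etaE => ->; rewrite expr0n /= eq_sym oppr_eq0. Qed.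
Let eta1 : nrm eta < 1.
Proof. by apply: sqrt_lt1; rewrite etaE nrmN. Qed.
Let pw n : tau ^+ n.+1 != 0. Proof. by rewrite expf_neq0. Qed.
Let pw1 n : nrm (tau ^+ n.+1) < 1. Proof. exact: nrm_expr_lt1. Qed.
Let opw n : - tau ^+ n.+1 != 0. Proof. by rewrite oppr_eq0. Qed.
Let opw1 n : nrm (- tau ^+ n.+1) < 1. Proof. by rewrite nrmN. Qed.

Lemma qinf_opp_tau : qinf (- tau) (tau ^+ 2) =
  qinf (- tau) (tau ^+ 6) * qinf (- tau ^+ 3) (tau ^+ 6) * qinf (- tau ^+ 5) (tau ^+ 6).
Proof.
rewrite (qinf_split3 (- tau) (pw 1) (pw1 1)) -(exprM tau 2 3).
have -> : - tau * tau ^+ 2 = - tau ^+ 3 by ring.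
by have -> : - tau * (tau ^+ 2) ^+ 2 = - tau ^+ 5 by ring.
Qed.

(** Together with [theta_prod2], this exchanges the functions of base [eta^3] produced by [level15]
    for those of base [tau^3], which [th_dissect_3] can recombine. *)
Lemma theta_prod1 :
  th (tau ^+ 3) 1 = qinf (- tau) (tau ^+ 2) * th (eta ^+ 3) eta.
Proof.
have e6 : (eta ^+ 3) ^+ 2 = - tau ^+ 3 by rewrite -exprM (exprM eta 2 3) etaE; ring.
rewrite !jacobi_triple ?oner_neq0 ?expf_neq0 ?nrm_expr_lt1 // e6 qinf_opp_tau.
have -> : - (eta ^+ 3 * eta) = - tau ^+ 2.
  by rewrite -exprSr (exprM eta 2 2) etaE; ring.
have -> : - (eta ^+ 3 / eta) = tau.
  by transitivity (- eta ^+ 2); [field | rewrite etaE opprK].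
rewrite mulr1 divr1 -(exprM tau 3 2).
rewrite !(qinf_split2 _ (opw 2) (opw1 2)) !sqrrN -!(exprM tau 3 2).
rewrite (_ : - tau ^+ 2 * - tau ^+ 3 = tau ^+ 5); last by ring.
rewrite (_ : tau * - tau ^+ 3 = - tau ^+ 4); last by ring.
rewrite (_ : - tau ^+ 3 * - tau ^+ 3 = tau ^+ 6); last by ring.
have sq n : qinf (tau ^+ (n * 2)) (tau ^+ 12) = qinf (tau ^+ n) (tau ^+ 6) * qinf (- tau ^+ n) (tau ^+ 6).
  by rewrite -(qinf_sqr (pw 5) (pw1 5)) -!exprM.
have S1 := sq 1%N; have S5 := sq 5%N; have S2 := sq 2%N; have S4 := sq 4%N.
have D2 := qinf_split2 (tau ^+ 2) (pw 5) (pw1 5); have D4 := qinf_split2 (tau ^+ 4) (pw 5) (pw1 5).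
rewrite -!exprD -!exprM in D2 D4; rewrite expr1 in S1.
have N n : qinf (tau ^+ n.+1) (tau ^+ 6) != 0 by apply: qinf_neq0_lt1.
have N12 n : qinf (tau ^+ n.+1) (tau ^+ 12) != 0 by apply: qinf_neq0_lt1.
(* Euler's identity [(-x; x)_oo (x; x^2)_oo = 1] at [x = tau], with the factors whose exponent is
   divisible by 3 left out. *)
have key : qinf (- tau) (tau ^+ 6) * qinf (- tau ^+ 5) (tau ^+ 6) * (qinf tau (tau ^+ 6) * qinf (tau ^+ 5) (tau ^+ 6))
   * (qinf (- tau ^+ 2) (tau ^+ 6) * qinf (- tau ^+ 4) (tau ^+ 6)) = 1.
  apply: (mulIf (mulf_neq0 (N 1%N) (N 3%N))); rewrite mul1r [in RHS]D2 [in RHS]D4.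
  rewrite S1 S5 S2 S4; ring.
move: key; move: (qinf _ _) (qinf _ _) (qinf _ _) (qinf _ _) (qinf _ _) (qinf _ _) (qinf _ _) (qinf _ _).
move=> a b c d e f g h key.
by rewrite -[LHS]mulr1 -key; ring.
Qed.

Lemma theta_prod2 :
  2 * th (tau ^+ 3) (tau ^+ 2) = qinf (- tau) (tau ^+ 2) * th (eta ^+ 3) (eta ^+ 3).
Proof.
have e6 : (eta ^+ 3) ^+ 2 = - tau ^+ 3 by rewrite -exprM (exprM eta 2 3) etaE; ring.
have e30 : eta ^+ 3 != 0 by rewrite expf_neq0.
rewrite !jacobi_triple ?expf_neq0 ?nrm_expr_lt1 // divff // -expr2 e6 qinf_opp_tau.
rewrite opprK -(exprM tau 3 2) -(exprD tau 3 2).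
have -> : tau ^+ 3 / tau ^+ 2 = tau by field.
rewrite (qinf_shift (-1) (opw 2) (opw1 2)) opprK mulN1r opprK.
have D3 := qinf_split2 (tau ^+ 3) (opw 2) (opw1 2); rewrite sqrrN -(exprM tau 3 2) in D3.
have e36 : tau ^+ 3 * - tau ^+ 3 = - tau ^+ 6 by ring.
rewrite e36 in D3; rewrite D3.
have N3 := qinf_split2 (- tau ^+ 3) (opw 2) (opw1 2); rewrite sqrrN -(exprM tau 3 2) in N3.
have e33 : - tau ^+ 3 * - tau ^+ 3 = tau ^+ 6 by ring.
rewrite e33 in N3; rewrite N3.
have S3 := qinf_sqr (pw 5) (pw1 5) (tau ^+ 3); rewrite -(exprM tau 3 2) -(exprM tau 6 2) in S3.
have S6 := qinf_sqr (pw 5) (pw1 5) (tau ^+ 6); rewrite -(exprM tau 6 2) in S6.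
have D6 := qinf_split2 (tau ^+ 6) (pw 5) (pw1 5); rewrite -(exprM tau 6 2) -(exprD tau 6 6) in D6.
have N6 : qinf (tau ^+ 6) (tau ^+ 6) != 0 by apply: qinf_neq0_lt1.
(* Euler's identity [(-x; x)_oo (x; x^2)_oo = 1] at [x = tau^3]. *)
have key : qinf (tau ^+ 3) (tau ^+ 6) * qinf (- tau ^+ 3) (tau ^+ 6) * qinf (- tau ^+ 6) (tau ^+ 6) = 1.
  by apply: (mulIf N6); rewrite mul1r [in RHS]D6 S6 S3; ring.
move: key; move: (qinf (- tau) _) (qinf (- tau ^+ 5) _) (qinf (- tau ^+ 3) _) (qinf (tau ^+ 6) _).
move: (qinf (tau ^+ 3) _) (qinf (- tau ^+ 6) _) => a b c d e f key.
transitivity (2 * c * d * f * (a * e * b) ^+ 2); last by ring.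
by rewrite key; ring.
Qed.

End Tau.

Lemma th_phi x : x != 0 -> nrm x < 1 ->
  th x 1 = qinf (x ^+ 2) (x ^+ 2) ^+ 5 / (qinf x x ^+ 2 * qinf (x ^+ 4) (x ^+ 4) ^+ 2).
Proof.
move=> x0 x1; have pw n : x ^+ n.+1 != 0 by rewrite expf_neq0.
have pw1 n : nrm (x ^+ n.+1) < 1 by exact: nrm_expr_lt1.
have N n : qinf (x ^+ n.+1) (x ^+ n.+1) != 0 by apply: qinf_neq0_lt1.
have N1 : qinf x x != 0 by have := N 0%N; rewrite expr1.
have D1 := qinf_split2 x x0 x1; have D2 := qinf_split2 (x ^+ 2) (pw 1%N) (pw1 1%N).
have S1 := qinf_sqr (pw 1%N) (pw1 1%N) x.
rewrite -expr2 in D1; rewrite -(exprM x 2 2) -(exprD x 2 2) in D2; rewrite -(exprM x 2 2) in S1.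
rewrite jacobi_triple ?oner_neq0 // mulr1 divr1.
apply: (mulIf (mulf_neq0 (expf_neq0 2 N1) (expf_neq0 2 (N 3%N)))).
rewrite divfK ?mulf_neq0 ?expf_neq0 //.
move: D1 D2 S1 (N 1%N) (N 3%N).
move: (qinf x x) (qinf x (x ^+ 2)) (qinf (- x) (x ^+ 2)) (qinf (x ^+ 2) (x ^+ 2)).
move: (qinf (x ^+ 2) (x ^+ 4)) (qinf (x ^+ 4) (x ^+ 4)) => a b c d e f -> fE aE f0 b0.
transitivity ((d * e) ^+ 2 * b ^+ 2 * f ^+ 3); first by ring.
rewrite -aE (_ : a ^+ 2 * b ^+ 2 * f ^+ 3 = (a * b) ^+ 2 * f ^+ 3); last by ring.
by rewrite -fE; ring.
Qed.

Lemma th_q3_q2 q : q != 0 -> nrm q < 1 ->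
  th (q ^+ 3) (q ^+ 2) =
  qinf (q ^+ 2) (q ^+ 2) ^+ 2 * qinf (q ^+ 3) (q ^+ 3) * qinf (q ^+ 12) (q ^+ 12) /
  (qinf q q * qinf (q ^+ 4) (q ^+ 4) * qinf (q ^+ 6) (q ^+ 6)).
Proof.
move=> q0 q1; have pw n : q ^+ n.+1 != 0 by rewrite expf_neq0.
have pw1 n : nrm (q ^+ n.+1) < 1 by exact: nrm_expr_lt1.
have N n : qinf (q ^+ n.+1) (q ^+ n.+1) != 0 by apply: qinf_neq0_lt1.
have N1 : qinf q q != 0 by have := N 0%N; rewrite expr1.
have M3 : qinf (- q ^+ 3) (q ^+ 6) != 0 by apply: qinf_neq0_lt1; rewrite ?nrmN.
have D1 := qinf_split2 q q0 q1; rewrite -expr2 in D1.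
have D2 := qinf_split2 (q ^+ 2) (pw 1%N) (pw1 1%N); rewrite -(exprM q 2 2) -(exprD q 2 2) in D2.
have D3 := qinf_split2 (q ^+ 3) (pw 2%N) (pw1 2%N); rewrite -(exprM q 3 2) -(exprD q 3 3) in D3.
have D6 := qinf_split2 (q ^+ 6) (pw 5%N) (pw1 5%N); rewrite -(exprM q 6 2) -(exprD q 6 6) in D6.
have S1 := qinf_sqr (pw 1%N) (pw1 1%N) q; rewrite -(exprM q 2 2) in S1.
have S3 := qinf_sqr (pw 5%N) (pw1 5%N) (q ^+ 3); rewrite -(exprM q 3 2) -(exprM q 6 2) in S3.
have T1 := qinf_opp_tau q0 q1.
rewrite jacobi_triple // -(exprD q 3 2) -(exprM q 3 2).
have -> : - (q ^+ 3 / q ^+ 2) = - q by field.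
apply: (mulIf (mulf_neq0 (mulf_neq0 N1 (N 3%N)) (N 5%N))).
(* The extra factor [(-q^3; q^6)_oo] completes those at [-q] and [-q^5] to [(-q; q^2)_oo]. *)
rewrite divfK ?mulf_neq0 //; apply: (mulIf M3).
move: D1 D2 D3 D6 S1 S3 T1.
move: (qinf q q) (qinf q (q ^+ 2)) (qinf (q ^+ 2) (q ^+ 2)) (qinf (q ^+ 2) (q ^+ 4)).
move: (qinf (q ^+ 4) (q ^+ 4)) (qinf (q ^+ 3) (q ^+ 3)) (qinf (q ^+ 3) (q ^+ 6)) (qinf (- q ^+ 3) (q ^+ 6)).
move: (qinf (q ^+ 6) (q ^+ 6)) (qinf (q ^+ 6) (q ^+ 12)) (qinf (q ^+ 12) (q ^+ 12)).
move: (qinf (- q) (q ^+ 2)) (qinf (- q) (q ^+ 6)) (qinf (- q ^+ 5) (q ^+ 6)).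
move=> a b c j6 j66 j12 j4 j3 j36 m3 j1 j12' j2 j24 E1 E2 E3 E6 F1 F3 T1.
transitivity ((j12' * a) * j2 * j4 * j6 ^+ 2).
  by rewrite E1 T1; ring.
rewrite -F1; transitivity (j2 ^+ 2 * j6 ^+ 2); first by rewrite E2; ring.
transitivity (j2 ^+ 2 * (j36 * m3) * j6 * j12); last by rewrite E3; ring.
by rewrite -F3 E6; ring.
Qed.

End ProductIdentities.

(** * Solution of the linear equations *)

Section Solution.
Context {R : realType} {C : cvalField R}.
Variables (q : C) (q0 : q != 0) (q1 : nrm q < 1).

Let p := q ^+ 4.
Let p0 : p != 0. Proof. exact: expf_neq0. Qed.
Let p1 : nrm p < 1. Proof. exact: nrm_expr_lt1. Qed.
Let pE : (q ^+ 2) ^+ 2 = p. Proof. by rewrite -exprM. Qed.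

(** Every exponent in these functions is twice an odd number, so passing from [eta] to [q] puts the
    same sign [d] on both arguments, and [th_twist] removes it. *)
Lemma level15_twist (eta d : C) : d ^+ 2 = 1 -> eta ^+ 2 = d * q ^+ 2 ->
  [/\ theta_A0 eta = theta_A0 q, theta_A1 eta = theta_A1 q, theta_B0 eta = theta_B0 q & theta_B1 eta = theta_B1 q].
Proof.
move=> d2 etaE.
have pw k : eta ^+ (2 * (2 * k).+1) = d * q ^+ (2 * (2 * k).+1).
  by rewrite exprM etaE exprMn -exprM exprS exprM d2 expr1n mulr1.
have e4 : eta ^+ 4 = q ^+ 4 by rewrite (exprM eta 2 2) etaE exprMn d2 mul1r -exprM.
have tw k l : th (eta ^+ (2 * (2 * k).+1)) (- eta ^+ (2 * (2 * l).+1)) =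
    th (q ^+ (2 * (2 * k).+1)) (- q ^+ (2 * (2 * l).+1)).
  by rewrite !pw -mulrN th_twist.
rewrite /theta_A0 /theta_A1 /theta_B0 /theta_B1 e4 (tw 7 0%N) (tw 7 5%N) (tw 7 4%N) (tw 7 3%N) (tw 7 6%N) (tw 7 1%N).
by [].
Qed.

(** The right-hand sides of the theorem before the quotients of products are expanded; [theta_V1]
    carries an extra factor [q] because the second sum is [q^-1 T_1]. *)
Definition theta_V0 : C := (th (q ^+ 3) 1 * theta_A0 q + 2 * q ^+ 3 * th (q ^+ 3) (q ^+ 2) * theta_A1 q) / qinf p p ^+ 2.
Definition theta_V1 : C := q * (2 * th (q ^+ 3) (q ^+ 2) * theta_B1 q + q * th (q ^+ 3) 1 * theta_B0 q) / qinf p p ^+ 2.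

Lemma theta_V_eqn (eps eta : C) : eps ^+ 2 = 1 -> eta ^+ 2 = - (eps * q ^+ 2) ->
  th (eta ^+ 5) (- eta) * theta_V0 + eps * th (eta ^+ 5) (- eta ^+ 3) * theta_V1 =
  th q eps * euler_sum (q ^+ 2) eps * th (q ^+ 2) eps / qinf p p.
Proof.
move=> eps2 etaE; pose tau := eps * q ^+ 2.
have e0 := eps_neq0 eps2; have ne := nrm_eps eps2.
have t0 : q ^+ 2 != 0 by rewrite expf_neq0.
have t1 : nrm (q ^+ 2) < 1 := nrm_sqr_lt1 q1.
have tau0 : tau != 0 by rewrite mulf_neq0.
have tau1 : nrm tau < 1 by rewrite nrmM ne mul1r.
have tau2 : tau ^+ 2 = p by rewrite exprMn eps2 mul1r pE.
have tau3 : tau ^+ 3 = eps * q ^+ 6 by rewrite exprS tau2 /tau /p; ring.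
have etaE' : eta ^+ 2 = - tau by [].
have eta0 : eta != 0.
  by apply: contra_eq_neq etaE => ->; rewrite expr0n /= eq_sym oppr_eq0 mulf_neq0.
have eta1 : nrm eta < 1 by apply: sqrt_lt1; rewrite etaE' nrmN.
have ne2 : (- eps) ^+ 2 = 1 by rewrite sqrrN.
have etaE2 : eta ^+ 2 = - eps * q ^+ 2 by rewrite etaE mulNr.
have [a0E a1E b0E b1E] := level15_twist ne2 etaE2.
have [E0 E1] := level15 eta0 eta1; rewrite a0E b0E etaE' opprK in E0.
rewrite a1E b1E etaE' opprK in E1.
have P1 := theta_prod1 tau0 tau1 etaE'; have P2 := theta_prod2 tau0 tau1 etaE'.
have D := th_dissect_3 eps2 q0 q1.
have tw1 x : th (eps * x) 1 = th x eps.
  by rewrite -(th_twist x eps eps2) -expr2 eps2.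
have tw2 : th (tau ^+ 3) (tau ^+ 2) = th (q ^+ 6) (eps * q ^+ 4).
  rewrite tau3 tau2 -(th_twist (q ^+ 6) (eps * q ^+ 4) eps2) mulrA -expr2 eps2 mul1r //.
rewrite tw2 in P2; rewrite tau3 tw1 in P1.
have E : euler_sum (q ^+ 2) eps = qinf (- tau) p.
  by rewrite -qinf_euler // -pE mulrC.
have J : th (q ^+ 2) eps = qinf (- tau) p ^+ 2 * qinf p p.
  by rewrite -tw1 -/tau jacobi_triple ?oner_neq0 // mulr1 divr1 tau2; ring.
have pinf0 : qinf p p != 0 by apply: qinf_neq0_lt1.
have pe0 : qinf (- tau) p != 0 by apply: qinf_neq0_lt1; rewrite ?nrmN.
have twt : th tau 1 = th (q ^+ 2) eps := tw1 _.
rewrite E; rewrite tau2 in P1 P2; rewrite twt in E0 E1.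
move: P1 P2 D E0 E1 J; rewrite /theta_V0 /theta_V1.
move: (th (eta ^+ 5) (- eta)) (th (eta ^+ 5) (- eta ^+ 3)) (theta_A0 q) (theta_A1 q) (theta_B0 q) (theta_B1 q).
move: (th (q ^+ 3) 1) (th (q ^+ 3) (q ^+ 2)) (th (q ^+ 2) eps) (th (q ^+ 6) eps) (th q eps).
move: (th (q ^+ 6) (eps * q ^+ 4)) (th (eta ^+ 3) eta) (th (eta ^+ 3) (eta ^+ 3)).
move: (qinf (- tau) p) (qinf p p) pinf0 pe0 => P J J0 Pn g u v.
move=> phi f th2 th6 thq Na Nb a0 a1 b0 b1 P1 P2 D E0 E1 JE.
(* [level15] reduces the left side to the combination of [u] and [v] in [K]. Multiplied by [P], this
   combination is [th_dissect_3]. *)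
have K : phi * u + eps * q * f * v = thq * P * J.
  apply: (mulIf Pn).
  transitivity (phi * (P * u) + eps * q * f * (P * v)); first by ring.
  rewrite -P1 -P2; transitivity (thq * th2); last by rewrite JE; ring.
  by rewrite D; ring.
have q2 : q ^+ 2 = eps * tau by rewrite /tau mulrA -expr2 eps2 mul1r.
transitivity ((phi * (Na * a0 - - tau * (Nb * b0)) +
  eps * q * f * (2 * (Nb * b1 - - tau * (Na * a1)))) / J ^+ 2).
  have -> : q ^+ 3 = q * (eps * tau) by rewrite exprS q2.
  have -> : eps * Nb * (q * (2 * f * b1 + q * phi * b0) / J ^+ 2) =
    eps * Nb * (2 * q * f * b1 + (eps * tau) * phi * b0) / J ^+ 2 by rewrite -q2; field.
  transitivity ((Na * (phi * a0 + 2 * (q * (eps * tau)) * f * a1) +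
     (eps * Nb * (2 * q * f * b1) + eps ^+ 2 * tau * Nb * phi * b0)) / J ^+ 2); first by field.
  by rewrite eps2; field.
rewrite E0 E1; transitivity (th2 * (phi * u + eps * q * f * v) / J ^+ 2); first by field.
by rewrite K; field.
Qed.

(** Cramer's rule for the equations with [eps = 1], [eta = io q] and [eps = -1], [eta = q]. *)
Lemma triple_sum_theta : triple_sum q 0 = theta_V0 /\ triple_sum q 1 = theta_V1.
Proof.
pose io : C := sqrtC (-1); have io2 : io ^+ 2 = -1 by rewrite /io sqrtCK.
have io0 : io != 0 by apply: contra_eq_neq io2 => ->; rewrite expr0n eq_sym oppr_eq0 oner_eq0.
pose z := io * q.
have e1 : (1 : C) ^+ 2 = 1 by rewrite expr1n.
have z2 : z ^+ 2 = - (1 * q ^+ 2) by rewrite /z exprMn io2 mul1r mulN1r.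
have q2 : q ^+ 2 = - (-1 * q ^+ 2) by rewrite mulN1r opprK.
have Tp := triple_sum_eqn q0 q1 e1 z2; have Tn := triple_sum_eqn q0 q1 sqrN1 q2.
have Vp := theta_V_eqn e1 z2; have Vn := theta_V_eqn sqrN1 q2.
rewrite pE in Tp Tn.
have D := th_lattice_5 io2 (erefl : z = io * q) q0 q1.
have nz : nrm z < 1 by apply: sqrt_lt1; rewrite z2 nrmN mul1r nrm_sqr_lt1.
have z0 : z != 0 by rewrite mulf_neq0.
have Dn : th q q * th z z != 0 by rewrite mulf_neq0 ?th_diag_neq0.
move: Dn; rewrite -D => Dn.
rewrite -Vp in Tp; rewrite -Vn in Tn; move: Tp Tn Dn.
move: (th (q ^+ 5) (- q)) (th (q ^+ 5) (- q ^+ 3)) (th (z ^+ 5) (- z)) (th (z ^+ 5) (- z ^+ 3)).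
move: (triple_sum q 0) (triple_sum q 1) theta_V0 theta_V1 => T0 T1 v0 v1 a b c d Tp Tn Dn.
have E0 : (2 * (a * d + c * b)) * (T0 - v0) = 0.
  transitivity (2 * (b * ((c * T0 + 1 * d * T1) - (c * v0 + 1 * d * v1)) +
    d * ((a * T0 + -1 * b * T1) - (a * v0 + -1 * b * v1)))); first by ring.
  by rewrite Tp Tn !subrr; ring.
have E1 : (2 * (a * d + c * b)) * (T1 - v1) = 0.
  transitivity (2 * (a * ((c * T0 + 1 * d * T1) - (c * v0 + 1 * d * v1)) -
    c * ((a * T0 + -1 * b * T1) - (a * v0 + -1 * b * v1)))); first by ring.
  by rewrite Tp Tn !subrr; ring.
by split; apply/eqP; rewrite -subr_eq0; [move/eqP: E0 | move/eqP: E1]; rewrite mulf_eq0 (negPf Dn).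
Qed.

Lemma theta_mod60 (a b c : nat) : (c = 30 + a)%N -> (b + a = 30)%N ->
  th (q ^+ 30) (- q ^+ a) = qinf (q ^+ b) (q ^+ 60) * qinf (q ^+ c) (q ^+ 60) * qinf (q ^+ 60) (q ^+ 60).
Proof.
move=> -> ba; have qa : - q ^+ a != 0 by rewrite oppr_eq0 expf_neq0.
rewrite jacobi_triple ?expf_neq0 ?nrm_expr_lt1 // -(exprM q 30 2) mulrN opprK -exprD.
have -> : - (q ^+ 30 / - q ^+ a) = q ^+ b.
  by rewrite -ba exprD; field; rewrite expf_neq0.
by rewrite [qinf (q ^+ _) _ * _]mulrC.
Qed.

End Solution.

Section ProductForm.
Context {R : realType} {C : cvalField R}.
Variables (q : C) (q0 : q != 0) (q1 : nrm q < 1).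

Let j (m : nat) : C := qinf (q ^+ m) (q ^+ m).
Let jp (a b : nat) : C := qinf (q ^+ a) (q ^+ 60) * qinf (q ^+ b) (q ^+ 60) * j 60.

Let j0 m : j m.+1 != 0.
Proof. by apply: qinf_neq0_lt1; rewrite ?expf_neq0 ?nrm_expr_lt1. Qed.

Let phiE : th (q ^+ 3) 1 = j 6 ^+ 5 / (j 3 ^+ 2 * j 12 ^+ 2).
Proof. by rewrite th_phi ?expf_neq0 ?nrm_expr_lt1 // -!exprM. Qed.

Let fE : th (q ^+ 3) (q ^+ 2) = j 2 ^+ 2 * j 3 * j 12 / (j 1 * j 4 * j 6).
Proof. by rewrite th_q3_q2 // /j expr1. Qed.

Lemma triple_sum0E : triple_sum q 0 =
  j 6 ^+ 5 * jp 28 32 / (j 3 ^+ 2 * j 4 ^+ 2 * j 12 ^+ 2)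
  + 2 * q ^+ 3 * (j 2 ^+ 2 * j 3 * j 12 * jp 12 48 / (j 1 * j 4 ^+ 3 * j 6))
  - q ^+ 4 * (j 6 ^+ 5 * jp 8 52 / (j 3 ^+ 2 * j 4 ^+ 2 * j 12 ^+ 2)).
Proof.
have [-> _] := triple_sum_theta q0 q1; rewrite /theta_V0 phiE fE /theta_A0 /theta_A1.
have M a b c := @theta_mod60 _ _ q q0 q1 a b c.
rewrite (M 2%N 28%N 32%N) // (M 22%N 8%N 52%N) // (M 18%N 12%N 48%N) //.
rewrite -/(j 4) -/(j 60) -/(jp 28 32) -/(jp 8 52) -/(jp 12 48).
move: (j0 0) (j0 2) (j0 3) (j0 5) (j0 11).
move: (j 1) (j 2) (j 3) (j 4) (j 6) (j 12) (jp 28 32) (jp 8 52) (jp 12 48).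
by move=> *; field; do ?[apply/andP; split].
Qed.

Lemma triple_sum1E : q^-1 * triple_sum q 1 =
  2 * (j 2 ^+ 2 * j 3 * j 12 * jp 24 36 / (j 1 * j 4 ^+ 3 * j 6))
  + q * (j 6 ^+ 5 * jp 16 44 / (j 3 ^+ 2 * j 4 ^+ 2 * j 12 ^+ 2))
  + q ^+ 5 * (j 6 ^+ 5 * jp 4 56 / (j 3 ^+ 2 * j 4 ^+ 2 * j 12 ^+ 2)).
Proof.
have [_ ->] := triple_sum_theta q0 q1; rewrite /theta_V1 phiE fE /theta_B0 /theta_B1.
have M a b c := @theta_mod60 _ _ q q0 q1 a b c.
rewrite (M 6%N 24%N 36%N) // (M 14%N 16%N 44%N) // (M 26%N 4%N 56%N) //.
rewrite -/(j 4) -/(j 60) -/(jp 24 36) -/(jp 16 44) -/(jp 4 56).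
move: (j0 0) (j0 2) (j0 3) (j0 5) (j0 11).
move: (j 1) (j 2) (j 3) (j 4) (j 6) (j 12) (jp 24 36) (jp 16 44) (jp 4 56).
by move=> *; field; do ?[apply/andP; split].
Qed.

Lemma has_sum_triple0 :
  has_sum (fun t : nat * nat * nat => let: i := t.1.1 in let: l := t.1.2 in let: k := t.2 in
    q ^ (3 * i%:Z ^+ 2 + 3 * l%:Z ^+ 2 + 3 * k%:Z ^+ 2
         - 2 * i%:Z * l%:Z - 2 * i%:Z * k%:Z - 2 * l%:Z * k%:Z)
    / (qpoch (q ^+ 4) (q ^+ 4) i * qpoch (q ^+ 4) (q ^+ 4) l * qpoch (q ^+ 4) (q ^+ 4) k))
  (triple_sum q 0).
Proof.
apply: has_sum_eq (has_sum_triple q0 q1 0) => -[[i l] k] /=.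
rewrite /triple_term -exprM; congr (_ ^ _ / _); ring.
Qed.

Lemma has_sum_triple1 :
  has_sum (fun t : nat * nat * nat => let: i := t.1.1 in let: l := t.1.2 in let: k := t.2 in
    q ^ (3 * i%:Z ^+ 2 + 3 * l%:Z ^+ 2 + 3 * k%:Z ^+ 2
         - 2 * i%:Z * l%:Z - 2 * i%:Z * k%:Z - 2 * l%:Z * k%:Z
         - 2 * i%:Z + 2 * l%:Z - 2 * k%:Z)
    / (qpoch (q ^+ 4) (q ^+ 4) i * qpoch (q ^+ 4) (q ^+ 4) l * qpoch (q ^+ 4) (q ^+ 4) k))
  (q^-1 * triple_sum q 1).
Proof.
apply: has_sum_eq (has_sumZ q^-1 (has_sum_triple q0 q1 1)) => -[[i l] k] /=.
rewrite /triple_term -exprM [q^-1 * _]mulrA -[q^-1]exprN1 -expfzDr //; congr (_ ^ _ / _); ring.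
Qed.

End ProductForm.

(** * Transfer to the topology used in the statement *)

Lemma cvg_limP (C : numFieldType) (u : nat -> C) (l : C) :
  (forall e, 0 < e -> exists N, forall n, (N <= n)%N -> `|u n - l| < e) ->
  lim (u @ \oo)%classic = l.
Proof.
move=> H; apply/cvg_lim; first exact: norm_hausdorff.
by apply/cvgrPdist_lt => e /H[N HN]; exists N => // n /= /HN; rewrite distrC.
Qed.

Lemma sums_to3P (C : numFieldType) (f : nat -> nat -> nat -> C) (s : C) :
  (forall e, 0 < e -> exists A : {fset nat * nat * nat},
     forall B : {fset nat * nat * nat}, (A `<=` B)%fset ->
       `|\sum_(t <- B) f t.1.1 t.1.2 t.2 - s| < e) ->
  sums_to3 f s.
Proof.
move=> H; have FF : ProperFilter (@totally (nat * nat * nat)%type) := totally_filter.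
rewrite /sums_to3; apply/cvgrPdist_lt => e /H[A HA].
exists A => // B /= AB; rewrite distrC /partial_sum.
by rewrite -(big_seq_fsetE _ B xpredT (fun t => f t.1.1 t.1.2 t.2)); exact: HA.
Qed.

Section Complex.
Context {R : realType}.
Local Notation C := (complex_cvalField R).

(** In the partial order of [R[i]] a positive element is real, so the tolerances of the topology on
    the complex numbers reduce to real ones. *)
Lemma gt0_Re (e : R[i]) : 0 < e -> 0 < complex.Re e.
Proof. by move=> e0; move: (e0); rewrite -{1}(RRe_real (gtr0_real e0)) ltcR. Qed.

Lemma ltr_norm_Re (x e : R[i]) : 0 < e -> (`|x| < e) = (nrm (x : C) < complex.Re e).
Proof. by move=> e0; rewrite nrmE -{1}(RRe_real (gtr0_real e0)) ltcR. Qed.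

Lemma qpoch_infE (a Q : R[i]) : Q != 0 -> nrm (Q : C) < 1 ->
  qpoch_inf a Q = qinf (a : C) Q.
Proof.
move=> Q0 Q1; apply: cvg_limP => e e0.
have [N HN] := lim_qpoch (C := C) a Q0 Q1 (gt0_Re e0); exists N => n /HN.
by rewrite ltr_norm_Re.
Qed.

Lemma has_sum_sums_to3 (f : nat -> nat -> nat -> R[i]) (s : R[i]) :
  has_sum (fun t : nat * nat * nat => f t.1.1 t.1.2 t.2 : C) (s : C) -> sums_to3 f s.
Proof.
move=> H; apply: sums_to3P => e e0.
have [A HA] := H _ (gt0_Re e0); exists A => B /HA.
by rewrite ltr_norm_Re.
Qed.

End Complex.
Theorem theorem1p1 (R : realType) (q : R[i]) (q_gt0 : 0 < `|q|)
    (q_lt1 : `|q| < 1) :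
  sums_to3 (fun i j k : nat =>
      q ^ (3 * i%:Z ^+ 2 + 3 * j%:Z ^+ 2 + 3 * k%:Z ^+ 2
           - 2 * i%:Z * j%:Z - 2 * i%:Z * k%:Z - 2 * j%:Z * k%:Z)
      / (qpoch (q ^+ 4) (q ^+ 4) i * qpoch (q ^+ 4) (q ^+ 4) j
         * qpoch (q ^+ 4) (q ^+ 4) k))
    (J q 6 ^+ 5 * Jp q 28 60 / (J q 3 ^+ 2 * J q 4 ^+ 2 * J q 12 ^+ 2)
     + 2 * q ^+ 3 * (J q 2 ^+ 2 * J q 3 * J q 12 * Jp q 12 60
                     / (J q 1 * J q 4 ^+ 3 * J q 6))
     - q ^+ 4 * (J q 6 ^+ 5 * Jp q 8 60
                 / (J q 3 ^+ 2 * J q 4 ^+ 2 * J q 12 ^+ 2)))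
  /\
  sums_to3 (fun i j k : nat =>
      q ^ (3 * i%:Z ^+ 2 + 3 * j%:Z ^+ 2 + 3 * k%:Z ^+ 2
           - 2 * i%:Z * j%:Z - 2 * i%:Z * k%:Z - 2 * j%:Z * k%:Z
           - 2 * i%:Z + 2 * j%:Z - 2 * k%:Z)
      / (qpoch (q ^+ 4) (q ^+ 4) i * qpoch (q ^+ 4) (q ^+ 4) j
         * qpoch (q ^+ 4) (q ^+ 4) k))
    (2 * (J q 2 ^+ 2 * J q 3 * J q 12 * Jp q 24 60
          / (J q 1 * J q 4 ^+ 3 * J q 6))
     + q * (J q 6 ^+ 5 * Jp q 16 60
            / (J q 3 ^+ 2 * J q 4 ^+ 2 * J q 12 ^+ 2))
     + q ^+ 5 * (J q 6 ^+ 5 * Jp q 4 60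
                 / (J q 3 ^+ 2 * J q 4 ^+ 2 * J q 12 ^+ 2))).
Proof.
pose C := complex_cvalField R.
have q0 : (q : C) != 0 by rewrite -normr_gt0.
have q1 : nrm (q : C) < 1 by move: q_lt1; rewrite nrmE ltcR.
(* The integer exponents [60 - a] in [Jp] compute to natural numbers, so this also covers those
   factors. *)
have QE a m : qpoch_inf (q ^+ a) (q ^+ m.+1) = qinf ((q : C) ^+ a) ((q : C) ^+ m.+1).
  by apply: qpoch_infE; [exact: expf_neq0 | exact: nrm_expr_lt1].
split; apply: has_sum_sums_to3.
  have H := has_sum_triple0 q0 q1; rewrite triple_sum0E // in H.
  by rewrite /Jp /J !QE.
have H := has_sum_triple1 q0 q1; rewrite triple_sum1E // in H.
by rewrite /Jp /J !QE.
Qed.
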